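(* Let $\omega\in L^\infty(\mathbb{T})$ be a symbol satisfying the symmetry condition $\overline{\omega(\mu)}=\omega(\overline\mu)$, $\mu\in\mathbb{T}$, such that $\operatorname{sing\,supp}\omega$ does not contain the points $1$ and $-1$, and such that the Hankel operator $H(\omega)$ is compact. Then for any $p>0$, $$\Delta_p^+(H(\omega))=\Delta_p^-(H(\omega))=\tfrac12\Delta_p(H(\omega)),$$ $$\delta_p^+(H(\omega))=\delta_p^-(H(\omega))=\tfrac12\delta_p(H(\omega)).$$
   Context: $\mathbb{T}$ is the unit circle in $\mathbb{C}$ with normalized Lebesgue measure; $H^2(\mathbb{T})\subset L^2(\mathbb{T})$ is the closed subspace spanned by $1,\mu,\mu^2,\dots$; $P_+$ is the orthogonal projection of $L^2(\mathbb{T})$ onto $H^2(\mathbb{T})$; $(Wf)(\mu)=f(\overline\mu)$. For $\omega\in L^\infty(\mathbb{T})$ the Hankel operator with symbol $\omega$ is $H(\omega)f=P_+(\omega Wf)$, $f\in H^2(\mathbb{T})$; it is self-adjoint under the symmetry condition. The singular support $\operatorname{sing\,supp}\omega$ is the smallest closed set $X\subset\mathbb{T}$ such that $\omega\in C^\infty(\mathbb{T}\setminus X)$. For a compact self-adjoint operator $A$, $\{\lambda_n^+(A)\}_{n\ge1}$ is the non-increasing sequence of positive eigenvalues of $A$, counted with multiplicities and appended by zeros if there are only finitely many; $\lambda_n^-(A)=\lambda_n^+(-A)$; $s_n(A)=\lambda_n^+(|A|)$, $|A|=\sqrt{A^*A}$, are the singular values. For $p>0$, $$\Delta_p(A)=\limsup_{n\to\infty}ns_n(A)^p,\quad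 \delta_p(A)=\liminf_{n\to\infty}ns_n(A)^p,$$ $$\Delta_p^\pm(A)=\limsup_{n\to\infty}n\lambda_n^\pm(A)^p,\quad \delta_p^\pm(A)=\liminf_{n\to\infty}n\lambda_n^\pm(A)^p,$$ with values in $[0,\infty]$. *)

(* Defs.v *)
From HB Require Import structures.
From mathcomp Require Import all_boot all_order all_algebra.
From mathcomp Require Import generic_quotient ring_quotient sesquilinear.
From mathcomp Require Import all_classical all_reals all_analysis.
From mathcomp Require Import complex ring.

Set Implicit Arguments.
Unset Strict Implicit.
Unset Printing Implicit Defensive.
Import Order.TTheory GRing.Theory Num.Theory.
Import numFieldNormedType.Exports.

Local Open Scope classical_set_scope.
Local Open Scope ring_scope.
Local Open Scope complex_scope.

Record circle (R : realType) :=
  Circle { circle_val :> R[i]; circle_norm : `|circle_val| == 1 }.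

Section circle_structure.
Variable R : realType.

HB.instance Definition _ := [isSub for @circle_val R].
HB.instance Definition _ := [Choice of circle R by <:].

Lemma expi_subproof (t : R) : `|cos t +i* sin t| == 1.
Proof. by rewrite normc_def /= cos2Dsin2 sqrtr1. Qed.
Definition expi (t : R) : circle R := Circle (expi_subproof t).

Definition circle1 : circle R := Circle (introT eqP (normr1 _)).
Lemma circleN1_subproof : `|-1 : R[i]| == 1.
Proof. by rewrite normrN1. Qed.
Definition circleN1 : circle R := Circle circleN1_subproof.

Lemma circle_conj_subproof (z : circle R) : `|(z : R[i])^*| == 1.
Proof. by case: z => -[a b] /=; rewrite !normc_def /= sqrrN. Qed.
Definition circle_conj (z : circle R) : circle R :=
  Circle (circle_conj_subproof z).

HB.instance Definition _ := isPointed.Build (circle R) circle1.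
HB.instance Definition _ :=
  Topological.copy (circle R)
    (initial_topology (@circle_val R : circle R -> R[i]^o)).

(* [expi] restricts to a Borel isomorphism from [0, 2pi[ onto the circle, so
   this is the Borel sigma-algebra of the circle. *)
Definition circle_measurable : set (set (circle R)) :=
  image_set_system setT expi (@measurable _ (measurableTypeR R)).

Let circle_measurable_sigma : sigma_algebra setT circle_measurable.
Proof. by apply: sigma_algebra_image; exact: sigma_algebra_measurable. Qed.

Let circle_measurable0 : circle_measurable set0.
Proof. by case: circle_measurable_sigma. Qed.

Let circle_measurableC A : circle_measurable A -> circle_measurable (~` A).
Proof.
by rewrite -setTD; case: circle_measurable_sigma => _ + _; apply.
Qed.

Let circle_measurable_bigcup (F : (set (circle R))^nat) :
  (forall i, circle_measurable (F i)) -> circle_measurable (\bigcup_i F i).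
Proof. by case: circle_measurable_sigma => _ _; exact. Qed.

HB.instance Definition _ := isMeasurable.Build default_measure_display
  (circle R) circle_measurable0 circle_measurableC circle_measurable_bigcup.

(* [expi] with a domain carrying the measurable structure on which the
   Lebesgue measure is defined *)
Definition mexpi (t : measurableTypeR R) : circle R := expi t.
Lemma measurable_mexpi : measurable_fun setT mexpi.
Proof. by move=> _ A mA. Qed.
HB.instance Definition _ := isMeasurableFun.Build _ _ _ _ mexpi measurable_mexpi.

Lemma lt0_2pi : 0 < pi *+ 2 :> R.
Proof. by rewrite mulrn_wgt0// pi_gt0. Qed.

(* normalized arc length: the law of exp(i t), with t uniform on [0, 2pi] *)
Definition arc_measure : probability (circle R) R :=
  distribution (uniform_prob lt0_2pi) mexpi.

End circle_structure.
Arguments circle1 {R}.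
Arguments circleN1 {R}.
Arguments arc_measure {R}.

Section hilbert.
Variables (R : realType) (V : lmodType R[i]) (dot : {dot V for Num.conj}).
Implicit Types (A B : V -> V) (x y : V).

Definition hnorm x : R := Num.sqrt (complex.Re (dot x x)).

(* norm closure of the set of finite linear combinations of the [e i] *)
Definition closed_span (I : Type) (e : I -> V) : {pred V} :=
  [pred x | `[< forall eps : R, 0 < eps -> exists s : seq (R[i] * I),
                  hnorm (x - \sum_(c <- s) c.1 *: e c.2) < eps >]].

Let dotRe x : dot x x = (hnorm x ^+ 2)%:C.
Proof.
have := dnorm_ge0 dot x; rewrite /hnorm.
case: (dot x x) => a b; rewrite lecE /= => /andP[/eqP -> a0].
by rewrite sqr_sqrtr.
Qed.

Let hnorm_comb a x y :
  hnorm (a *: x + y) ^+ 2 <=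
  2 * (complex.Re `|a| ^+ 2 * hnorm x ^+ 2 + hnorm y ^+ 2).
Proof.
have aE : `|a| = (complex.Re `|a|)%:C by rewrite normc_def.
have : dot (a *: x + y) (a *: x + y) <= 2 * (`|a| ^+ 2 * dot x x + dot y y).
  rewrite -dnormZ -subr_ge0.
  have := dnorm_ge0 dot (a *: x - y); rewrite dnormB dnormD.
  by congr (0 <= _); ring.
rewrite !dotRe aE -lecR; congr (_ <= _).
by rewrite !(rmorphM (real_complex R), rmorphD (real_complex R),
             rmorphXn (real_complex R), rmorph_nat (real_complex R)).
Qed.

Lemma closed_span_submod_closed I (e : I -> V) : submod_closed (closed_span e).
Proof.
split=> [|a x y /asboolP xe /asboolP ye]; apply/asboolP => eps eps0.
  exists [::]; rewrite big_nil subr0 /hnorm linear0l.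
  by rewrite sqrtr0.
pose na := complex.Re `|a|.
have na0 : 0 <= na by rewrite /na normc_def /= sqrtr_ge0.
pose d := eps / (2 * (na + 1)).
have d0 : 0 < d by rewrite divr_gt0// mulr_gt0// ltr_wpDl.
have [s xs] := xe d d0; have [t yt] := ye d d0.
exists ([seq (a * c.1, c.2) | c <- s] ++ t).
rewrite big_cat big_map /=.
under eq_bigr do rewrite -scalerA.
rewrite -scaler_sumr opprD addrACA -scalerBr.
rewrite -(@ltr_pXn2r _ 2)// ?nnegrE ?sqrtr_ge0 ?(ltW eps0)//.
apply: (le_lt_trans (hnorm_comb _ _ _)); rewrite -/na.
apply: (@le_lt_trans _ _ (2 * (na ^+ 2 * d ^+ 2 + d ^+ 2))).
  rewrite ler_pM2l// lerD//; last first.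
    by rewrite ltW// ltr_pXn2r// ?nnegrE ?sqrtr_ge0 ?(ltW d0).
  rewrite ler_wpM2l ?sqr_ge0//.
  by rewrite ltW// ltr_pXn2r// ?nnegrE ?sqrtr_ge0 ?(ltW d0).
have -> : eps = d * (2 * (na + 1)) by rewrite divfK// gt_eqF// mulr_gt0// ltr_wpDl.
have d20 : 0 < d ^+ 2 by rewrite exprn_gt0.
move: (d) (na) d20 na0 => u v u0 v0; rewrite -subr_gt0.
rewrite (_ : _ - _ = u ^+ 2 * (2 * v ^+ 2 + 8 * v + 2)); last by ring.
by rewrite mulr_gt0// ltr_wpDl// addr_ge0// mulr_ge0 ?sqr_ge0.
Qed.

HB.instance Definition _ I (e : I -> V) := GRing.isSubmodClosed.Build _ _
  (closed_span e) (closed_span_submod_closed e).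

Definition compact_op A := forall u : nat -> V,
  (exists M : R, forall n, hnorm (u n) <= M) ->
  exists (phi : nat -> nat) (y : V), (forall n, (phi n < phi n.+1)%N) /\
    (fun n => hnorm (A (u (phi n)) - y)) @ \oo --> (0 : R).

(* In the next definitions [xget] returns the unique element of the set; its
   default value is only returned when there is none (on a Hilbert space, every
   bounded operator has an adjoint and every bounded positive one a positive
   square root). *)
Definition adjoint A : V -> V :=
  xget (fun=> 0) [set B | forall x y, dot (A x) y = dot x (B y)].

Definition sqrt_op A : V -> V :=
  xget (fun=> 0) [set B | [/\ linear B, forall x, 0 <= dot (B x) x &
                             forall x, B (B x) = A x]].

Definition abs_op A : V -> V := sqrt_op (adjoint A \o A).

End hilbert.

Section eigenvalues.
Variables (R : realType) (V : lmodType R[i]).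
Implicit Types (A : V -> V) (E : set V).

Definition eigspace A (t : R) : set V := [set x | A x = t%:C *: x].

Definition has_dim E (k : nat) := exists e : 'I_k -> V,
  (forall x, E x <-> exists c : 'I_k -> R[i], x = \sum_i c i *: e i) /\
  (forall c : 'I_k -> R[i], \sum_i c i *: e i = 0 -> forall i, c i = 0).

(* [lam] lists the positive eigenvalues of [A] in non-increasing order, each
   value occurring as many times as the dimension of its eigenspace; the only
   other value it may take is 0, which then fills the tail. This determines
   [lam], and such a [lam] exists when [A] is compact and self-adjoint. *)
Definition enumerates_pos_eigenvalues A (lam : nat -> R) :=
  [/\ forall n, lam n.+1 <= lam n,
      forall n, 0 <= lam n &
      forall t, 0 < t -> exists k,
        has_dim (eigspace A t) k /\ ([set n | lam n = t] #= `I_k)%card].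

Definition lambda_plus A : nat -> R :=
  xget (fun=> 0) [set lam | enumerates_pos_eigenvalues A lam].

Definition lambda_minus A : nat -> R := lambda_plus (fun x => - A x).

End eigenvalues.

Section asymptotics.
Variables (R : realType) (V : lmodType R[i]) (dot : {dot V for Num.conj}).
Implicit Types (A : V -> V) (p : R).

Definition singular_values A : nat -> R := lambda_plus (abs_op dot A).

(* Sequences are indexed from 0, so that [u n] is the (n+1)-st term. *)
Definition power_limsup p (u : nat -> R) : \bar R :=
  limn_esup (fun n => (n.+1%:R * u n `^ p)%:E).

Definition power_liminf p (u : nat -> R) : \bar R :=
  limn_einf (fun n => (n.+1%:R * u n `^ p)%:E).

Definition Delta p A := power_limsup p (singular_values A).
Definition delta p A := power_liminf p (singular_values A).
Definition Delta_plus p A := power_limsup p (lambda_plus A).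
Definition delta_plus p A := power_liminf p (lambda_plus A).
Definition Delta_minus p A := power_limsup p (lambda_minus A).
Definition delta_minus p A := power_liminf p (lambda_minus A).

End asymptotics.

Section function_spaces.
Variable R : realType.
Notation T := (circle R).
Notation C := R[i].
Notation m := (@arc_measure R).

(* for p >= 1: complex functions whose real and imaginary parts are in L^p *)
Definition Lp (p : \bar R) : {pred T -> C} :=
  [pred f | (@complex.Re R \o f \in Lfun m p) && (@complex.Im R \o f \in Lfun m p)].

Lemma Lp2_submod_closed : submod_closed (Lp 2%:E).
Proof.
have p1 : (1 <= 2%:E :> \bar R)%E by rewrite lee_fin ler1n.
have [L0 L2ZD] := Lfun_submod_closed m p1.
split.
  by apply/andP; split; rewrite (_ : _ \o _ = 0).
move=> [a b] f g /andP[fr fi] /andP[gr gi]; apply/andP; split.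
  rewrite (_ : _ \o _ = a *: (@complex.Re R \o f) +
     ((- b) *: (@complex.Im R \o f) + (@complex.Re R \o g))).
    by apply: (L2ZD) => //; apply: (L2ZD).
  apply/funext => z; rewrite /= !fctE /= ![in RHS]/(_ *: _) /=.
  by case: (f z) (g z) => ? ? [? ?] /=; rewrite addrA mulNr.
rewrite (_ : _ \o _ = a *: (@complex.Im R \o f) +
   (b *: (@complex.Re R \o f) + (@complex.Im R \o g))).
  by apply: (L2ZD) => //; apply: (L2ZD).
apply/funext => z; rewrite /= !fctE /= ![in RHS]/(_ *: _) /=.
by case: (f z) (g z) => ? ? [? ?] /=; rewrite addrA.
Qed.
HB.instance Definition _ := GRing.isSubmodClosed.Build _ _ (Lp 2%:E)
  Lp2_submod_closed.

Record L2_fun := L2Fun { L2_val :> T -> C; L2_valP : L2_val \in Lp 2%:E }.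
HB.instance Definition _ := [isSub for L2_val].
HB.instance Definition _ := [Choice of L2_fun by <:].
HB.instance Definition _ := [SubChoice_isSubLmodule of L2_fun by <:].

Definition ae0 : {pred L2_fun} :=
  [pred f : L2_fun | `[< {ae m, forall z, f z = 0} >]].

Lemma ae0_submod_closed : submod_closed ae0.
Proof.
split; first by apply/asboolP; apply: nearW.
move=> a f g /asboolP f0 /asboolP g0; apply/asboolP.
near=> z; rewrite /= /GRing.scale /= !fctE /=.
rewrite (near f0 z)// (near g0 z)// scaler0 addr0//.
Unshelve. all: by end_near. Qed.
HB.instance Definition _ := GRing.isSubmodClosed.Build _ _ ae0
  ae0_submod_closed.

(* classes of square-integrable functions modulo equality almost everywhere *)
Definition L2 : Type := Quotient.quot ae0.
HB.instance Definition _ := GRing.Zmodule.on L2.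
HB.instance Definition _ := EqQuotient.on L2.

Local Open Scope quotient_scope.

Lemma L2_eqP (f g : L2_fun) :
  reflect {ae m, forall z, f z = g z} (\pi_L2 f == \pi_L2 g).
Proof.
rewrite -[_ == _](Quotient.idealrBE ae0 f g); apply: (iffP (asboolP _)) => fg;
  apply: filterS fg => z.
  by move/eqP; rewrite subr_eq0 => /eqP.
by move=> fgz; apply/eqP; rewrite subr_eq0; apply/eqP.
Qed.

Lemma L2_repr_pi (f : L2_fun) : {ae m, forall z, repr (\pi_L2 f) z = f z}.
Proof. by apply/L2_eqP; rewrite reprK. Qed.

Definition L2_scale (a : C) (f : L2) : L2 := \pi_L2 (a *: repr f).

Lemma L2_scaleE a f : L2_scale a (\pi_L2 f) = \pi_L2 (a *: f).
Proof.
apply/eqP/L2_eqP; have := L2_repr_pi f; apply: filterS => z.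
by rewrite /GRing.scale /= /GRing.scale /= => ->.
Qed.

Let L2_piD (f g : L2_fun) : \pi_L2 (f + g) = \pi_L2 f + \pi_L2 g :> L2.
Proof. by rewrite !piE. Qed.

Lemma L2_scaleA a b f : L2_scale a (L2_scale b f) = L2_scale (a * b) f.
Proof. by elim/quotW: f => f; rewrite (L2_scaleE b) !L2_scaleE scalerA. Qed.

Lemma L2_scale1 : left_id 1 L2_scale.
Proof. by elim/quotW => f; rewrite L2_scaleE scale1r. Qed.

Lemma L2_scaleDr : right_distributive L2_scale +%R.
Proof.
move=> a; elim/quotW => f; elim/quotW => g.
by rewrite !L2_scaleE -!L2_piD L2_scaleE scalerDr.
Qed.

Lemma L2_scaleDl f : {morph L2_scale^~ f : a b / a + b}.
Proof.
by elim/quotW: f => f a b; rewrite !L2_scaleE -L2_piD scalerDl.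
Qed.

HB.instance Definition _ := GRing.Zmodule_isLmodule.Build C L2
  L2_scaleA L2_scale1 L2_scaleDr L2_scaleDl.

Definition arc_integral (f : T -> C) : C :=
  (\int[m]_z complex.Re (f z)) +i* (\int[m]_z complex.Im (f z)).

Definition L2_dot (f g : L2) : C := arc_integral (fun z => repr f z * (repr g z)^*).

Let L1_int f : f \in Lfun m 1 -> m.-integrable setT (EFin \o f).
Proof. by move/Lfun1_integrable. Qed.

Lemma Lp1_mul_conj f g : f \in Lp 2%:E -> g \in Lp 2%:E ->
  (fun z => f z * (g z)^*) \in Lp 1.
Proof.
have [_ L1ZD] := Lfun_submod_closed m (lexx 1%E).
move=> /andP[fr fi] /andP[gr gi]; apply/andP; split.
  rewrite (_ : _ \o _ = 1 *: ((@complex.Re R \o f) \* (@complex.Re R \o g)) +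
    ((@complex.Im R \o f) \* (@complex.Im R \o g))).
    by apply: L1ZD; exact: Lfun2_mul_Lfun1.
  rewrite scale1r; apply/funext => z; rewrite !fctE /=.
  by case: (f z) (g z) => ? ? [? ?] /=; rewrite mulrN opprK.
rewrite (_ : _ \o _ = (- 1) *: ((@complex.Re R \o f) \* (@complex.Im R \o g)) +
  ((@complex.Im R \o f) \* (@complex.Re R \o g))).
  by apply: L1ZD; exact: Lfun2_mul_Lfun1.
rewrite scaleN1r; apply/funext => z; rewrite !fctE /=.
by case: (f z) (g z) => ? ? [? ?] /=; rewrite mulrN.
Qed.

Lemma arc_integral_linear a f g : f \in Lp 1 -> g \in Lp 1 ->
  arc_integral (fun z => a * f z + g z) = a * arc_integral f + arc_integral g.
Proof.
have [L10 L1ZD] := Lfun_submod_closed m (lexx 1%E).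
have L1Z c h : h \in Lfun m 1 -> c *: h \in Lfun m 1.
  by move=> hL; rewrite -[_ *: _]addr0; exact: (L1ZD).
case: a => a b /andP[fr fi] /andP[gr gi].
have intlin c d h1 h2 h3 : h1 \in Lfun m 1 -> h2 \in Lfun m 1 ->
    h3 \in Lfun m 1 -> \int[m]_z (c * h1 z + (d * h2 z + h3 z)) =
    c * (\int[m]_z h1 z) + (d * (\int[m]_z h2 z) + \int[m]_z h3 z) :> R.
  move=> h1L h2L h3L.
  rewrite RintegralD//; last 2 first.
  - by apply: L1_int; exact: (L1Z c).
  - by apply: L1_int; exact: L1ZD.
  rewrite RintegralZl//; last exact: L1_int.
  rewrite RintegralD//; last 2 first.
  - by apply: L1_int; exact: (L1Z d).
  - exact: L1_int.
  by rewrite RintegralZl//; exact: L1_int.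
rewrite /arc_integral; apply/eqP; rewrite eq_complex /=; apply/andP; split; apply/eqP.
  rewrite -addrA -mulNr -intlin//; apply: eq_Rintegral => z _.
  by case: (f z) (g z) => ? ? [? ?] /=; rewrite addrA mulNr.
rewrite -addrA -intlin//; apply: eq_Rintegral => z _.
by case: (f z) (g z) => ? ? [? ?] /=; rewrite addrA.
Qed.

Lemma arc_integral_conj f : f \in Lp 1 ->
  arc_integral (fun z => (f z)^*) = (arc_integral f)^*.
Proof.
move=> /andP[fr fi]; apply/eqP; rewrite eq_complex /=; apply/andP; split; apply/eqP.
  by apply: eq_Rintegral => z _; case: (f z).
rewrite -mulN1r -RintegralZl//; last exact: L1_int.
by apply: eq_Rintegral => z _; case: (f z) => ? ? /=; rewrite mulN1r.
Qed.

Lemma arc_integral_ae f g : f \in Lp 1 -> g \in Lp 1 ->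
  {ae m, forall z, f z = g z} -> arc_integral f = arc_integral g.
Proof.
move=> /andP[fr fi] /andP[gr gi] fg.
by congr (_ +i* _); congr fine; apply: ae_eq_integral => //;
  try (by apply: measurable_int; exact: L1_int);
  apply: filterS fg => z /= -> _.
Qed.

Lemma L2_dotE (f g : L2_fun) :
  L2_dot (\pi_L2 f) (\pi_L2 g) = arc_integral (fun z => f z * (g z)^*).
Proof.
apply: arc_integral_ae; [apply: Lp1_mul_conj; exact: L2_valP..|].
have := L2_repr_pi g; apply: filterS2 (L2_repr_pi f) => z.
by move=> -> ->.
Qed.

Lemma L2_dot_linearl h : GRing.linear_for *%R (L2_dot^~ h).
Proof.
move=> a; elim/quotW => f; elim/quotW => g; elim/quotW: h => h.
rewrite [_ *: _]L2_scaleE -L2_piD !L2_dotE -arc_integral_linear;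
  [|apply: Lp1_mul_conj; exact: L2_valP..].
congr arc_integral; apply/funext => z.
by rewrite [L2_val _ z]/= mulrDl mulrA.
Qed.

Lemma L2_dot_herm f g : L2_dot f g = (-1) ^+ false * Num.conj (L2_dot g f).
Proof.
rewrite expr0 mul1r -[RHS]/((arc_integral _)^*) -arc_integral_conj; last first.
  by apply: Lp1_mul_conj; exact: L2_valP.
by congr arc_integral; apply/funext => z; rewrite rmorphM /= conjcK mulrC.
Qed.

Lemma L2_dot_linearr f : GRing.linear_for (Num.conj \; *%R) (L2_dot f).
Proof.
move=> a g h.
rewrite [LHS]L2_dot_herm [in RHS]L2_dot_herm expr0 !mul1r.
rewrite L2_dot_linearl rmorphD rmorphM /=; congr (_ + _).
by rewrite [RHS]L2_dot_herm expr0 mul1r.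
Qed.

HB.instance Definition _ := bilinear_isBilinear.Build C L2 L2 C *%R
  (Num.conj \; *%R) L2_dot (L2_dot_linearl, L2_dot_linearr).
HB.instance Definition _ := isHermitianSesquilinear.Build C L2 false Num.conj
  L2_dot L2_dot_herm.

Lemma L2_dot_gt0 f : f != 0 -> 0 < L2_dot f f.
Proof.
elim/quotW: f => f f0; have /andP[fr fi] := L2_valP f.
have fL : (fun z => f z * (f z)^*) \in Lp 1.
  by apply: Lp1_mul_conj; exact: L2_valP.
have fE z : f z * (f z)^* = (complex.Re (f z) ^+ 2 + complex.Im (f z) ^+ 2)%:C.
  by case: (f z) => a b; apply/eqP; rewrite eq_complex /= !mulrN opprK !expr2
    [b * a]mulrC addNr !eqxx.
have int_f : m.-integrable setT
    (EFin \o (fun z => complex.Re (f z) ^+ 2 + complex.Im (f z) ^+ 2)).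
  apply: L1_int; have /andP[+ _] := fL; suff -> : complex.Re (R:=R) \o
      (fun z => f z * (f z)^*) =
    (fun z => complex.Re (f z) ^+ 2 + complex.Im (f z) ^+ 2) by [].
  by apply/funext => z; rewrite [LHS]/comp fE.
rewrite L2_dotE (_ : arc_integral _ =
    (\int[m]_z (complex.Re (f z) ^+ 2 + complex.Im (f z) ^+ 2))%:C); last first.
  apply/eqP; rewrite eq_complex /=; apply/andP; split; apply/eqP.
    by apply: eq_Rintegral => z _; rewrite fE.
  rewrite (_ : (fun z => complex.Im _) = cst 0) ?Rintegral_cst ?mul0r//.
  by apply/funext => z; rewrite fE.
rewrite ltcR lt_neqAle Rintegral_ge0 ?andbT; last first.
  by move=> z _; rewrite addr_ge0 ?sqr_ge0.
apply: contra_neq f0 => /esym I0; have -> : 0 = \pi_L2 0 :> L2 by rewrite !piE.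
apply/eqP/L2_eqP.
have /(ae_eq_integral_abs m measurableT)[+ _] := measurable_int m int_f.
have h0 z : 0 <= complex.Re (f z) ^+ 2 + complex.Im (f z) ^+ 2.
  by rewrite addr_ge0 ?sqr_ge0.
under eq_integral do rewrite gee0_abs ?lee_fin//.
rewrite -[X in X = 0%E]fineK; last exact: integrable_fin_num int_f.
rewrite [fine _]I0 => /(_ erefl); apply: filterS => z /(_ I) [] /eqP.
rewrite paddr_eq0 ?sqr_ge0// !sqrf_eq0 => /andP[/eqP r0 /eqP i0].
by case: (f z) r0 i0 => /= ? ? -> ->.
Qed.

HB.instance Definition _ := isDotProduct.Build C L2 L2_dot L2_dot_gt0.

(* the class of [f], and the junk value 0 if [f] is not square-integrable *)
Definition toL2 (f : T -> C) : L2 := \pi_L2 (insubd 0 f).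

End function_spaces.

Section hankel.
Variable R : realType.
Notation T := (circle R).
Notation C := R[i].
Notation m := (@arc_measure R).
Notation L2 := (L2 R).

Definition monomials (n : nat) : L2 := toL2 (fun z : T => (z : C) ^+ n).

Record H2 := MkH2 {
  H2_val :> L2; H2_valP : H2_val \in closed_span (@L2_dot R) monomials }.
HB.instance Definition _ := [isSub for H2_val].
HB.instance Definition _ := [Choice of H2 by <:].
HB.instance Definition _ := [SubChoice_isSubLmodule of H2 by <:].

Definition H2_dot (f g : H2) : C := L2_dot f g.

Lemma H2_dot_linearl h : GRing.linear_for *%R (H2_dot^~ h).
Proof. by move=> a f g; exact: L2_dot_linearl. Qed.

Lemma H2_dot_linearr f : GRing.linear_for (Num.conj \; *%R) (H2_dot f).
Proof. by move=> a g h; exact: L2_dot_linearr. Qed.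

HB.instance Definition _ := bilinear_isBilinear.Build C H2 H2 C *%R
  (Num.conj \; *%R) H2_dot (H2_dot_linearl, H2_dot_linearr).
HB.instance Definition _ := isHermitianSesquilinear.Build C H2 false Num.conj
  H2_dot (fun f g => L2_dot_herm f g).

Lemma H2_dot_gt0 f : f != 0 -> 0 < H2_dot f f.
Proof. exact: L2_dot_gt0. Qed.
HB.instance Definition _ := isDotProduct.Build C H2 H2_dot H2_dot_gt0.

(* orthogonal projection onto H2, given by f - Pplus f _|_ H2 *)
Definition Pplus (f : L2) : H2 :=
  xget 0 [set g : H2 | forall h : H2, L2_dot (f - H2_val g) (H2_val h) = 0].

Definition flip_op (f : L2) : L2 := toL2 (fun z => repr f (circle_conj z)).

Definition mul_op (w : T -> C) (f : L2) : L2 := toL2 (fun z => w z * repr f z).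

Definition hankel (w : T -> C) (f : H2) : H2 :=
  Pplus (mul_op w (flip_op (H2_val f))).

(* [g] is C^oo on the open set [U], in the angular variable *)
Definition smooth_on (U : set T) (g : T -> C) := forall (n : nat) (t : R),
  U (expi t) ->
  derivable (derive1n n (fun s => complex.Re (g (expi s)))) t 1 /\
  derivable (derive1n n (fun s => complex.Im (g (expi s)))) t 1.

(* elements of L^oo are functions modulo equality almost everywhere, so [w] is
   C^oo on the complement of [X] when it agrees there a.e. with such a [g] *)
Definition smooth_off (w : T -> C) (X : set T) := exists g : T -> C,
  smooth_on (~` X) g /\ {ae m, forall z, ~ X z -> w z = g z}.

(* The smallest element of a family of sets, when there is one, is the
   intersection of the family. *)
Definition sing_supp (w : T -> C) : set T :=
  \bigcap_(X in [set X | closed X /\ smooth_off w X]) X.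

End hankel.

(* Main.v *)
Require Import Defs.
From HB Require Import structures.
From mathcomp Require Import finmap generic_quotient.
From mathcomp Require Import all_boot all_order all_algebra sesquilinear.
From mathcomp Require Import all_classical all_reals all_analysis.
From mathcomp Require Import measurable_realfun ess_sup_inf.
From mathcomp Require Import complex ring lra.

Set Implicit Arguments.
Unset Strict Implicit.
Unset Printing Implicit Defensive.
Import Order.TTheory GRing.Theory Num.Theory.
Import numFieldNormedType.Exports.

Local Open Scope classical_set_scope.
Local Open Scope ring_scope.
Local Open Scope complex_scope.

(* Let [sigma] be a smooth real function on the circle with [|sigma| <= 1],
   [sigma (conj z) = - sigma z], and [sigma ^ 2 = 1] outside small neighbourhoods
   of 1 and -1 on which [w] is smooth, and let [T f = Pplus (sigma f)], a
   contraction of [H2]. Up to the part of [sigma f] outside [H2],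
     [<H T f, T f> = <sigma (z) sigma (conj z) w W f, f> = - <sigma ^ 2 w W f, f>],
   so that [<H f, f> + <H T f, T f>] is controlled by the smooth symbols [sigma]
   and [(1 - sigma ^ 2) w]. If [f] is orthogonal to [1, z, ..., z ^ (m - 1)],
   trigonometric polynomials of degree at most [m] contribute nothing, hence the
   form is [O(m ^ -N) |f| ^ 2] for any given [N]. By minimax,
     [lambda+_(n + m) <= lambda-_n + eps_m] and [lambda-_(n + m) <= lambda+_n + eps_m]
   with [eps_m = O(m ^ -N)] and [N p > 1]; taking for [m] a small multiple of [n]
   shows that [lambda+] and [lambda-] have the same power asymptotics. As the
   singular values merge these two sequences,
   [min (lambda+_n) (lambda-_n) <= s_(2 n + 1)] and
   [s_(2 n) <= max (lambda+_n) (lambda-_n)], which gives the factor 1/2. *)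

(** * Hilbert spaces *)

(** Conjugation fixes 1 and -1, so a function that is odd under it vanishes there and [sigma ^ 2]
    cannot be 1 nearby: this is where the hypothesis on the singular support enters. A rate is
    needed, and not mere compactness of the error: exact constants survive an index shift only if
    [m] is a small fraction of [n], while [eps_m] must stay negligible against [n ^ (- 1 / p)]. For
    a given [p] a single order [N] is enough, so [sigma] has finite smoothness and is built from
    powers of [max 0 y]. A contraction [T] suffices in the minimax step, because [<- A T x, T x> <=
    lambda-_n |T x| ^ 2 <= lambda-_n |x| ^ 2] uses only [lambda-_n >= 0]. Eigenvalue lists, [|A|]
    and [Pplus] are values selected by [xget]. The spectral theorem, a positive square root and the
    completeness of L2 show that the selection succeeds; afterwards variational inequalities take
    over. In particular the merging of the two lists into the singular values is replaced by two
    minimax inequalities. *)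

Section complex_modulus.
Variable R : realType.
Implicit Types z w : R[i].

Lemma ReD z w : complex.Re (z + w) = complex.Re z + complex.Re w.
Proof. by case: z; case: w. Qed.

Lemma ReN z : complex.Re (- z) = - complex.Re z.
Proof. by case: z. Qed.

Definition cabs z : R := complex.Re `|z|.

Lemma cabsE z : `|z| = (cabs z)%:C.
Proof. by rewrite /cabs normc_def. Qed.

Lemma cabs_def z : cabs z = Num.sqrt (complex.Re z ^+ 2 + complex.Im z ^+ 2).
Proof. by rewrite /cabs normc_def. Qed.

Lemma cabs_ge0 z : 0 <= cabs z.
Proof. by rewrite cabs_def sqrtr_ge0. Qed.

Lemma cabs_sqr z : cabs z ^+ 2 = complex.Re z ^+ 2 + complex.Im z ^+ 2.
Proof. by rewrite cabs_def sqr_sqrtr// addr_ge0 ?sqr_ge0. Qed.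

Lemma cabs0 : cabs 0 = 0.
Proof. by rewrite cabs_def /= expr0n addr0 sqrtr0. Qed.

Lemma cabs0_eq0 z : cabs z = 0 -> z = 0.
Proof. by move=> z0; apply/eqP; rewrite -normr_eq0 cabsE z0. Qed.

Lemma cabsM z w : cabs (z * w) = cabs z * cabs w.
Proof. by apply: complexI; rewrite rmorphM -!cabsE normrM. Qed.

Lemma cabsD z w : cabs (z + w) <= cabs z + cabs w.
Proof. by rewrite -lecR rmorphD -!cabsE ler_normD. Qed.

Lemma cabsN z : cabs (- z) = cabs z.
Proof. by apply: complexI; rewrite -!cabsE normrN. Qed.

Lemma cabsJ z : cabs (conjc z) = cabs z.
Proof. by case: z => a b; rewrite !cabs_def /= sqrrN. Qed.

Lemma cabs_real (t : R) : cabs t%:C = `|t|.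
Proof. by rewrite cabs_def /= expr0n addr0 sqrtr_sqr. Qed.

Lemma le_Re_cabs z : `|complex.Re z| <= cabs z.
Proof.
by rewrite -(@ler_pXn2r _ 2)// ?nnegrE ?cabs_ge0// real_normK ?num_real// cabs_sqr
  lerDl sqr_ge0.
Qed.

Lemma le_Im_cabs z : `|complex.Im z| <= cabs z.
Proof.
by rewrite -(@ler_pXn2r _ 2)// ?nnegrE ?cabs_ge0// real_normK ?num_real// cabs_sqr
  lerDr sqr_ge0.
Qed.

Lemma cabs_le_ReIm z : cabs z <= `|complex.Re z| + `|complex.Im z|.
Proof.
rewrite -(@ler_pXn2r _ 2)// ?nnegrE ?cabs_ge0// ?addr_ge0// cabs_sqr sqrrD.
rewrite !real_normK ?num_real// -addrA [_ *+ 2 + _]addrC addrA lerDl.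
by rewrite mulrn_wge0// mulr_ge0.
Qed.

Lemma mulcJ_cabs z : z * conjc z = (cabs z ^+ 2)%:C.
Proof. by rewrite -sqr_normc cabsE rmorphXn. Qed.

End complex_modulus.

Section hilbert_norm.
Variables (R : realType) (V : lmodType R[i]) (dot : {dot V for Num.conj}).
Implicit Types (x y z : V).
Local Notation N := (hnorm dot).

Definition rdot x y : R := complex.Re (dot x y).

Lemma dotC x y : dot x y = conjc (dot y x).
Proof. by rewrite hermC expr0 mul1r. Qed.

Lemma dotxx x : dot x x = (N x ^+ 2)%:C.
Proof.
have := dnorm_ge0 dot x; rewrite /hnorm.
case: (dot x x) => a b; rewrite lecE /= => /andP[/eqP -> a0].
by rewrite sqr_sqrtr.
Qed.

Lemma rdotxx x : rdot x x = N x ^+ 2.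
Proof. by rewrite /rdot dotxx. Qed.

Lemma rdotC x y : rdot x y = rdot y x.
Proof. by rewrite /rdot dotC; case: (dot _ _). Qed.

Lemma rdotDl z x y : rdot (x + y) z = rdot x z + rdot y z.
Proof. by rewrite /rdot linearDl ReD. Qed.

Lemma rdotNl z x : rdot (- x) z = - rdot x z.
Proof. by rewrite /rdot linearNl ReN. Qed.

Lemma rdotBl z x y : rdot (x - y) z = rdot x z - rdot y z.
Proof. by rewrite rdotDl rdotNl. Qed.

Lemma rdotDr z x y : rdot z (x + y) = rdot z x + rdot z y.
Proof. by rewrite rdotC rdotDl !(rdotC z). Qed.

Lemma rdotNr z x : rdot z (- x) = - rdot z x.
Proof. by rewrite rdotC rdotNl rdotC. Qed.

Lemma rdotBr z x y : rdot z (x - y) = rdot z x - rdot z y.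
Proof. by rewrite rdotDr rdotNr. Qed.

Lemma dotZl (a : R[i]) x y : dot (a *: x) y = a * dot x y.
Proof. by rewrite linearZl_LR. Qed.

Lemma dotZr (a : R[i]) x y : dot x (a *: y) = conjc a * dot x y.
Proof. by rewrite linearZr_LR. Qed.

Lemma dotDl z x y : dot (x + y) z = dot x z + dot y z.
Proof. exact: linearDl. Qed.

Lemma dotBl z x y : dot (x - y) z = dot x z - dot y z.
Proof. exact: linearBl. Qed.

Lemma dotDr z x y : dot z (x + y) = dot z x + dot z y.
Proof. exact: linearDr. Qed.

Lemma dotBr z x y : dot z (x - y) = dot z x - dot z y.
Proof. exact: linearBr. Qed.

Lemma rdotZl (t : R) x y : rdot (t%:C *: x) y = t * rdot x y.
Proof. by rewrite /rdot dotZl; case: (dot _ _) => a b /=; rewrite mul0r subr0. Qed.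

Lemma rdotZr (t : R) x y : rdot x (t%:C *: y) = t * rdot x y.
Proof. by rewrite rdotC rdotZl rdotC. Qed.

(** Multiplying by [- 'i] turns the imaginary part into a real part, so that bounds on [rdot] also
    control complex inner products. *)
Lemma dotIm x y : complex.Im (dot x y) = rdot (- 'i *: x) y.
Proof. by rewrite /rdot dotZl; case: (dot _ _) => a b /=; ring. Qed.

Lemma hnorm_ge0 x : 0 <= N x. Proof. exact: sqrtr_ge0. Qed.

Lemma hnorm0 : N 0 = 0.
Proof. by rewrite /hnorm linear0l sqrtr0. Qed.

Lemma hnorm0_eq0 x : N x = 0 -> x = 0.
Proof. by move=> x0; apply/eqP; rewrite -(dnorm_eq0 dot) dotxx x0 expr0n. Qed.

Lemma hnormN x : N (- x) = N x.
Proof. by rewrite /hnorm linearNl/= linearNr/= opprK. Qed.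

Lemma hnormBC x y : N (x - y) = N (y - x).
Proof. by rewrite -hnormN opprB. Qed.

Lemma hnormZ (a : R[i]) x : N (a *: x) = cabs a * N x.
Proof.
apply/eqP; rewrite -(@eqrXn2 _ 2)// ?mulr_ge0 ?hnorm_ge0 ?cabs_ge0//; apply/eqP.
apply: complexI.
by rewrite -dotxx dotZl dotZr mulrA mulcJ_cabs dotxx exprMn [RHS]rmorphM.
Qed.

Lemma hnorm_sqrD x y : N (x + y) ^+ 2 = N x ^+ 2 + N y ^+ 2 + 2 * rdot x y.
Proof. by rewrite -!rdotxx !rdotDl !rdotDr [rdot y x]rdotC; ring. Qed.

Lemma hnorm_sqrB x y : N (x - y) ^+ 2 = N x ^+ 2 + N y ^+ 2 - 2 * rdot x y.
Proof. by rewrite hnorm_sqrD rdotNr hnormN mulrN. Qed.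

Lemma rdot_le x y : rdot x y <= N x * N y.
Proof.
have [x0|x0] := eqVneq (N x) 0.
  by rewrite x0 (hnorm0_eq0 x0) /rdot linear0l mul0r.
have [y0|y0] := eqVneq (N y) 0.
  by rewrite y0 (hnorm0_eq0 y0) /rdot linear0r mulr0.
have xy : 0 < N x * N y by rewrite mulr_gt0// lt_def hnorm_ge0 ?x0 ?y0.
(* This square equals [2 * (N x * N y) * (N x * N y - r)], whose last factor must therefore be
   nonnegative. *)
have := sqr_ge0 (N ((N y)%:C *: x - (N x)%:C *: y)).
rewrite hnorm_sqrB !hnormZ rdotZl rdotZr !cabs_real !ger0_norm ?hnorm_ge0//.
set r := rdot x y => h; rewrite -subr_ge0 -(pmulr_rge0 _ xy).
by rewrite -(pmulr_rge0 _ (ltr0Sn R 1)); apply: le_trans h _; rewrite le_eqVlt; apply/orP; left; apply/eqP; ring.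
Qed.

Lemma normr_rdot_le x y : `|rdot x y| <= N x * N y.
Proof. by rewrite ler_norml lerNl -rdotNl -(hnormN x) rdot_le hnormN rdot_le. Qed.

Lemma cabs_dot_le x y : cabs (dot x y) <= 2 * (N x * N y).
Proof.
apply: le_trans (cabs_le_ReIm _) _; rewrite mulr2n mulrDl !mul1r lerD//.
  exact: normr_rdot_le.
rewrite dotIm; apply: le_trans (normr_rdot_le _ _) _.
by rewrite hnormZ cabsN cabs_def /= expr0n expr1n add0r sqrtr1 mul1r.
Qed.

Lemma hnormD x y : N (x + y) <= N x + N y.
Proof.
rewrite -(@ler_pXn2r _ 2)// ?nnegrE ?addr_ge0 ?hnorm_ge0// hnorm_sqrD.
by have := rdot_le x y; nra.
Qed.

Lemma hnorm_dist z x y : N (x - y) <= N (x - z) + N (z - y).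
Proof. by apply: le_trans (hnormD _ _); rewrite addrA subrK. Qed.

Lemma hnorm_le_dist x y : N x <= N y + N (x - y).
Proof. by rewrite -[in leLHS](subrK y x) addrC hnormD. Qed.

Lemma rdot0l x : rdot 0 x = 0. Proof. by rewrite /rdot linear0l. Qed.
Lemma rdot0r x : rdot x 0 = 0. Proof. by rewrite /rdot linear0r. Qed.

Lemma dot_eq0 x : (forall y, dot x y = 0) -> x = 0.
Proof. by move=> /(_ x)/eqP; rewrite dnorm_eq0 => /eqP. Qed.

Lemma rdot_sum I (r : seq I) (P : pred I) (F : I -> V) y :
  rdot (\sum_(i <- r | P i) F i) y = \sum_(i <- r | P i) rdot (F i) y.
Proof.
by elim/big_rec2 : _ => [|i a b _ <-]; rewrite ?rdot0l// rdotDl.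
Qed.

Lemma dot_suml I (r : seq I) (P : pred I) (F : I -> V) y :
  dot (\sum_(i <- r | P i) F i) y = \sum_(i <- r | P i) dot (F i) y.
Proof. by rewrite linear_sumlz. Qed.

Lemma dot_sumr I (r : seq I) (P : pred I) (F : I -> V) y :
  dot y (\sum_(i <- r | P i) F i) = \sum_(i <- r | P i) dot y (F i).
Proof. exact: linear_sumr. Qed.

Definition hcvg (u : nat -> V) y := (fun n => N (u n - y)) @ \oo --> (0 : R).

Lemma hcvgP u y :
  hcvg u y <-> forall eps, 0 < eps -> exists n0, forall n, (n0 <= n)%N -> N (u n - y) < eps.
Proof.
split=> [/cvgrPdist_lt uy eps eps0|uy].
  have [n0 _ h] := uy _ eps0; exists n0 => n n0n.
  by have := h n n0n; rewrite /= sub0r normrN ger0_norm ?hnorm_ge0.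
apply/cvgrPdist_lt => eps /uy[n0 h]; exists n0 => // n /= n0n.
by rewrite sub0r normrN ger0_norm ?hnorm_ge0// h.
Qed.

Definition hcauchy (u : nat -> V) := forall eps, 0 < eps ->
  exists n0, forall n m, (n0 <= n)%N -> (n0 <= m)%N -> N (u n - u m) < eps.

Definition hcomplete := forall u, hcauchy u -> exists y, hcvg u y.

Lemma hcvg_cauchy u y : hcvg u y -> hcauchy u.
Proof.
move=> /hcvgP uy eps eps0; have e2 : 0 < eps / 2 by rewrite divr_gt0.
have [n0 h] := uy _ e2; exists n0 => n m n0n n0m.
apply: le_lt_trans (hnorm_dist y _ _) _; rewrite (splitr eps) ltrD ?h//.
by rewrite hnormBC h.
Qed.

Lemma hcvg_unique u x y : hcvg u x -> hcvg u y -> x = y.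
Proof.
move=> /hcvgP ux /hcvgP uy; apply/subr0_eq/hnorm0_eq0/eqP.
rewrite eq_le hnorm_ge0 andbT leNgt; apply/negP => xy.
have e2 : 0 < N (x - y) / 2 by rewrite divr_gt0.
have [n0 h] := ux _ e2; have [n1 h'] := uy _ e2.
have := hnorm_dist (u (maxn n0 n1)) x y; rewrite leNgt => /negP; apply.
rewrite [ltRHS]splitr ltrD//; first by rewrite hnormBC h// leq_maxl.
by rewrite h'// leq_maxr.
Qed.

Lemma hcvg_dist u x (v : nat -> R) : v @ \oo --> (0 : R) ->
  (forall n, N (u n - x) <= v n) -> hcvg u x.
Proof.
move=> v0 h; apply: (@squeeze_cvgr _ _ _ _ (cst 0) v) => //; last exact: cvg_cst.
by apply: nearW => n; rewrite hnorm_ge0 h.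
Qed.

Lemma hcvgD u v x y : hcvg u x -> hcvg v y -> hcvg (fun n => u n + v n) (x + y).
Proof.
move=> ux vy; apply: (@hcvg_dist _ _ (fun n => N (u n - x) + N (v n - y))).
  by rewrite -[0](addr0 0); exact: cvgD.
by move=> n; rewrite opprD addrACA hnormD.
Qed.

Lemma hcvg_lip (W : lmodType R[i]) (dotW : {dot W for Num.conj}) (f : V -> W) u x M :
  (forall y z, hnorm dotW (f y - f z) <= M * N (y - z)) -> hcvg u x ->
  (fun n => hnorm dotW (f (u n) - f x)) @ \oo --> (0 : R).
Proof.
move=> fM ux; apply: (@squeeze_cvgr _ _ _ _ (cst 0) (fun n => M * N (u n - x))).
- by apply: nearW => n; rewrite sqrtr_ge0 fM.
- exact: cvg_cst.
- by rewrite -(mulr0 M); apply: cvgM => //; exact: cvg_cst.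
Qed.

Lemma hcvg_cst x : hcvg (fun=> x) x.
Proof. by apply/hcvgP => eps eps0; exists 0%N => n _; rewrite subrr hnorm0. Qed.

Lemma hcvgZ a u x : hcvg u x -> hcvg (fun n => a *: u n) (a *: x).
Proof.
by move=> ux; apply: (hcvg_lip (M := cabs a)) ux => y z; rewrite -scalerBr hnormZ.
Qed.

Lemma hcvg_sub u x phi : (forall n, (phi n < phi n.+1)%N) -> hcvg u x ->
  hcvg (u \o phi) x.
Proof.
move=> phiS /hcvgP ux; apply/hcvgP => eps /ux[n0 h]; exists n0 => n n0n.
apply: h; apply: leq_trans n0n _; elim: n => // n ih.
exact: leq_ltn_trans ih (phiS n).
Qed.

Lemma hcvg_rdot u x y : hcvg u x -> (fun n => rdot (u n) y) @ \oo --> rdot x y.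
Proof.
move=> ux; apply/cvgrPdist_lt => eps eps0.
have e0 : 0 < eps / (N y + 1) by rewrite divr_gt0// ltr_wpDl ?hnorm_ge0.
have /hcvgP/(_ _ e0)[n0 h] := ux; exists n0 => // n /= n0n.
rewrite -rdotBl; apply: le_lt_trans (normr_rdot_le _ _) _.
have := h n n0n; rewrite hnormBC ltr_pdivlMr ?ltr_wpDl ?hnorm_ge0//.
by apply: le_lt_trans; rewrite ler_wpM2l ?hnorm_ge0// lerDl.
Qed.

Lemma hcvg_dot0 u x y : hcvg u x -> (forall n, dot (u n) y = 0) -> dot x y = 0.
Proof.
move=> /hcvgP ux u0; apply: cabs0_eq0; apply/eqP.
rewrite eq_le cabs_ge0 andbT leNgt; apply/negP => xy.
have e0 : 0 < cabs (dot x y) / (2 * (N y + 1)).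
  by rewrite divr_gt0// mulr_gt0// ltr_wpDl ?hnorm_ge0.
have [n0 /(_ _ (leqnn _))] := ux _ e0.
rewrite hnormBC ltr_pdivlMr ?mulr_gt0 ?ltr_wpDl ?hnorm_ge0//.
have := cabs_dot_le (x - u n0) y; rewrite dotBl u0 subr0.
by have := hnorm_ge0 (x - u n0); have := hnorm_ge0 y; nra.
Qed.

End hilbert_norm.

(** * Partial projections, closed spans and dimension counts *)

Section orthogonal_systems.
Variables (R : realType) (V : lmodType R[i]) (dot : {dot V for Num.conj}).
Implicit Types (x y z : V) (e : nat -> V).
Local Notation N := (hnorm dot).

(* Zero vectors are allowed, so that finite systems are covered too. *)
Definition orthosys e :=
  forall i j, dot (e i) (e j) = ((i == j) && (e i != 0))%:R.

Definition oproj e n x := \sum_(i < n) dot x (e i) *: e i.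

Section system.
Variable e : nat -> V.
Hypothesis eO : orthosys e.

Lemma orthosys_norm i : e i != 0 -> N (e i) = 1.
Proof.
move=> ei0; apply/eqP; rewrite -(@eqrXn2 _ 2)// ?hnorm_ge0// expr1n; apply/eqP.
by apply: complexI; rewrite -dotxx eO eqxx ei0.
Qed.

Lemma orthosys_dot0 i j : i != j -> dot (e i) (e j) = 0.
Proof. by move=> /negbTE ij; rewrite eO ij. Qed.

Lemma dot_oproj n x j : dot (oproj e n x) (e j) = if (j < n)%N then dot x (e j) else 0.
Proof.
rewrite /oproj dot_suml; case: ifPn => [jn|nj].
  rewrite (bigD1 (Ordinal jn))//= big1 ?addr0 => [|i ij].
    rewrite dotZl eO eqxx/=; have [->|_] := eqVneq (e j) 0; last by rewrite mulr1.
    by rewrite mulr0 linear0r.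
  by rewrite dotZl orthosys_dot0 ?mulr0.
rewrite big1// => i _; rewrite dotZl orthosys_dot0 ?mulr0//.
by apply: contraNneq nj => <-.
Qed.

Lemma dot_sub_oproj n x j : (j < n)%N -> dot (x - oproj e n x) (e j) = 0.
Proof. by move=> jn; rewrite dotBl dot_oproj jn subrr. Qed.

Lemma dot_orth_oproj n x y : (forall i, (i < n)%N -> dot x (e i) = 0) ->
  dot x (oproj e n y) = 0.
Proof.
by move=> xe; rewrite dot_sumr big1// => i _; rewrite dotZr xe ?mulr0.
Qed.

Lemma oproj_pythagoras n x : N x ^+ 2 = N (oproj e n x) ^+ 2 + N (x - oproj e n x) ^+ 2.
Proof.
have o : rdot dot (x - oproj e n x) (oproj e n x) = 0.
  by rewrite /rdot dot_orth_oproj// => i ilt; rewrite dot_sub_oproj.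
by have := hnorm_sqrD dot (x - oproj e n x) (oproj e n x); rewrite subrK o mulr0 addr0 addrC.
Qed.

Lemma hnorm_oproj n x : N (oproj e n x) <= N x.
Proof.
by rewrite -(@ler_pXn2r _ 2)// ?nnegrE ?hnorm_ge0// (oproj_pythagoras n x) lerDl sqr_ge0.
Qed.

Lemma oproj_oproj m n x : (m <= n)%N -> oproj e m (oproj e n x) = oproj e m x.
Proof.
move=> mn; apply: eq_bigr => i _; rewrite dot_oproj ifT//.
exact: leq_trans mn.
Qed.

Lemma oproj_increment m n x : (m <= n)%N ->
  N (oproj e n x - oproj e m x) ^+ 2 = N (oproj e n x) ^+ 2 - N (oproj e m x) ^+ 2.
Proof.
by move=> mn; rewrite (oproj_pythagoras m (oproj e n x)) oproj_oproj// addrAC subrr add0r.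
Qed.

Lemma oproj_linear n a x y : oproj e n (a *: x + y) = a *: oproj e n x + oproj e n y.
Proof.
rewrite /oproj scaler_sumr -big_split; apply: eq_bigr => i _.
by rewrite dotDl dotZl scalerDl scalerA.
Qed.

(** Bessel's inequality: the squared norms of the projections increase and stay below that of [x],
    and a difference of two projections has the difference of these squares as its squared norm. *)
Lemma oproj_cauchy x : hcauchy dot (oproj e ^~ x).
Proof.
pose a n := N (oproj e n x) ^+ 2.
have a_nd : nondecreasing_seq a.
  by move=> m n mn; rewrite -subr_ge0 -oproj_increment// sqr_ge0.
have a_cvg : cvgn a.
  apply: nondecreasing_is_cvgn => //; exists (N x ^+ 2) => _ [n _ <-].
  by rewrite ler_pXn2r ?nnegrE ?hnorm_ge0// hnorm_oproj.
move=> eps eps0; have /cvgrPdist_lt/(_ _ (exprn_gt0 2 eps0))[n0 _ h] := a_cvg.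
have claim n m : (n0 <= m)%N -> (m <= n)%N -> N (oproj e n x - oproj e m x) < eps.
  move=> n0m mn; rewrite -(@ltr_pXn2r _ 2)// ?nnegrE ?hnorm_ge0 ?(ltW eps0)//.
  rewrite oproj_increment//; apply: le_lt_trans (h m n0m); rewrite /=.
  by rewrite (le_trans _ (ler_norm _))// lerD2r; exact: (nondecreasing_cvgn_le a_nd).
exists n0 => n m n0n n0m; have [mn|/ltnW nm] := leqP m n; first exact: claim.
by rewrite hnormBC claim.
Qed.

Lemma oproj_best n x s : (forall c : R[i] * nat, c \in s -> (c.2 < n)%N) ->
  N (x - oproj e n x) <= N (x - \sum_(c <- s) c.1 *: e c.2).
Proof.
move=> sn; set y := \sum_(c <- s) _.
have yE : oproj e n y = y.
  apply/subr0_eq/eqP; rewrite -(dnorm_eq0 dot) dotBr dot_orth_oproj.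
    rewrite dot_sumr big_seq big1 ?subr0//= => c cs.
    by rewrite dotZr dotBl dot_oproj sn// subrr mulr0.
  by move=> i ilt; rewrite dotBl dot_oproj ilt subrr.
rewrite -(@ler_pXn2r _ 2)// ?nnegrE ?hnorm_ge0//.
rewrite [leRHS](oproj_pythagoras n).
have -> : oproj e n (x - y) = oproj e n x - y.
  rewrite -[in RHS]yE -[x - y]addrC -scaleN1r oproj_linear scaleN1r.
  by rewrite addrC.
by rewrite opprB addrA subrK lerDr sqr_ge0.
Qed.

(** A finite combination involves finitely many indices, so from some [n] on the projection on the
    first [n] vectors approximates [x] at least as well. *)
Lemma closed_span_oproj x : closed_span dot e x -> hcvg dot (oproj e ^~ x) x.
Proof.
move=> /asboolP xe; apply/hcvgP => eps /xe[s xs].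
exists (\max_(c <- s) c.2).+1 => n sn; rewrite hnormBC.
apply: le_lt_trans xs; apply: oproj_best => c cs.
by apply: leq_trans sn; rewrite ltnS; apply: leq_bigmax_seq.
Qed.

Lemma oproj_closed_span n x : closed_span dot e (oproj e n x).
Proof.
apply: rpred_sum => i _; apply: rpredZ; apply/asboolP => eps eps0.
by exists [:: (1, nat_of_ord i)]; rewrite big_seq1 scale1r subrr hnorm0.
Qed.

Lemma closed_span_closed (I : Type) (f : I -> V) u x :
  (forall n, closed_span dot f (u n)) -> hcvg dot u x -> closed_span dot f x.
Proof.
move=> uf /hcvgP ux; apply/asboolP => eps eps0.
have e2 : 0 < eps / 2 by rewrite divr_gt0.
have [n h] := ux _ e2; have /asboolP/(_ _ e2)[s us] := uf n.
exists s; apply: le_lt_trans (hnorm_dist _ (u n) _ _) _.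
by rewrite (splitr eps) ltrD// hnormBC h.
Qed.

End system.

(** More unknowns than equations: the left kernel of an [n] by [m] matrix with [m < n] is nonzero.
    Both the uniqueness of dimensions and the minimax arguments rest on it. *)
Lemma exists_combination n m (phi : 'I_m -> 'I_n -> R[i]) : (m < n)%N ->
  exists c : 'I_n -> R[i], (exists i, c i != 0) /\
    forall j, \sum_i c i * phi j i = 0.
Proof.
move=> mn; pose M := \matrix_(i < n, j < m) phi j i.
have /rowV0Pn[v /sub_kermxP vM v0] : kermx M != 0.
  rewrite -mxrank_eq0 mxrank_ker subn_eq0 -ltnNge.
  by apply: leq_ltn_trans (rank_leq_col _) mn.
exists (v 0); split.
  have /eqP/rowP/existsNP[i /eqP] := v0; rewrite mxE => vi.
  by exists i.
move=> j; move/rowP/(_ j): vM; rewrite mxE mxE => vM; rewrite -[RHS]vM.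
by apply: eq_bigr => i _; rewrite !mxE.
Qed.

Section span.
Variables (n : nat) (e : 'I_n -> V).
Hypothesis eO : forall i j, dot (e i) (e j) = (i == j)%:R.
Implicit Type c : 'I_n -> R[i].

Lemma dot_comb c j : dot (\sum_i c i *: e i) (e j) = c j.
Proof.
rewrite dot_suml (bigD1 j)//= big1 => [|i /negbTE ij].
  by rewrite dotZl eO eqxx mulr1 addr0.
by rewrite dotZl eO ij mulr0.
Qed.

Lemma dot_comb2 c d :
  dot (\sum_i c i *: e i) (\sum_i d i *: e i) = \sum_i c i * conjc (d i).
Proof.
rewrite dot_sumr; apply: eq_bigr => i _.
by rewrite dotZr dot_comb mulrC.
Qed.

Lemma hnorm_comb c : N (\sum_i c i *: e i) ^+ 2 = \sum_i cabs (c i) ^+ 2.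
Proof.
apply: complexI; rewrite -dotxx dot_comb2 rmorph_sum.
by apply: eq_bigr => i _; rewrite mulcJ_cabs.
Qed.

Lemma rdot_comb (l : 'I_n -> R) c :
  rdot dot (\sum_i c i *: ((l i)%:C *: e i)) (\sum_i c i *: e i) =
  \sum_i l i * cabs (c i) ^+ 2.
Proof.
under eq_bigr do rewrite scalerA.
rewrite /rdot dot_comb2 (_ : \sum_i _ = (\sum_i l i * cabs (c i) ^+ 2)%:C)//.
rewrite rmorph_sum; apply: eq_bigr => i _.
by rewrite mulrAC mulcJ_cabs [RHS]rmorphM mulrC.
Qed.

End span.

End orthogonal_systems.

(** * Compact symmetric operators *)

Section eigenvalue_lists.
Variables (R : realType) (V : lmodType R[i]).
Implicit Types (A : V -> V) (lam : nat -> R).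

Lemma has_dim_le (E : set V) k k' : has_dim E k -> has_dim E k' -> (k' <= k)%N.
Proof.
move=> [e [eE _]] [e' [e'E e'free]]; rewrite leqNgt; apply/negP => kk'.
have /choice[c cE] : forall i, exists c : 'I_k -> R[i], e' i = \sum_j c j *: e j.
  move=> i; apply/eE/e'E; exists (fun j => (j == i)%:R).
  rewrite (bigD1 i)//= eqxx scale1r big1 ?addr0// => j /negbTE ->.
  by rewrite scale0r.
have [d [[i di] d0]] := exists_combination (fun j i => c i j) kk'.
move/eqP: di; apply; apply: (e'free d).
under eq_bigr do rewrite cE scaler_sumr.
rewrite exchange_big big1//= => j _.
under eq_bigr do rewrite scalerA.
by rewrite -scaler_suml d0 scale0r.
Qed.

Lemma has_dim_unique (E : set V) k k' : has_dim E k -> has_dim E k' -> k = k'.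
Proof.
by move=> h h'; apply/eqP; rewrite eqn_leq (has_dim_le h h') (has_dim_le h' h).
Qed.

Let nonincr lam : (forall n, lam n.+1 <= lam n) ->
  forall m n, (m <= n)%N -> lam n <= lam m.
Proof.
move=> h m n; elim: n => [|n ih]; first by rewrite leqn0 => /eqP ->.
by rewrite leq_eqVlt => /orP[/eqP->//|/ih]; exact: le_trans.
Qed.

(** Suppose [lam' n < t] with [t = lam n]. By monotonicity [lam'] takes the value [t] only before
    [n], where the two sequences agree. Both level sets of [t] have the dimension of the eigenspace
    as cardinality, so they coincide, although [n] lies in the first one alone. *)
Lemma enumerates_le A lam lam' n : enumerates_pos_eigenvalues A lam ->
  enumerates_pos_eigenvalues A lam' ->
  (forall k, (k < n)%N -> lam k = lam' k) -> lam n <= lam' n.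
Proof.
move=> [_ lam0 lamE] [d' lam'0 lam'E] eqn; rewrite leNgt; apply/negP => ltn.
have t0 : 0 < lam n by apply: le_lt_trans ltn.
have [k [Ek cardk]] := lamE _ t0; have [k' [Ek' cardk']] := lam'E _ t0.
rewrite -(has_dim_unique Ek Ek') in cardk'.
have sub : [set i | lam' i = lam n] `<=` [set i | lam i = lam n].
  move=> i /= lami; have [ilt|nlei] := ltnP i n; first by rewrite eqn.
  by have := nonincr d' nlei; rewrite lami leNgt ltn.
have fin : finite_set [set i | lam i = lam n] by exists k.
have fin' : finite_set [set i | lam' i = lam n] by exists k.
have /fsetP/(_ n) : fset_set [set i | lam' i = lam n] = fset_set [set i | lam i = lam n].
  apply/eqP; rewrite eqEfcard (card_fset_set cardk) (card_fset_set cardk') leqnn andbT.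
  by rewrite -fset_set_sub.
rewrite !in_fset_set//; have -> : n \in [set i | lam i = lam n] by rewrite mem_set.
by move=> /set_mem /= e; move: ltn; rewrite e ltxx.
Qed.

Lemma enumerates_unique A lam lam' : enumerates_pos_eigenvalues A lam ->
  enumerates_pos_eigenvalues A lam' -> lam = lam'.
Proof.
move=> h h'; apply/funext; elim/ltn_ind => n ih.
by apply/eqP; rewrite eq_le !(@enumerates_le A)// => k /ih.
Qed.

Lemma lambda_plusE A lam : enumerates_pos_eigenvalues A lam -> lambda_plus A = lam.
Proof.
move=> h; apply: (@enumerates_unique A) => //.
exact: (@xgetI _ _ [set lam | enumerates_pos_eigenvalues A lam] lam h).
Qed.

End eigenvalue_lists.

Section symmetric_operator.
Variables (R : realType) (V : lmodType R[i]) (dot : {dot V for Num.conj}).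
Implicit Types (x y z : V).
Local Notation N := (hnorm dot).
Variable A : V -> V.
Hypothesis Alin : linear A.

Lemma linD x y : A (x + y) = A x + A y.
Proof. by have := Alin 1 x y; rewrite !scale1r. Qed.

Lemma lin0 : A 0 = 0.
Proof. by apply: (addrI (A 0)); rewrite -linD !addr0. Qed.

Lemma linZ a x : A (a *: x) = a *: A x.
Proof. by have := Alin a x 0; rewrite lin0 !addr0. Qed.

Lemma linN x : A (- x) = - A x.
Proof. by rewrite -scaleN1r linZ scaleN1r. Qed.

Lemma linB x y : A (x - y) = A x - A y.
Proof. by rewrite linD linN. Qed.

Lemma lin_sum I (r : seq I) (F : I -> V) :
  A (\sum_(i <- r) F i) = \sum_(i <- r) A (F i).
Proof. by elim/big_rec2 : _ => [|i x y _ <-]; rewrite ?lin0// linD. Qed.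

Hypothesis Asym : forall x y, dot (A x) y = dot x (A y).

Lemma rdot_sym x y : rdot dot (A x) y = rdot dot x (A y).
Proof. by rewrite /rdot Asym. Qed.

(* By polarization of the form [<A x, y>]. *)
Lemma numerical_radius (S : set V) M : (forall x, S x -> S (A x)) ->
  (forall x y, S x -> S y -> S (x + y)) -> (forall a x, S x -> S (a *: x)) ->
  0 <= M -> (forall x, S x -> `|rdot dot (A x) x| <= M * N x ^+ 2) ->
  forall x, S x -> N (A x) <= M * N x.
Proof.
move=> SA SD SZ M0 SM x Sx.
have pol y : S y -> 2 * rdot dot (A x) y <= M * (N x ^+ 2 + N y ^+ 2).
  move=> Sy; have Sxy := SD _ _ Sx Sy.
  have Sxny : S (x - y) by apply: SD => //; rewrite -scaleN1r; exact: SZ.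
  have := SM _ Sxy; have := SM _ Sxny.
  rewrite !ler_norml => /andP[h1 _] /andP[_ h2].
  move: h1 h2; rewrite linB linD hnorm_sqrB hnorm_sqrD.
  rewrite !(rdotBl, rdotDl, rdotBr, rdotDr) (rdot_sym y x) (rdotC _ y).
  by nra.
have [Ax0|Ax0] := eqVneq (N (A x)) 0; first by rewrite Ax0 mulr_ge0 ?hnorm_ge0.
have [x0|x0] := eqVneq (N x) 0.
  by move: Ax0; rewrite (hnorm0_eq0 x0) lin0 hnorm0 eqxx.
have b0 : 0 < N x by rewrite lt_def x0 hnorm_ge0.
have a0 : 0 < N (A x) by rewrite lt_def Ax0 hnorm_ge0.
(* The test vector is [A x] rescaled to the norm of [x], so that the polarized inequality reads
   [2 * N x * N (A x) <= 2 * M * N x ^ 2]. *)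
have /pol : S ((N x / N (A x))%:C *: A x) by apply/SZ/SA.
rewrite rdotZr rdotxx hnormZ cabs_real ger0_norm; last by rewrite divr_ge0 ?hnorm_ge0.
rewrite divfK// expr2 [_ / _ * _]mulrA divfK// => h.
by rewrite -(ler_pM2r b0); nra.
Qed.

Variable M : R.
Hypothesis AM : forall x, N (A x) <= M * N x.
Hypothesis Acpt : compact_op dot A.

Lemma hcvg_norm1 (u : nat -> V) x : (forall n, N (u n) = 1) -> hcvg dot u x -> N x = 1.
Proof.
move=> u1 ux; apply: (@cvg_unique _ _ (cst (1 : R) @ \oo)) => //; last exact: cvg_cst.
apply/cvgrPdist_lt => eps eps0; have /hcvgP/(_ _ eps0)[n0 h] := ux.
exists n0 => // n /= /h; apply: le_lt_trans.
rewrite -(u1 n) ler_norml; have := hnorm_le_dist dot x (u n).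
by have := hnorm_le_dist dot (u n) x; rewrite (hnormBC _ x); lra.
Qed.

Lemma lin_hcvg u x : hcvg dot u x -> hcvg dot (A \o u) (A x).
Proof.
by move=> ux; apply: (hcvg_lip (M := M)) ux => y z; rewrite -linB.
Qed.

(** Let [l] be the supremum of the form on unit vectors of [S]. The form of [B = l - A] is
    nonnegative on [S], which bounds [|B x| ^ 2] by a multiple of [<B x, x>]. Hence [B u] tends to 0
    along a maximizing sequence [u], and compactness of [A] makes [u = (B u + A u) / l] converge
    along a subsequence. *)
Lemma max_eigenvector (S : set V) : (forall x, S x -> S (A x)) ->
  (forall x y, S x -> S y -> S (x + y)) -> (forall a x, S x -> S (a *: x)) ->
  (forall u x, (forall n, S (u n)) -> hcvg dot u x -> S x) ->
  (exists2 x, S x & 0 < rdot dot (A x) x) ->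
  exists p : V * R, [/\ S p.1, N p.1 = 1, 0 < p.2, A p.1 = p.2%:C *: p.1 &
    forall x, S x -> rdot dot (A x) x <= p.2 * N x ^+ 2].
Proof.
move=> SA SD SZ Scl [x0 Sx0 qx0].
pose E := [set rdot dot (A x) x | x in [set x | S x /\ N x = 1]].
have normalize x : S x -> N x != 0 -> E (rdot dot (A x) x / N x ^+ 2).
  move=> Sx nx; exists ((N x)^-1%:C *: x); last first.
    by rewrite linZ rdotZl rdotZr; field.
  split; first exact: SZ.
  by rewrite hnormZ cabs_real ger0_norm ?invr_ge0 ?hnorm_ge0// mulVf.
have nx0 : N x0 != 0.
  by apply: contraTneq qx0 => /hnorm0_eq0 ->; rewrite rdot0r ltxx.
have supE : has_sup E.
  split; first by exists (rdot dot (A x0) x0 / N x0 ^+ 2); exact: normalize.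
  exists M => _ [x [_ nx] <-]; apply: le_trans (rdot_le _ _ _) _.
  by rewrite nx mulr1; have := AM x; rewrite nx mulr1.
pose l := sup E.
have qle x : S x -> rdot dot (A x) x <= l * N x ^+ 2.
  move=> Sx; have [/hnorm0_eq0 ->|nx] := eqVneq (N x) 0.
    by rewrite rdot0r hnorm0 expr0n mulr0.
  have xx : 0 < N x ^+ 2 by rewrite exprn_gt0// lt_def nx hnorm_ge0.
  by rewrite -ler_pdivrMr//; apply: sup_upper_bound => //; exact: normalize.
have l0 : 0 < l.
  apply: lt_le_trans (sup_upper_bound supE (normalize _ Sx0 nx0)).
  by rewrite divr_gt0// exprn_gt0// lt_def nx0 hnorm_ge0.
have /choice[u uP] : forall n, exists x, [/\ S x, N x = 1 & l - n.+1%:R^-1 < rdot dot (A x) x].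
  move=> n; have n0 : 0 < n.+1%:R^-1 :> R by [].
  by have [_ [x [Sx nx] <-] lx] := sup_adherent n0 supE; exists x.
pose K := l + M.
have M0 : 0 <= M.
  by have := AM x0; rewrite -ler_pdivrMr ?lt_def ?nx0 ?hnorm_ge0//; apply: le_trans; rewrite divr_ge0 ?hnorm_ge0.
have K0 : 0 < K by rewrite ltr_wpDr.
have [B BxE] : exists B : V -> V, forall x, B x = l%:C *: x - A x by eexists.
have BE x y : rdot dot (B x) y = l * rdot dot x y - rdot dot (A x) y.
  by rewrite BxE rdotBl rdotZl.
have B_le x : S x -> N (B x) ^+ 2 <= K * (l * N x ^+ 2 - rdot dot (A x) x).
  move=> Sx; have SBx : S (B x).
    by rewrite BxE; apply: SD; [exact: SZ|rewrite -scaleN1r; apply/SZ/SA].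
  (* Nonnegativity of the form of [B] at [x - B x / K], together with
     [<B (B x), B x> <= K |B x| ^ 2], yields [|B x| ^ 2 <= K <B x, x>]. *)
  pose y := x - K^-1%:C *: B x.
  have Sy : S y by apply: SD => //; rewrite -scaleN1r; apply/SZ/SZ.
  have qB : - rdot dot (A (B x)) (B x) <= M * N (B x) ^+ 2.
    rewrite -rdotNl; apply: le_trans (rdot_le _ _ _) _.
    by rewrite hnormN expr2 mulrA ler_wpM2r ?hnorm_ge0.
  have := qle _ Sy; rewrite -rdotxx /y.
  rewrite linB linZ !(rdotBl, rdotBr, rdotZl, rdotZr) (rdotC _ (B x) x) (rdot_sym (B x) x).
  rewrite (rdotC _ (B x) (A x)) (rdotxx _ (B x)) => h.
  have e : l * rdot dot x (B x) - rdot dot (A x) (B x) = N (B x) ^+ 2.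
    by rewrite -BE rdotxx.
  have KK : K^-1 * K = 1 by rewrite mulVf// gt_eqF.
  rewrite -(rdotxx _ x).
  have Ki : 0 < K^-1 by rewrite invr_gt0.
  have h2 : K^-1 * N (B x) ^+ 2 <= l * rdot dot x x - rdot dot (A x) x.
    have : K^-1 * (K^-1 * (M * N (B x) ^+ 2 + rdot dot (A (B x)) (B x))) >= 0.
      by rewrite !mulr_ge0 ?(ltW Ki)//; lra.
    have -> : M = K - l by rewrite /K; ring.
    move: h e; set X := rdot dot x (B x); set Y := rdot dot (A x) (B x).
    set Z := N (B x) ^+ 2; set W := rdot dot (A (B x)) _.
    set P := rdot dot x x; set Q := rdot dot (A x) x; set k := K^-1 => h e h3.
    have h4 : k * (k * ((K - l) * Z + W)) = k * Z - k * (k * (l * Z - W)).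
      have -> : k * Z = k * (k * K) * Z by rewrite KK mulr1.
      by ring.
    by rewrite h4 in h3; move: h e h3; nra.
  by rewrite -ler_pdivrMl.
have Bu0 : hcvg dot (B \o u) 0.
  have K_cvg : (fun n => K * n.+1%:R^-1) @ \oo --> (0 : R).
    by rewrite -(mulr0 K); apply: cvgM; [exact: cvg_cst|exact: cvg_harmonic].
  apply/hcvgP => eps eps0; have /cvgrPdist_lt/(_ _ (exprn_gt0 2 eps0))[n0 _ h] := K_cvg.
  exists n0 => n n0n; rewrite -(@ltr_pXn2r _ 2)// ?nnegrE ?hnorm_ge0 ?(ltW eps0)//.
  apply: le_lt_trans (h n n0n); rewrite /= sub0r normrN subr0.
  rewrite (le_trans _ (ler_norm _))//; have [Su nu lu] := uP n.
  by apply: le_trans (B_le _ Su) _; rewrite nu expr1n mulr1 ler_pM2l// lerBlDr addrC -lerBlDr ltW.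
have [phi [y [phiS Auy]]] : exists (phi : nat -> nat) y,
    (forall n, (phi n < phi n.+1)%N) /\ hcvg dot (A \o u \o phi) y.
  by apply: Acpt; exists 1 => n; have [_ -> _] := uP n.
have lz : l%:C != 0 by rewrite -(rmorph0 (real_complex R)) (inj_eq (@complexI R)) gt_eqF.
pose v := l%:C^-1 *: y.
have uv : hcvg dot (u \o phi) v.
  rewrite (_ : u \o phi = fun n => l%:C^-1 *: ((B \o u \o phi) n + (A \o u \o phi) n)).
    apply: hcvgZ; rewrite -[y]add0r; apply: hcvgD => //.
    exact: hcvg_sub.
  by apply/funext => n /=; rewrite BxE subrK scalerA mulVf// scale1r.
exists (v, l); split => //=.
- by apply: Scl uv => n /=; have [] := uP (phi n).
- by apply: hcvg_norm1 uv => n /=; have [] := uP (phi n).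
- rewrite /v scalerA divff// scale1r.
  by apply: hcvg_unique (lin_hcvg uv) Auy.
Qed.

End symmetric_operator.

Section eigensystems.
Variables (R : realType) (V : lmodType R[i]) (dot : {dot V for Num.conj}).
Implicit Types (x y z : V).
Local Notation N := (hnorm dot).

(** A list with finitely many positive values is completed by zeros, and [e n = 0] is allowed there.
    [es_max] is the upper half of the minimax principle; it also encodes that no positive eigenvalue
    has been missed. *)
Record eigensystem (A : V -> V) (e : nat -> V) (l : nat -> R) : Prop := {
  es_ortho : orthosys dot e;
  es_eigen : forall n, A (e n) = (l n)%:C *: e n;
  es_decr : forall n, l n.+1 <= l n;
  es_ge0 : forall n, 0 <= l n;
  es_neq0 : forall n, 0 < l n -> e n != 0;
  es_max : forall n x, (forall i, (i < n)%N -> dot x (e i) = 0) ->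
    rdot dot (A x) x <= l n * N x ^+ 2;
  es_cvg0 : l @ \oo --> (0 : R) }.

Section properties.
Variables (A : V -> V) (e : nat -> V) (l : nat -> R).
Hypothesis Alin : linear A.
Hypothesis Asym : forall x y, dot (A x) y = dot x (A y).
Hypothesis Ael : eigensystem A e l.

Lemma es_nonincr m n : (m <= n)%N -> l n <= l m.
Proof.
elim: n => [|n ih]; first by rewrite leqn0 => /eqP ->.
rewrite leq_eqVlt => /orP[/eqP->//|/ih]; apply: le_trans.
exact: es_decr Ael n.
Qed.

Lemma es_orthonormal n : 0 < l n ->
  forall i j : 'I_n.+1, dot (e i) (e j) = (i == j)%:R.
Proof.
move=> ln i j; rewrite (es_ortho Ael); have -> : e i != 0.
  by apply: (es_neq0 Ael); apply: lt_le_trans ln _; apply: es_nonincr; rewrite -ltnS.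
by rewrite andbT.
Qed.

Lemma es_dot_invariant n x : dot x (e n) = 0 -> dot (A x) (e n) = 0.
Proof. by move=> xe; rewrite Asym (es_eigen Ael) dotZr xe mulr0. Qed.

Lemma es_small t : 0 < t -> exists n, l n < t.
Proof.
move=> t0; have /cvgrPdist_lt/(_ _ t0)[n _ /(_ n (leqnn n))] := es_cvg0 Ael.
by rewrite /= sub0r normrN ger0_norm ?(es_ge0 Ael)// => h; exists n.
Qed.

(** The indices with [l n = t] form an interval from [n0] to [n1] excluded. An eigenvector for [t],
    minus its components on these [e i], is orthogonal to every [e i] with [i < n1], since the
    earlier ones have another eigenvalue. Then [es_max] at [n1], where [l n1 < t], forces it to
    vanish. *)
Lemma es_enumerates : enumerates_pos_eigenvalues A l.
Proof.
split; [exact: es_decr Ael|exact: es_ge0 Ael|move=> t t0].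
have lt_ex := es_small t0; have le_ex : exists n, l n <= t.
  by have [n /ltW] := lt_ex; exists n.
have [n1 ln1 n1min] := ex_minnP lt_ex; have [n0 ln0 n0min] := ex_minnP le_ex.
have n01 : (n0 <= n1)%N by rewrite n0min// ltW.
have lE n : (l n == t) = (n0 <= n < n1)%N.
  apply/eqP/andP => [lnt|[n0n nn1]].
    split; first by rewrite n0min// lnt.
    by rewrite ltnNge; apply/negP => /es_nonincr; rewrite lnt leNgt ln1.
  apply/eqP; rewrite eq_le (le_trans (es_nonincr n0n))//= leNgt.
  by apply/negP => /n1min; rewrite leqNgt nn1.
have lE' (i : 'I_(n1 - n0)) : l (n0 + i) = t.
  by apply/eqP; rewrite lE leq_addr/= -ltn_subRL.
exists (n1 - n0)%N; split.
  have eO (i j : 'I_(n1 - n0)) : dot (e (n0 + i)) (e (n0 + j)) = (i == j)%:R.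
    by rewrite (es_ortho Ael) (es_neq0 Ael) ?lE'// eqn_add2l andbT.
  exists (fun i => e (n0 + i)); split=> [x|c c0 i]; last first.
    by rewrite -(dot_comb eO c) c0 linear0l.
  rewrite /eigspace /=; split=> [Ax|[c ->]]; last first.
    rewrite (lin_sum Alin) scaler_sumr; apply: eq_bigr => i _.
    by rewrite (linZ Alin) (es_eigen Ael) lE' !scalerA mulrC.
  exists (fun i => dot x (e (n0 + i))); apply/subr0_eq/(hnorm0_eq0 (dot := dot)).
  set s := \sum_i _; pose y := x - s.
  have Ay : A y = t%:C *: y.
    rewrite /y (linB Alin) Ax scalerBr; congr (_ - _).
    rewrite (lin_sum Alin) scaler_sumr; apply: eq_bigr => i _.
    by rewrite (linZ Alin) (es_eigen Ael) lE' !scalerA mulrC.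
  have yo i : (i < n1)%N -> dot y (e i) = 0.
    move=> in1; have [n0i|ilt] := leqP n0 i.
      have ik : (i - n0 < n1 - n0)%N by rewrite ltn_sub2r// (leq_ltn_trans n0i).
      have -> : i = (n0 + Ordinal ik)%N by rewrite /= subnKC.
      by rewrite dotBl (dot_comb eO (fun i => dot x (e (n0 + i)))) subrr.
    have tli : t < l i by rewrite ltNge; apply/negP => /n0min; rewrite leqNgt ilt.
    have : dot (A y) (e i) = dot y (A (e i)) by rewrite Asym.
    rewrite Ay (es_eigen Ael) dotZl dotZr conjc_real => /eqP.
    rewrite -subr_eq0 -mulrBl -rmorphB mulf_eq0 -(rmorph0 (real_complex R)).
    rewrite (inj_eq (@complexI R)) subr_eq0 (lt_eqF tli)/= => /eqP->.
    by rewrite rmorph0.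
  have := es_max Ael yo; rewrite Ay rdotZl rdotxx => h.
  apply/eqP; rewrite eq_le hnorm_ge0 andbT leNgt; apply/negP => ys.
  have y2 : 0 < N y ^+ 2 by rewrite exprn_gt0.
  by move: h; rewrite ler_pM2r// leNgt ln1.
have -> : [set n | l n = t] = addn n0 @` `I_(n1 - n0).
  apply/seteqP; split=> [n /eqP|_ /= [i ilt <-]].
    rewrite lE => /andP[n0n nn1]; exists (n - n0)%N; last by rewrite subnKC.
    by rewrite /= ltn_sub2r// (leq_ltn_trans n0n).
  exact: (lE' (Ordinal ilt)).
by apply: inj_card_eq; apply: in2W; exact: addnI.
Qed.

Lemma es_lambda_plus : lambda_plus A = l.
Proof. exact/lambda_plusE/es_enumerates. Qed.

(** The lower half of the minimax principle: on the span of the first [n + 1] eigenvectors the form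
    is a sum of squares with weights at least [l n]. *)
Lemma es_comb n (c : 'I_n.+1 -> R[i]) : 0 < l n ->
  l n * N (\sum_i c i *: e i) ^+ 2 <=
  rdot dot (A (\sum_i c i *: e i)) (\sum_i c i *: e i).
Proof.
move=> ln; have eO := es_orthonormal ln.
rewrite (lin_sum Alin); under [X in rdot _ X]eq_bigr do rewrite (linZ Alin) (es_eigen Ael).
rewrite (rdot_comb eO (fun i => l i)) (hnorm_comb eO) mulr_sumr; apply: ler_sum => i _.
by rewrite ler_wpM2r ?sqr_ge0// es_nonincr// -ltnS.
Qed.

End properties.

Section existence.
Variables (A : V -> V) (M : R).
Hypothesis Alin : linear A.
Hypothesis Asym : forall x y, dot (A x) y = dot x (A y).
Hypothesis AM : forall x, N (A x) <= M * N x.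
Hypothesis Acpt : compact_op dot A.

Let orth (s : seq V) : set V := [set x | {in s, forall y, dot x y = 0}].

(* A unit eigenvector maximizing the quadratic form of [A] orthogonally to [s],
   and [(0, 0)] once that form is no longer positive there. *)
Let next (s : seq V) : V * R := xget (0, 0)
  [set p | [/\ orth s p.1, N p.1 = 1, 0 < p.2, A p.1 = p.2%:C *: p.1 &
    forall x, orth s x -> rdot dot (A x) x <= p.2 * N x ^+ 2]].

Let Fixpoint prefix n := if n is k.+1 then (next (prefix k)).1 :: prefix k else [::].
Let e n := (next (prefix n)).1.
Let l n := (next (prefix n)).2.

Let orth_prefix n x : orth (prefix n) x <-> forall i, (i < n)%N -> dot x (e i) = 0.
Proof.
elim: n => [|n ih]; first by split.
split=> [h i|h].
  rewrite ltnS leq_eqVlt => /orP[/eqP->|ilt]; first by apply: h; rewrite mem_head.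
  have h' : orth (prefix n) x by move=> y ys; apply: h; rewrite inE ys orbT.
  exact: ih.1.
move=> y; rewrite inE => /orP[/eqP->|]; first exact: h.
by apply: (ih.2 _ y) => i ilt; apply: h; exact: ltnW.
Qed.

Let nextP s : next s = (0, 0) \/ [/\ orth s (next s).1, N (next s).1 = 1, 0 < (next s).2,
   A (next s).1 = (next s).2%:C *: (next s).1 &
    forall x, orth s x -> rdot dot (A x) x <= (next s).2 * N x ^+ 2].
Proof. by rewrite {1}/next; case: xgetP => [p -> //|]; [right|left]. Qed.

Let eigen n : A (e n) = (l n)%:C *: e n.
Proof.
rewrite /e /l; have [->|[]//] := nextP (prefix n).
by rewrite /= (lin0 Alin) scaler0.
Qed.

Let e_orth n : orth (prefix n) (e n).
Proof.
rewrite /e /l; have [->|[]//] := nextP (prefix n).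
by move=> y _; rewrite /= linear0l.
Qed.

Let maximal n x : orth (prefix n) x -> rdot dot (A x) x <= l n * N x ^+ 2.
Proof.
(* If [next] is the default, a positive value of the form would provide an admissible pair through
   [max_eigenvector], and [xget] would then have returned a pair with positive second component. *)
move=> ox; rewrite /l; have [n0|[_ _ _ _ h]] := nextP (prefix n); last exact: h.
rewrite n0 mul0r leNgt; apply/negP => Axx.
suff [p pP] : exists p : V * R, [/\ orth (prefix n) p.1, N p.1 = 1, 0 < p.2, A p.1 = p.2%:C *: p.1 &
    forall x, orth (prefix n) x -> rdot dot (A x) x <= p.2 * N x ^+ 2].
  have := @xgetI _ (0, 0) [set p | [/\ orth (prefix n) p.1, N p.1 = 1, 0 < p.2, A p.1 = p.2%:C *: p.1 &
    forall x, orth (prefix n) x -> rdot dot (A x) x <= p.2 * N x ^+ 2]] p pP.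
  by rewrite -/(next _) n0 /= => -[_ _]; rewrite ltxx.
apply: (max_eigenvector Alin Asym AM Acpt).
- move=> y /orth_prefix yo; apply/orth_prefix => i /yo yi.
  by rewrite Asym eigen dotZr yi mulr0.
- by move=> y z yo zo w ws; rewrite dotDl yo ?zo ?addr0.
- by move=> a y yo w ws; rewrite dotZl yo ?mulr0.
- by move=> u y uo uy w ws; apply: (hcvg_dot0 uy) => k; exact: uo.
- by exists x.
Qed.

Let e_or_0 n : (e n = 0 /\ l n = 0) \/ (N (e n) = 1 /\ 0 < l n).
Proof. by rewrite /e /l; have [->|[]] := nextP (prefix n); [left|right]. Qed.

Let ortho : orthosys dot e.
Proof.
have lt_orth i j : (i < j)%N -> dot (e j) (e i) = 0.
  by move=> ij; have /orth_prefix := @e_orth j; exact.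
move=> i j; have [->|] := eqVneq i j.
  rewrite dotxx; have [[-> _]|[N1 _]] := e_or_0 j.
    by rewrite eqxx hnorm0 expr0n.
  by rewrite N1 expr1n; case: eqVneq N1 => // ->; rewrite hnorm0 => /esym/eqP; rewrite oner_eq0.
rewrite neq_ltn => /orP[] ij; last exact: lt_orth.
by rewrite dotC lt_orth// conjc0.
Qed.

Let decr n : l n.+1 <= l n.
Proof.
have [[_ ->]|[N1 _]] := e_or_0 n.+1.
  by have [[_ ->]|[_ /ltW]] := e_or_0 n.
have := @maximal n (e n.+1); rewrite eigen rdotZl rdotxx N1 expr1n !mulr1; apply.
by move=> y ys; apply: e_orth; rewrite inE ys orbT.
Qed.

Let ge0 n : 0 <= l n.
Proof. by have [[_ ->]|[_ /ltW]] := e_or_0 n. Qed.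

(** If every [l n] were at least [eps], the [e n] would be orthonormal and the vectors [A (e n)]
    pairwise at distance at least [eps], against compactness. *)
Let cvg0 : l @ \oo --> (0 : R).
Proof.
have lni m n : (m <= n)%N -> l n <= l m.
  elim: n => [|n ih]; first by rewrite leqn0 => /eqP ->.
  by rewrite leq_eqVlt => /orP[/eqP->//|/ih]; apply: le_trans; exact: decr.
apply/cvgrPdist_lt => eps eps0.
suff [n ln] : exists n, l n < eps.
  exists n => // m /= nm; rewrite sub0r normrN ger0_norm ?ge0//.
  exact: le_lt_trans (lni _ _ nm) ln.
apply: contrapT => /forallNP h.
have lge n : eps <= l n by rewrite leNgt; apply/negP; exact: h.
have e1 n : N (e n) = 1.
  by have [[_ l0]|[]//] := e_or_0 n; have := lge n; rewrite l0 leNgt eps0.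
have [phi [y [phiS Aey]]] : exists (phi : nat -> nat) y,
    (forall n, (phi n < phi n.+1)%N) /\ hcvg dot (A \o e \o phi) y.
  by apply: Acpt; exists 1 => n; rewrite e1.
have [n0 h0] := hcvg_cauchy Aey eps0.
have := h0 n0 n0.+1 (leqnn _) (leqnSn _); rewrite ltNge => /negP; apply.
rewrite /= -(@ler_pXn2r _ 2)// ?nnegrE ?hnorm_ge0 ?(ltW eps0)//.
rewrite hnorm_sqrB !eigen !hnormZ !e1 !mulr1 rdotZl rdotZr !cabs_real.
rewrite /rdot ortho (ltn_eqF (phiS n0)) /= !mulr0 subr0 !real_normK ?num_real//.
by have := lge (phi n0); have := lge (phi n0.+1); nra.
Qed.

Theorem spectral_theorem : exists e l, eigensystem A e l.
Proof.
exists e, l; split=> //.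
- move=> n ln; apply: contraTneq ln => e0.
  by have [[_ ->]|[]] := e_or_0 n; rewrite ?ltxx// e0 hnorm0 => /esym/eqP; rewrite oner_eq0.
- by move=> n x /orth_prefix; exact: maximal.
Qed.

End existence.

End eigensystems.

(** * Projection on a closed span and the positive square root of [A ^ 2] *)

Section absolute_value.
Variables (R : realType) (V : lmodType R[i]) (dot : {dot V for Num.conj}).
Implicit Types (x y z : V).
Local Notation N := (hnorm dot).
Hypothesis Vcomplete : hcomplete dot.

Section projection.
Variable e : nat -> V.
Hypothesis eO : orthosys dot e.

Definition closed_proj x : V := xget 0 [set y | hcvg dot (oproj dot e ^~ x) y].

Lemma closed_proj_cvg x : hcvg dot (oproj dot e ^~ x) (closed_proj x).
Proof.
have [y xy] := Vcomplete (oproj_cauchy eO x).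
exact: (@xgetI _ 0 [set y | hcvg dot (oproj dot e ^~ x) y] y xy).
Qed.

Lemma closed_proj_linear : linear closed_proj.
Proof.
move=> a x y; apply: hcvg_unique (closed_proj_cvg _) _.
rewrite (_ : oproj dot e ^~ _ = fun n => a *: oproj dot e n x + oproj dot e n y).
  by apply: hcvgD; [apply: hcvgZ|]; exact: closed_proj_cvg.
by apply/funext => n; rewrite oproj_linear.
Qed.

Lemma dot_closed_proj x i : dot (closed_proj x) (e i) = dot x (e i).
Proof.
apply/subr0_eq; rewrite -dotBl.
apply: (@hcvg_dot0 _ _ _ (fun n => oproj dot e (i.+1 + n) x + - x)).
  apply: hcvgD; last exact: hcvg_cst.
  apply: (@hcvg_sub _ _ _ _ _ (addn i.+1)) (closed_proj_cvg x).
  by move=> n; rewrite addnS.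
by move=> n; rewrite dotBl (dot_oproj eO) leq_addr subrr.
Qed.

Lemma closed_projK x : closed_proj (closed_proj x) = closed_proj x.
Proof.
apply: hcvg_unique (closed_proj_cvg _) _.
rewrite (_ : oproj dot e ^~ _ = oproj dot e ^~ x); first exact: closed_proj_cvg.
by apply/funext => n; apply: eq_bigr => i _; rewrite dot_closed_proj.
Qed.

Lemma closed_proj_orth x y : (forall i, dot y (e i) = 0) -> dot (closed_proj x) y = 0.
Proof.
move=> ye; apply: hcvg_dot0 (closed_proj_cvg x) _ => n.
by rewrite dotC dot_orth_oproj ?conjc0.
Qed.

Lemma dot_sub_closed_proj x y : dot (closed_proj x) (y - closed_proj y) = 0.
Proof. by apply: closed_proj_orth => i; rewrite dotBl dot_closed_proj subrr. Qed.

End projection.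

Variables (A : V -> V) (M : R).
Hypothesis Alin : linear A.
Hypothesis Asym : forall x y, dot (A x) y = dot x (A y).
Hypothesis AM : forall x, N (A x) <= M * N x.

Lemma opp_linear : linear (fun x => - A x).
Proof. by move=> a x y; rewrite Alin opprD scalerN. Qed.

Lemma opp_symmetric x y : dot (- A x) y = dot x (- A y).
Proof. by rewrite linearNl/= linearNr/= Asym. Qed.

Lemma adjoint_symmetric : adjoint dot A = A.
Proof.
have h x y : dot (A x) y = dot x (adjoint dot A y).
  exact: (@xgetI _ (fun=> 0) [set B | forall x y, dot (A x) y = dot x (B y)] A Asym).
apply/funext => y; apply/subr0_eq/(dot_eq0 (dot := dot)) => x.
by rewrite dotC dotBr -h -Asym subrr conjc0.
Qed.

Lemma sym_real x : dot (A x) x = (rdot dot (A x) x)%:C.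
Proof.
have : dot (A x) x = conjc (dot (A x) x) by rewrite {1}Asym -dotC.
rewrite /rdot; case: (dot _ _) => a b [/eqP].
by rewrite -subr_eq0 opprK -mulr2n mulrn_eq0/= => /eqP ->.
Qed.

(* With [P] the projection onto the negative spectral subspace, [A (1 - 2 P)] is
   the absolute value. *)
Lemma exists_abs e l : eigensystem dot (fun x => - A x) e l ->
  exists B, [/\ linear B, forall x, 0 <= dot (B x) x & forall x, B (B x) = A (A x)].
Proof.
move=> es; have eO := es_ortho es; pose P := closed_proj e.
have Plin : linear P := closed_proj_linear eO.
have Ae n : A (e n) = (- l n)%:C *: e n.
  by rewrite -[LHS]opprK (es_eigen es) rmorphN scaleNr.
have AP x : A (P x) = P (A x).
  apply: (hcvg_unique (dot := dot)) (closed_proj_cvg eO _).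
  rewrite (_ : oproj dot e ^~ _ = A \o (oproj dot e ^~ x)).
    exact: (lin_hcvg Alin AM (closed_proj_cvg eO x)).
  apply/funext => n /=; rewrite /oproj (lin_sum Alin); apply: eq_bigr => i _.
  by rewrite (linZ Alin) Asym Ae dotZr conjc_real !scalerA mulrC.
have PP x : P (P x) = P x by exact: closed_projK.
pose J x := x - 2 *: P x.
(* [J] is a reflection commuting with [A], so [A J] squares to [A ^ 2]; its positivity is checked
   separately on the two summands [y] and [z] of [x]. *)
have AJ x : A (J x) = J (A x) by rewrite /J (linB Alin) (linZ Alin) AP.
have JJ x : J (J x) = x.
  rewrite /J (linB Plin) (linZ Plin) PP -[X in 2 *: (X - _)]scale1r -scalerBl.
  by rewrite scalerA -addrA -opprD -scalerDl (_ : 2 + _ = 0) ?scale0r ?subr0//; ring.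
exists (fun x => A (J x)); split=> [a x y|x|x]; last by rewrite -AJ JJ.
  rewrite -Alin; congr A; rewrite /J Plin scalerBr !scalerDr opprD !scalerA [2 * a]mulrC.
  by rewrite addrACA.
pose y := x - P x; pose z := P x.
have xE : x = y + z by rewrite /y subrK.
have JE : J x = y - z by rewrite /J /y /z scalerDl scale1r opprD addrA.
have yz u : dot (P u) y = 0 by exact: dot_sub_closed_proj.
have zy : dot (A z) y = 0 by rewrite /z AP yz.
have yz0 : dot (A y) z = 0 by rewrite Asym dotC zy conjc0.
have -> : dot (A (J x)) x = (rdot dot (A y) y - rdot dot (A z) z)%:C.
  rewrite JE [X in dot _ X]xE (linB Alin) dotBl (dotDr _ _ y z) (dotDr _ _ y z) zy yz0 add0r addr0.
  by rewrite !sym_real rmorphB.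
rewrite ler0c subr_ge0.
(* [y] is orthogonal to the whole list of eigenvectors of [- A], so [es_max] bounds [- <A y, y>] by
   [l n * N y ^ 2] for every [n], and [l n] tends to 0. *)
have yP : 0 <= rdot dot (A y) y.
  rewrite leNgt; apply/negP => ylt0; have y0 : 0 < N y ^+ 2.
    rewrite exprn_gt0// lt_def hnorm_ge0 andbT; apply: contraTneq ylt0.
    by move=> /hnorm0_eq0 ->; rewrite rdot0r ltxx.
  have [n ln] : exists n, l n < - rdot dot (A y) y / N y ^+ 2.
    by apply: (es_small es); rewrite divr_gt0// oppr_gt0.
  have yo i : (i < n)%N -> dot y (e i) = 0.
    by move=> _; rewrite dotBl (dot_closed_proj eO) subrr.
  have := es_max es yo; rewrite rdotNl -ler_pdivrMr// leNgt.
  by rewrite ln.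
have zN : rdot dot (A z) z <= 0.
  have zc : hcvg dot (A \o oproj dot e ^~ x) (A z).
    exact: (lin_hcvg Alin AM (closed_proj_cvg eO x)).
  rewrite -(cvg_lim _ (hcvg_rdot (y := z) zc))//.
  apply: limr_le; first by apply/cvg_ex; exists (rdot dot (A z) z); exact: hcvg_rdot.
  apply: nearW => n /=; rewrite (lin_sum Alin) rdot_sum sumr_le0// => i _.
  rewrite (linZ Alin) Ae scalerA mulrC -scalerA rdotZl mulNr oppr_le0 mulr_ge0 ?(es_ge0 es)//.
  rewrite /rdot dotZl -(dot_closed_proj eO) -/P -/z [dot (e i) z]dotC mulcJ_cabs.
  by rewrite sqr_ge0.
exact: le_trans zN yP.
Qed.

End absolute_value.

(** * Minimax comparisons *)

Section minimax.
Variables (R : realType) (V : lmodType R[i]) (dot : {dot V for Num.conj}).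
Implicit Types (x y z : V).
Local Notation N := (hnorm dot).

(** Two families of functionals are kept apart because constraints of different origin, such as
    [<x, u j>] and [<T x, e' j>], are imposed together. *)
Lemma exists_unit_orth n m1 m2 (v : 'I_n -> V)
    (phi1 : 'I_m1 -> V -> R[i]) (phi2 : 'I_m2 -> V -> R[i]) :
  (forall i j, dot (v i) (v j) = (i == j)%:R) ->
  (forall j a x y, phi1 j (a *: x + y) = a * phi1 j x + phi1 j y) ->
  (forall j a x y, phi2 j (a *: x + y) = a * phi2 j x + phi2 j y) ->
  (m1 + m2 < n)%N ->
  exists c : 'I_n -> R[i], [/\ 0 < N (\sum_i c i *: v i),
    forall j, phi1 j (\sum_i c i *: v i) = 0 & forall j, phi2 j (\sum_i c i *: v i) = 0].
Proof.
move=> vO lin1 lin2 mn.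
have lsum (f : V -> R[i]) : (forall a x y, f (a *: x + y) = a * f x + f y) ->
    forall c, f (\sum_i c i *: v i) = \sum_i c i * f (v i).
  move=> flin c; have f0 : f 0 = 0.
    by have /eqP := flin 1 0 0; rewrite scaler0 addr0 mul1r -subr_eq0 opprD addNKr oppr_eq0 => /eqP.
  by elim/big_rec2 : _ => // i x y _ <-; rewrite flin.
have [c [[i0 ci0] c0]] := exists_combination (fun (j : 'I_(m1 + m2)) (i : 'I_n) =>
  match fintype.split j with inl k => phi1 k (v i) | inr k => phi2 k (v i) end) mn.
exists c; split=> [|j|j].
- rewrite lt_def hnorm_ge0 andbT; apply/eqP => cN.
  have := hnorm_comb vO c; rewrite cN expr0n/= => /esym/eqP.
  rewrite psumr_eq0 => [|i _]; last exact: sqr_ge0.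
  move=> /allP/(_ i0 (mem_index_enum _)); rewrite sqrf_eq0 => /eqP/cabs0_eq0/eqP.
  by rewrite (negbTE ci0).
- by rewrite lsum//; have := c0 (lshift m2 j); rewrite (unsplitK (inl j)).
- by rewrite lsum//; have := c0 (rshift m1 j); rewrite (unsplitK (inr j)).
Qed.

Variable A : V -> V.
Hypothesis Alin : linear A.
Hypothesis Asym : forall x y, dot (A x) y = dot x (A y).

Lemma dot_form y a x z : dot (a *: x + z) y = a * dot x y + dot z y.
Proof. by rewrite dotDl dotZl. Qed.

(* The trial space is spanned by [n + m + 1] eigenvectors of [A]; the [m + n]
   constraints leave a nonzero [x] there for which [T x] is orthogonal to the first
   [n] eigenvectors of [- A]. *)
Lemma eigenvalue_shift e a e' b (T : V -> V) (u : nat -> V) n m eps :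
  eigensystem dot A e a -> eigensystem dot (fun x => - A x) e' b ->
  linear T -> (forall x, N (T x) <= N x) -> 0 <= eps ->
  (forall x, (forall j, (j < m)%N -> dot x (u j) = 0) ->
    rdot dot (A x) x + rdot dot (A (T x)) (T x) <= eps * N x ^+ 2) ->
  a (n + m) <= b n + eps.
Proof.
move=> ea eb Tlin TN eps0 uP.
have [a0|] := leP (a (n + m)) 0.
  by apply: le_trans a0 _; rewrite addr_ge0// (es_ge0 eb).
move=> a0; have eO := es_orthonormal ea a0.
have [|||c [xN xu xe']] := exists_unit_orth (phi1 := fun j : 'I_m => dot ^~ (u j))
    (phi2 := fun (j : 'I_n) x => dot (T x) (e' j)) eO.
- by move=> j *; exact: dot_form.
- by move=> j s x y; rewrite Tlin dot_form.
- by rewrite ltnS addnC.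
set x := \sum_i _ in xN xu xe'.
have ax := es_comb Alin ea c a0; rewrite -/x in ax.
have := uP x (fun j jm => xu (Ordinal jm)).
have := es_max eb (fun j jn => xe' (Ordinal jn)); rewrite rdotNl.
have TN2 : N (T x) ^+ 2 <= N x ^+ 2 by rewrite ler_pXn2r ?nnegrE ?hnorm_ge0.
have b0 := es_ge0 eb n; have x2 : 0 < N x ^+ 2 by rewrite exprn_gt0.
have := ler_wpM2l b0 TN2 => h1 h2 h3.
by rewrite -(ler_pM2r x2); move: ax h1 h2 h3; lra.
Qed.

Variable B : V -> V.
Hypothesis Blin : linear B.
Hypothesis Bpos : forall x, 0 <= dot (B x) x.
Hypothesis BB : forall x, B (B x) = A (A x).

(** The form is real at [x + y] and at [x + 'i *: y]; these two evaluations compare the imaginary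
    and the real parts of [<B x, y>] and [<B y, x>]. *)
Lemma pos_sym x y : dot (B x) y = dot x (B y).
Proof.
have Im0 z : complex.Im (dot (B z) z) = 0.
  by have := Bpos z; case: (dot _ _) => ? ?; rewrite lecE /= => /andP[/eqP].
rewrite [RHS]dotC; have := Im0 (x + y); have := Im0 (x + 'i *: y).
rewrite !(linD Blin) (linZ Blin) !dotDl !dotDr !dotZl !dotZr.
move: (Im0 x) (Im0 y).
case: (dot (B x) x) (dot (B y) y) (dot (B x) y) (dot (B y) x) => [a1 b1] [a2 b2] [a3 b3] [a4 b4] /= -> ->.
by move=> h1 h2; apply/eqP; rewrite eq_complex /=; apply/andP; split; apply/eqP; lra.
Qed.

Lemma abs_hnorm x : N (B x) = N (A x).
Proof.
apply/eqP; rewrite -(@eqrXn2 _ 2)// ?hnorm_ge0//; apply/eqP.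
by rewrite -!rdotxx (rdot_sym pos_sym) BB -(rdot_sym Asym).
Qed.

Lemma abs_compact : hcomplete dot -> compact_op dot A -> compact_op dot B.
Proof.
move=> Vc Ac u /Ac[phi [y [phiS Auy]]].
have /Vc[z Buz] : hcauchy dot (B \o u \o phi).
  move=> eps /(hcvg_cauchy Auy)[n0 h]; exists n0 => n m n0n n0m.
  by rewrite /= -(linB Blin) abs_hnorm (linB Alin); exact: h.
by exists phi, z; split.
Qed.

Section compare.
Variables (e e' f : nat -> V) (a b s : nat -> R).
Hypothesis ea : eigensystem dot A e a.
Hypothesis eb : eigensystem dot (fun x => - A x) e' b.
Hypothesis es : eigensystem dot B f s.

Let orth_span (C : V -> V) (g : nat -> V) l n : linear C ->
  (forall x y, dot (C x) y = dot x (C y)) -> eigensystem dot C g l ->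
  forall x, (forall i, (i < n)%N -> dot x (g i) = 0) ->
    forall i, (i < n)%N -> dot (C x) (g i) = 0.
Proof. by move=> Cl Cs ec x xg i ilt; apply: (es_dot_invariant Cs ec); exact: xg. Qed.

(** Some combination of [n1 + n2 + 1] singular vectors is orthogonal to the first [n1] eigenvectors
    of [A] and the first [n2] of [- A]. The space [S] of all such orthogonal vectors is invariant
    under [A], whose form is bounded there from both sides, so [numerical_radius] bounds [|A x|],
    which equals [|B x|]. *)
Lemma singular_le_max n1 n2 : s (n1 + n2) <= Num.max (a n1) (b n2).
Proof.
have m0 : 0 <= Num.max (a n1) (b n2) by rewrite le_max (es_ge0 ea).
have [s0|s0] := leP (s (n1 + n2)) 0; first exact: le_trans s0 m0.
have fO := es_orthonormal es s0.
have [|||c [xN xe xe']] := exists_unit_orth (phi1 := fun j : 'I_n1 => dot ^~ (e j))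
    (phi2 := fun j : 'I_n2 => dot ^~ (e' j)) fO.
- by move=> j *; exact: dot_form.
- by move=> j *; exact: dot_form.
- by rewrite ltnS.
set x := \sum_i _ in xN xe xe'.
have sx := es_comb Blin es c s0; rewrite -/x in sx.
pose S : set V := [set x | (forall i, (i < n1)%N -> dot x (e i) = 0) /\
                           (forall i, (i < n2)%N -> dot x (e' i) = 0)].
have Ax : N (A x) <= Num.max (a n1) (b n2) * N x.
  apply: (numerical_radius Alin Asym (S := S)) => //.
  - move=> y [ye ye']; split=> i ilt; first by apply: (orth_span Alin Asym ea) ilt.
    have := orth_span (opp_linear Alin) (opp_symmetric Asym) eb ye' ilt.
    by rewrite linearNl/= => /eqP; rewrite oppr_eq0 => /eqP.
  - move=> y z [ye ye'] [ze ze']; split=> i ilt.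
      by rewrite dotDl ye// ze// addr0.
    by rewrite dotDl ye'// ze'// addr0.
  - by move=> t y [ye ye']; split=> i ilt; rewrite dotZl ?ye ?ye' ?mulr0.
  - move=> y [ye ye']; have y2 := sqr_ge0 (N y).
    have := es_max eb ye'; have := es_max ea ye; rewrite rdotNl => h1 h2.
    rewrite ler_norml lerNl (le_trans h2) ?(le_trans h1)//.
      by rewrite ler_wpM2r// le_max lexx.
    by rewrite ler_wpM2r// le_max lexx orbT.
  - by split=> i ilt; [have := xe (Ordinal ilt)|have := xe' (Ordinal ilt)].
rewrite -(ler_pM2r xN); apply: le_trans Ax; rewrite -abs_hnorm.
rewrite -(ler_pM2r xN); apply: le_trans (rdot_le _ _ _).
by rewrite -mulrA -expr2.
Qed.

(** The trial space is now spanned by [n1 + 1] eigenvectors of [A] and [n2 + 1] of [- A].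
    Orthogonality to [n1 + n2 + 1] singular vectors still leaves a nonzero vector, whence the index
    on the right. *)
Lemma min_le_singular n1 n2 : Num.min (a n1) (b n2) <= s (n1 + n2).+1.
Proof.
have [m0|] := leP (Num.min (a n1) (b n2)) 0.
  by apply: le_trans m0 _; exact: es_ge0 es _.
set m := Num.min _ _ => m0.
have [a0 b0] : 0 < a n1 /\ 0 < b n2 by move: m0; rewrite lt_min => /andP[].
have eO := es_orthonormal ea a0; have e'O := es_orthonormal eb b0.
pose v (i : 'I_(n1.+1 + n2.+1)) := match fintype.split i with inl j => e j | inr j => e' j end.
pose l (i : 'I_(n1.+1 + n2.+1)) := match fintype.split i with inl j => a j | inr j => - b j end.
have Av i : A (v i) = (l i)%:C *: v i.
  rewrite /v /l; case: (fintype.split i) => j; first exact: es_eigen ea j.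
  by rewrite -[LHS]opprK (es_eigen eb) rmorphN scaleNr.
have ee' i j : (i <= n1)%N -> (j <= n2)%N -> dot (e i) (e' j) = 0.
  move=> ilt jlt; have ai : 0 < a i by apply: lt_le_trans a0 (es_nonincr ea _).
  have bj : 0 < b j by apply: lt_le_trans b0 (es_nonincr eb _).
  have := Asym (e i) (e' j); rewrite (es_eigen ea) -[A (e' j)]opprK (es_eigen eb).
  rewrite -scaleNr -rmorphN dotZl dotZr conjc_real => /eqP.
  rewrite -subr_eq0 -mulrBl -rmorphB opprK mulf_eq0 -(rmorph0 (real_complex R)).
  by rewrite (inj_eq (@complexI R)) gt_eqF ?addr_gt0//= rmorph0 => /eqP.
have vO i j : dot (v i) (v j) = (i == j)%:R.
  rewrite /v -(inj_eq (can_inj (@splitK n1.+1 n2.+1))).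
  case: (fintype.split i) (fintype.split j) => [i'|i'] [j'|j'].
  - by rewrite eO.
  - by rewrite ee' // -ltnS.
  - by rewrite dotC ee' ?conjc0// -ltnS.
  - by rewrite e'O.
have [|||c [xN xf _]] := exists_unit_orth (phi1 := fun j : 'I_(n1 + n2).+1 => dot ^~ (f j))
    (phi2 := fun (j : 'I_0) x => dot x x) vO.
- by move=> j *; exact: dot_form.
- by case.
- by rewrite addn0 addSn addnS ltnS.
set x := \sum_i _ in xN xf.
have mAx : m * N x <= N (A x).
  rewrite -(@ler_pXn2r _ 2)// ?nnegrE ?mulr_ge0 ?hnorm_ge0 ?(ltW m0)//.
  rewrite /x (lin_sum Alin); under [X in _ <= N X ^+ 2]eq_bigr do rewrite (linZ Alin) Av scalerA.
  rewrite exprMn !(hnorm_comb vO) mulr_sumr; apply: ler_sum => i _.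
  rewrite cabsM exprMn mulrC ler_wpM2l ?sqr_ge0// cabs_real ler_pXn2r ?nnegrE ?(ltW m0)//.
  rewrite /l; case: (fintype.split i) => j.
    rewrite ger0_norm ?(es_ge0 ea)//; apply: le_trans (es_nonincr ea (n := n1) _).
      by rewrite /m ge_min lexx.
    by rewrite -ltnS.
  rewrite normrN ger0_norm ?(es_ge0 eb)//; apply: le_trans (es_nonincr eb (n := n2) _).
    by rewrite /m ge_min lexx orbT.
  by rewrite -ltnS.
have sBx : N (B x) <= s (n1 + n2).+1 * N x.
  apply: (numerical_radius Blin pos_sym
    (S := [set x | forall i, (i < (n1 + n2).+1)%N -> dot x (f i) = 0])) => //=.
  - by move=> y yf i ilt; apply: (orth_span Blin pos_sym es) ilt.
  - by move=> y z ye ze i ilt; rewrite dotDl ye// ze// addr0.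
  - by move=> t y ye i ilt; rewrite dotZl ye ?mulr0.
  - exact: es_ge0 es _.
  - move=> y ye; rewrite ger0_norm; first by apply: (es_max es); exact: ye.
    by have := Bpos y; rewrite lecE => /andP[].
  - by move=> i ilt; exact: xf (Ordinal ilt).
rewrite -(ler_pM2r xN); apply: le_trans mAx _.
by rewrite -abs_hnorm.
Qed.

End compare.

End minimax.

Section lambda.
Variables (R : realType) (V : lmodType R[i]) (dot : {dot V for Num.conj}).
Local Notation N := (hnorm dot).
Variables (A : V -> V) (M : R).
Hypothesis Vcomplete : hcomplete dot.
Hypothesis Alin : linear A.
Hypothesis Asym : forall x y, dot (A x) y = dot x (A y).
Hypothesis AM : forall x, N (A x) <= M * N x.
Hypothesis Acpt : compact_op dot A.

Lemma opp_compact : compact_op dot (fun x => - A x).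
Proof.
move=> u /Acpt[phi [y [phiS Auy]]]; exists phi, (- y); split=> //.
rewrite (_ : (fun _ => _) = fun n => N (A (u (phi n)) - y))//.
by apply/funext => n; rewrite -opprD hnormN.
Qed.

Lemma eigensystem_plus : exists e, eigensystem dot A e (lambda_plus A).
Proof.
have [e [l el]] := spectral_theorem Alin Asym AM Acpt.
by exists e; rewrite (es_lambda_plus Alin Asym el).
Qed.

Lemma eigensystem_minus : exists e, eigensystem dot (fun x => - A x) e (lambda_minus A).
Proof.
have AM' x : N (- A x) <= M * N x by rewrite hnormN.
have [e [l el]] := spectral_theorem (opp_linear Alin) (opp_symmetric Asym) AM' opp_compact.
exists e; rewrite /lambda_minus.
by rewrite (es_lambda_plus (opp_linear Alin) (opp_symmetric Asym) el).
Qed.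

(** Existence is enough: whichever positive square root [xget] picks has these three properties, and
    all later arguments about [abs_op] go through them. *)
Lemma abs_opP : [/\ linear (abs_op dot A), forall x, 0 <= dot (abs_op dot A x) x &
  forall x, abs_op dot A (abs_op dot A x) = A (A x)].
Proof.
have [e el] := eigensystem_minus.
have [B BP] := exists_abs Vcomplete Alin Asym AM el.
rewrite /abs_op /sqrt_op (adjoint_symmetric Asym) /=.
exact: (@xgetI _ (fun=> 0) [set B | [/\ linear B, forall x, 0 <= dot (B x) x &
   forall x, B (B x) = A (A x)]] B BP).
Qed.

Lemma eigensystem_abs : exists e, eigensystem dot (abs_op dot A) e (singular_values dot A).
Proof.
have [Blin Bpos BB] := abs_opP.
have Bsym := pos_sym Blin Bpos.
have BM x : N (abs_op dot A x) <= M * N x by rewrite (abs_hnorm Asym Blin).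
have Bc := abs_compact Alin Asym Blin Bpos BB Vcomplete Acpt.
have [e [l el]] := spectral_theorem Blin Bsym BM Bc.
by exists e; rewrite /singular_values (es_lambda_plus Blin Bsym el).
Qed.

Lemma lambda_plus_ge0 n : 0 <= lambda_plus A n.
Proof. by have [e el] := eigensystem_plus; exact: es_ge0 el n. Qed.

Lemma lambda_minus_ge0 n : 0 <= lambda_minus A n.
Proof. by have [e el] := eigensystem_minus; exact: es_ge0 el n. Qed.

Lemma singular_values_ge0 n : 0 <= singular_values dot A n.
Proof. by have [e el] := eigensystem_abs; exact: es_ge0 el n. Qed.

Lemma singular_values_nonincr m n : (m <= n)%N ->
  singular_values dot A n <= singular_values dot A m.
Proof. by have [e el] := eigensystem_abs; exact: (es_nonincr el). Qed.

Lemma lambda_plus_nonincr m n : (m <= n)%N -> lambda_plus A n <= lambda_plus A m.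
Proof. by have [e el] := eigensystem_plus; exact: (es_nonincr el). Qed.

Lemma lambda_minus_nonincr m n : (m <= n)%N -> lambda_minus A n <= lambda_minus A m.
Proof. by have [e el] := eigensystem_minus; exact: (es_nonincr el). Qed.

Lemma singular_values_le_max n1 n2 :
  singular_values dot A (n1 + n2) <= Num.max (lambda_plus A n1) (lambda_minus A n2).
Proof.
have [Blin Bpos BB] := abs_opP.
have [e el] := eigensystem_plus; have [e' el'] := eigensystem_minus.
have [f fs] := eigensystem_abs.
exact: (singular_le_max Alin Asym Blin Bpos BB el el' fs).
Qed.

Lemma min_le_singular_values n1 n2 :
  Num.min (lambda_plus A n1) (lambda_minus A n2) <= singular_values dot A (n1 + n2).+1.
Proof.
have [Blin Bpos BB] := abs_opP.
have [e el] := eigensystem_plus; have [e' el'] := eigensystem_minus.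
have [f fs] := eigensystem_abs.
exact: (min_le_singular Alin Asym Blin Bpos BB el el' fs).
Qed.

Variables (T : V -> V) (u : nat -> V).
Hypothesis Tlin : linear T.
Hypothesis TN : forall x, N (T x) <= N x.

Lemma lambda_shift m eps n : 0 <= eps ->
  (forall x, (forall j, (j < m)%N -> dot x (u j) = 0) ->
    `|rdot dot (A x) x + rdot dot (A (T x)) (T x)| <= eps * N x ^+ 2) ->
  lambda_plus A (n + m) <= lambda_minus A n + eps /\
  lambda_minus A (n + m) <= lambda_plus A n + eps.
Proof.
move=> eps0 h; have [e el] := eigensystem_plus; have [e' el'] := eigensystem_minus.
split.
  apply: (eigenvalue_shift Alin n (u := u) el el' Tlin TN eps0) => x /h.
  by apply: le_trans; exact: ler_norm.
have el2 : eigensystem dot (fun x => - - A x) e (lambda_plus A).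
  by rewrite (_ : (fun x => - - A x) = A)//; apply/funext => x; rewrite opprK.
apply: (eigenvalue_shift (opp_linear Alin) n (u := u) el' el2 Tlin TN eps0).
move=> x /h; apply: le_trans.
by rewrite !rdotNl -opprD -normrN ler_norm.
Qed.

End lambda.

(** * Power asymptotics of eigenvalue sequences *)

Section limsup_comparison.
Variable R : realType.
Implicit Types (f g : nat -> \bar R) (u v w : nat -> R).
Local Open Scope ereal_scope.

Lemma limn_esupE f : limn_esup f = ereal_inf (range (esups f)).
Proof. by rewrite limn_esup_lim; apply/cvg_lim => //; exact: cvg_esups_inf. Qed.

Lemma limn_einfE f : limn_einf f = ereal_sup (range (einfs f)).
Proof. by rewrite limn_einf_lim; apply/cvg_lim => //; exact: cvg_einfs_sup. Qed.

Lemma limn_esup_le_ev f x n0 : (forall n, (n0 <= n)%N -> f n <= x) -> limn_esup f <= x.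
Proof.
move=> fx; rewrite limn_esupE; apply: (@le_trans _ _ (esups f n0)).
  by apply: ereal_inf_lbound; exists n0.
by apply: ge_ereal_sup => _ [n /= n0n <-]; exact: fx.
Qed.

Lemma limn_esup_lt_ev f x : limn_esup f < x ->
  exists n0, forall n, (n0 <= n)%N -> f n < x.
Proof.
rewrite limn_esupE => /ereal_inf_lt[_ [n0 _ <-] fx]; exists n0 => n n0n.
by apply: le_lt_trans fx; apply: ereal_sup_ubound; exists n.
Qed.

Lemma limn_einf_le_freq f x :
  (forall n0, exists2 n, (n0 <= n)%N & f n <= x) -> limn_einf f <= x.
Proof.
move=> fx; rewrite limn_einfE; apply: ge_ereal_sup => _ [n0 _ <-].
have [n n0n fnx] := fx n0; apply: le_trans fnx.
by apply: ereal_inf_lbound; exists n.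
Qed.

Lemma limn_einf_lt_freq f x : limn_einf f < x ->
  forall n0, exists2 n, (n0 <= n)%N & f n < x.
Proof.
rewrite limn_einfE => fx n0.
have : einfs f n0 < x.
  by apply: le_lt_trans fx; apply: ereal_sup_ubound; exists n0.
by move=> /ereal_inf_lt[_ [n /= n0n <-] fnx]; exists n.
Qed.

Let between (c l : R) (L : \bar R) : (0 < c)%R -> (c * l)%:E < L ->
  exists x y : R, [/\ (l < x)%R, (c * x < y)%R & y%:E < L].
Proof.
move=> c0 clL; have [y [cly yL]] : exists y : R, (c * l < y)%R /\ y%:E < L.
  case: L clL => [L| |//]; last by exists (c * l + 1)%R; rewrite ltry; split=> //; lra.
  by rewrite lte_fin => h; exists ((c * l + L) / 2)%R; rewrite lte_fin; lra.
exists (l + (y - c * l) / (2 * c))%R, y; split=> //.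
  by rewrite ltrDl divr_gt0 ?mulr_gt0// subr_gt0.
have -> : (c * (l + (y - c * l) / (2 * c)) = (c * l + y) / 2)%R by field; lra.
by lra.
Qed.

(** Every large [n] is paired with some [k] beyond [K], and a bound of [v] at [k] is carried to [u]
    at [n] with an arbitrarily small loss. *)
Lemma limn_esup_compare u v (c : R) : (0 < c)%R -> (forall n, 0 <= v n)%R ->
  (forall x y, (0 <= x)%R -> (c * x < y)%R -> forall K, exists n0, forall n, (n0 <= n)%N ->
     exists2 k, (K <= k)%N & (v k <= x -> u n <= y)%R) ->
  limn_esup (EFin \o u) <= c%:E * limn_esup (EFin \o v).
Proof.
move=> c0 v0 h; rewrite leNgt; apply/negP.
have : 0 <= limn_esup (EFin \o v).
  rewrite limn_esupE; apply: le_ereal_inf_tmp => _ [n _ <-].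
  by apply: (@le_trans _ _ (v n)%:E); [rewrite lee_fin|apply: ereal_sup_ubound; exists n => /=].
case L : (limn_esup (EFin \o v)) => [l| |//] l0; last by rewrite gt0_muley ?lte_fin// ltNge leey.
rewrite -EFinM => /(between c0)[x [y [lx cxy yL]]].
have [K vK] : exists K, forall n, (K <= n)%N -> (EFin \o v) n < x%:E.
  by apply: limn_esup_lt_ev; rewrite L lte_fin.
have x0 : (0 <= x)%R by apply: le_trans (ltW lx); rewrite -lee_fin.
have [n0 un] := h _ _ x0 cxy K.
move: yL; rewrite ltNge => /negP; apply; apply: (@limn_esup_le_ev _ _ n0) => n /un[k Kk vu].
by rewrite lee_fin vu// -lee_fin ltW// vK.
Qed.

(** The pairing goes from [k] to [n] here: small values of [v] occur only along a subsequence of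
    indices [k], and each has to produce a late index for [u]. *)
Lemma limn_einf_compare u v (c : R) : (0 < c)%R -> (forall n, 0 <= v n)%R ->
  (forall x y, (0 <= x)%R -> (c * x < y)%R -> forall K, exists k0, forall k, (k0 <= k)%N ->
     exists2 n, (K <= n)%N & (v k <= x -> u n <= y)%R) ->
  limn_einf (EFin \o u) <= c%:E * limn_einf (EFin \o v).
Proof.
move=> c0 v0 h; rewrite leNgt; apply/negP.
have : 0 <= limn_einf (EFin \o v).
  rewrite limn_einfE; apply: (@le_trans _ _ (einfs (EFin \o v) 0%N)).
    by apply: le_ereal_inf_tmp => _ [n _ <-]; rewrite lee_fin.
  by apply: ereal_sup_ubound; exists 0%N.
case L : (limn_einf (EFin \o v)) => [l| |//] l0; last by rewrite gt0_muley ?lte_fin// ltNge leey.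
rewrite -EFinM => /(between c0)[x [y [lx cxy yL]]].
have x0 : (0 <= x)%R by apply: le_trans (ltW lx); rewrite -lee_fin.
move: yL; rewrite ltNge => /negP; apply; apply: limn_einf_le_freq => K.
have [k0 un] := h _ _ x0 cxy K.
have [k k0k vk] : exists2 k, (k0 <= k)%N & (EFin \o v) k < x%:E.
  by apply: limn_einf_lt_freq; rewrite L lte_fin.
have [n Kn vu] := un k k0k; exists n => //.
by rewrite lee_fin vu// -lee_fin ltW.
Qed.

End limsup_comparison.

Section power_asymptotics.
Variables (R : realType) (p : R).
Hypothesis p0 : 0 < p.
Implicit Types (u v : nat -> R).

Let F u n := n.+1%:R * u n `^ p.

Let F_ge0 u n : 0 <= F u n.
Proof. by rewrite mulr_ge0 ?powR_ge0. Qed.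

Lemma lt_truncnS (x : R) : 0 <= x -> x < (Num.truncn x).+1%:R.
Proof. by move=> x0; rewrite -truncn_lt_nat. Qed.

(** Either [y <= r * x] and the first term alone dominates, or [r * x < y] and the second one does.
    This covers [p] on both sides of 1, with a coefficient of the first term close to 1 for small
    [r]. *)
Lemma powR_add_le (r x y : R) : 0 <= x -> 0 <= y -> 0 < r ->
  (x + y) `^ p <= (1 + r) `^ p * x `^ p + (1 + r^-1) `^ p * y `^ p.
Proof.
move=> x0 y0 r0; have r1 : 0 <= 1 + r by rewrite addr_ge0 ?(ltW r0).
have r2 : 0 <= 1 + r^-1 by rewrite addr_ge0 ?invr_ge0 ?(ltW r0).
rewrite -!powRM//; have [yx|xy] := leP y (r * x).
  apply: (@le_trans _ _ (((1 + r) * x) `^ p)); last by rewrite lerDl powR_ge0.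
  by rewrite ge0_ler_powR ?nnegrE ?addr_ge0 ?mulr_ge0 ?(ltW p0)//; lra.
apply: (@le_trans _ _ (((1 + r^-1) * y) `^ p)); last by rewrite lerDr powR_ge0.
rewrite ge0_ler_powR ?nnegrE ?addr_ge0 ?mulr_ge0 ?(ltW p0)//.
by rewrite mulrDl mul1r addrC lerD2l -ler_pdivrMl ?invr_gt0// invrK ltW.
Qed.

Section shift.
Variables (u v eps : nat -> R).
Hypothesis u0 : forall n, 0 <= u n.
Hypothesis v0 : forall n, 0 <= v n.
Hypothesis eps0 : forall n, 0 <= eps n.
Hypothesis uv : forall n m, u (n + m) <= v n + eps m.
Hypothesis eps_cvg : F eps @ \oo --> (0 : R).

(* [D] is large enough for the indices [k] and [n = k + m], where
   [D.-1 m <= k], to be asymptotically comparable, while [n / m] stays bounded. *)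
Let shift_bound x y : 0 <= x -> x < y -> exists D m0, (0 < D)%N /\
  forall k m, (m0 <= m)%N -> (D * m <= k)%N -> ((k + m).+1 <= D.+1 * m.+1)%N ->
    F v k <= x -> F u (k + m) <= y.
Proof.
(* [t] is small enough for [(1 + t) ^ 2 * x < y], by way of [(1 + t) ^ 2 <= 1 + 3 * t]. One factor
   [1 + t] pays for [powR_add_le], the other for replacing [k + m + 1] by [k + 1]. *)
move=> x0 xy; pose t := (y - x) / (3 * x + (y - x)).
have d0 : 0 < 3 * x + (y - x) by lra.
have t0 : 0 < t by rewrite divr_gt0// subr_gt0.
have t1 : t <= 1 by rewrite ler_pdivrMr// mul1r; lra.
have tx : (1 + t) ^+ 2 * x < y.
  have : 3 * t * x < y - x.
    have tE : t * (3 * x + (y - x)) = y - x by rewrite divfK// gt_eqF.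
    have : 0 < t * (y - x) by rewrite mulr_gt0// subr_gt0.
    by lra.
  by nra.
pose r := (1 + t) `^ p^-1 - 1.
have r0 : 0 < r.
  have e1 : 1 `^ p^-1 = 1 :> R by rewrite powR1.
  rewrite subr_gt0 -[ltLHS]e1 gt0_ltr_powR ?nnegrE ?invr_gt0//.
    by rewrite addr_ge0// ltW.
  by rewrite ltrDl.
have rp : (1 + r) `^ p = 1 + t.
  by rewrite /r addrC subrK -powRrM mulVf ?gt_eqF// powRr1// addr_ge0// ltW.
(* With [D >= 1 / t], the condition [D * m <= k] gives [m <= t * (k + 1)]. *)
pose D := (Num.truncn t^-1).+1.
have Dt : D%:R^-1 <= t.
  by rewrite -[leRHS]invrK lef_pV2 ?posrE ?invr_gt0 ?ltr0n// ltW// lt_truncnS// invr_ge0 ltW.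
pose z := y - (1 + t) ^+ 2 * x.
have z0 : 0 < z by rewrite subr_gt0.
(* [C] is the total factor of [F eps m]: the weight [k + m + 1] of [u] is at most [D + 1] times the
   weight [m + 1] of [eps]. *)
pose C := D.+1%:R * (1 + r^-1) `^ p.
have C0 : 0 < C by rewrite mulr_gt0// powR_gt0// addr_gt0 ?invr_gt0.
have /cvgrPdist_lt/(_ _ (divr_gt0 z0 C0))[m0 _ hm0] := eps_cvg.
exists D, m0; split=> // k m m0m Dmk nDm Fv.
have Fe : C * F eps m <= z.
  have := hm0 m m0m; rewrite /= sub0r normrN ger0_norm ?F_ge0// ltr_pdivlMr//.
  by rewrite mulrC => /ltW.
have step : F u (k + m) <= (k + m).+1%:R * ((1 + t) * v k `^ p + (1 + r^-1) `^ p * eps m `^ p).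
  rewrite ler_wpM2l// -rp; apply: le_trans (powR_add_le (v0 k) (eps0 m) r0).
  by rewrite ge0_ler_powR ?nnegrE ?addr_ge0 ?(ltW p0).
apply: (le_trans step); rewrite mulrDr.
have -> : y = (1 + t) ^+ 2 * x + z by rewrite /z addrC subrK.
apply: lerD.
  apply: (@le_trans _ _ ((1 + t) ^+ 2 * F v k)); last by rewrite ler_wpM2l ?sqr_ge0.
  rewrite /F mulrCA expr2 -!mulrA ler_wpM2l ?addr_ge0 ?(ltW t0)//.
  rewrite mulrA ler_wpM2r ?powR_ge0//.
  rewrite -addSn natrD mulrDl mul1r lerD2l.
  apply: (@le_trans _ _ (D%:R^-1 * k.+1%:R)); last by rewrite ler_wpM2r.
  by rewrite ler_pdivlMl ?ltr0n// -natrM ler_nat (leq_trans Dmk).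
apply: le_trans Fe; rewrite /C /F [leRHS]mulrACA.
by rewrite ler_wpM2r ?mulr_ge0 ?powR_ge0// -natrM ler_nat.
Qed.

Lemma power_limsup_shift : (power_limsup p u <= power_limsup p v)%E.
Proof.
rewrite -[leRHS]mul1e; apply: (limn_esup_compare (u := F u) (v := F v)) => //.
move=> x y x0; rewrite mul1r => xy K; have [D [m0 [D0 h]]] := shift_bound x0 xy.
(* Here [n] is split as [k + m] with [m = n %/ D.+1]: a small fraction of [n] that still tends to
   infinity. *)
exists (D.+1 * (maxn m0 K))%N => n hn; pose m := (n %/ D.+1)%N.
have mn : (m * D.+1 <= n)%N by exact: leq_trunc_div.
have mle : (maxn m0 K <= m)%N by rewrite leq_divRL// mulnC.
have mn' : (m <= n)%N by apply: leq_trans mn; rewrite mulnS leq_addr.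
have Dmk : (D * m <= n - m)%N by rewrite leq_subRL// -mulSn mulnC.
exists (n - m)%N.
  apply: leq_trans Dmk; apply: leq_trans (leq_pmull _ D0).
  by apply: leq_trans mle; exact: leq_maxr.
rewrite -{2}(subnK mn'); apply: h => //.
  by apply: leq_trans mle; exact: leq_maxl.
by rewrite subnK// mulnC ltn_ceil.
Qed.

Lemma power_liminf_shift : (power_liminf p u <= power_liminf p v)%E.
Proof.
rewrite -[leRHS]mul1e; apply: (limn_einf_compare (u := F u) (v := F v)) => //.
move=> x y x0; rewrite mul1r => xy K; have [D [m0 [D0 h]]] := shift_bound x0 xy.
exists (D * m0 + K)%N => k hk; pose m := (k %/ D)%N.
exists (k + m)%N; first by apply: leq_trans (leq_addr _ _); apply: leq_trans hk; exact: leq_addl.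
apply: h.
- by rewrite leq_divRL// mulnC; apply: leq_trans hk; exact: leq_addr.
- by rewrite mulnC; exact: leq_trunc_div.
- rewrite -addSn mulSn addnC leq_add//.
  by rewrite mulnC ltn_ceil.
Qed.

End shift.

Section doubling.
Variables (c d s : nat -> R).
Hypothesis c0 : forall n, 0 <= c n.
Hypothesis s0 : forall n, 0 <= s n.
Hypothesis s_decr : forall m n, (m <= n)%N -> s n <= s m.
Hypothesis cs : forall n, c n <= s n.*2.+1.
Hypothesis sd : forall n, s n.*2 <= d n.

Let F_le u v m n : 0 <= u m -> u m <= v n -> u m `^ p <= v n `^ p.
Proof.
move=> um uv; rewrite ge0_ler_powR ?nnegrE ?(ltW p0)//.
exact: le_trans uv.
Qed.

Lemma power_limsup_double_le : (power_limsup p s <= 2%:E * power_limsup p d)%E.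
Proof.
apply: (limn_esup_compare (u := F s) (v := F d)) => // x y x0 xy K.
exists K.*2 => n Kn; exists n./2; first by rewrite geq_half_double.
move=> dx; apply: le_trans (ltW xy); apply: le_trans (ler_wpM2l (ler0n _ _) dx).
rewrite /F mulrA -natrM ler_pM ?powR_ge0 ?ler_nat//.
  by rewrite mul2n -ltn_half_double.
by apply: F_le => //; apply: le_trans (sd _); apply: s_decr; rewrite -geq_half_double.
Qed.

Lemma power_liminf_double_le : (power_liminf p s <= 2%:E * power_liminf p d)%E.
Proof.
apply: (limn_einf_compare (u := F s) (v := F d)) => // x y x0 xy K.
exists K => k Kk; exists k.*2; first by rewrite -addnn (leq_trans Kk)// leq_addr.
move=> dx; apply: le_trans (ltW xy); apply: le_trans (ler_wpM2l (ler0n _ _) dx).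
rewrite /F mulrA -natrM ler_pM ?powR_ge0 ?ler_nat//.
  by rewrite mul2n doubleS.
exact: F_le.
Qed.

Lemma power_limsup_double_ge : (power_limsup p c <= 2^-1%:E * power_limsup p s)%E.
Proof.
apply: (limn_esup_compare (u := F c) (v := F s)) => // x y x0 xy K.
exists K => n Kn; exists n.*2.+1; first by rewrite ltnW// ltnS -addnn (leq_trans Kn)// leq_addr.
move=> sx; apply: le_trans (ltW xy); rewrite ler_pdivlMl//; apply: le_trans sx.
rewrite /F mulrA -natrM mul2n doubleS ler_wpM2l//.
exact: F_le.
Qed.

(** An index [k] where [s] is small yields [c] at [k./2], but for even [k] the doubled weight
    [2 * (k./2 + 1)] is [k + 2] instead of [k + 1]. The excess, the [p]-th power of [s k], is at
    most [x / (k + 1)]; [k1] is chosen to make it smaller than [y - x / 2]. *)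
Lemma power_liminf_double_ge : (power_liminf p c <= 2^-1%:E * power_liminf p s)%E.
Proof.
apply: (limn_einf_compare (u := F c) (v := F s)) => // x y x0 xy K.
have d0 : 0 < y - 2^-1 * x by rewrite subr_gt0.
pose k1 := Num.truncn (x / (y - 2^-1 * x)).
exists (k1 + K.*2)%N => k hk; exists k./2.
  by rewrite geq_half_double; apply: leq_trans hk; exact: leq_addl.
move=> sx; have xk : x <= (y - 2^-1 * x) * k.+1%:R.
  rewrite -ler_pdivrMl// mulrC ltW//; apply: lt_le_trans (lt_truncnS _) _; first by rewrite divr_ge0// ltW.
  by rewrite ler_nat ltnS; apply: leq_trans hk; exact: leq_addr.
have sx' : 2^-1 * k.+2%:R * s k `^ p <= y.
  have : s k `^ p <= y - 2^-1 * x.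
    rewrite -(ler_pM2r (ltr0Sn R k)); apply: le_trans xk.
    by rewrite mulrC.
  have := sx; rewrite /F -[k.+2]addn1 natrD mulrDr mulr1 mulrDl -mulrA.
  have := powR_ge0 (s k) p; set S := s k `^ p => S0 h1 h2.
  by lra.
apply: le_trans sx'; rewrite /F ler_pM ?powR_ge0//.
  rewrite ler_pdivlMl// -natrM ler_nat mul2n doubleS !ltnS.
  by rewrite -[leqRHS](odd_double_half k) leq_addl.
apply: F_le => //; apply: le_trans (cs _) _; apply: s_decr.
by rewrite -{1}[k](odd_double_half k) -add1n leq_add2r leq_b1.
Qed.

End doubling.

(** With [c] and [d] the minimum and the maximum of [a] and [b], the shifts bound [a] by [c] and [d]
    by [a] asymptotically, while doubling relates both to [s]: the chain
    [s / 2 <= d <= a <= c <= s / 2] closes, for upper and for lower limits. *)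
Theorem half_asymptotics (a b s eps : nat -> R) :
  (forall n, 0 <= a n) -> (forall n, 0 <= b n) -> (forall n, 0 <= s n) ->
  (forall n, 0 <= eps n) ->
  (forall m n, (m <= n)%N -> a n <= a m) -> (forall m n, (m <= n)%N -> b n <= b m) ->
  (forall m n, (m <= n)%N -> s n <= s m) ->
  (forall n, Num.min (a n) (b n) <= s n.*2.+1) ->
  (forall n, s n.*2 <= Num.max (a n) (b n)) ->
  (forall n m, a (n + m) <= b n + eps m) -> (forall n m, b (n + m) <= a n + eps m) ->
  (fun n => n.+1%:R * eps n `^ p) @ \oo --> (0 : R) ->
  power_limsup p a = (2^-1%:E * power_limsup p s)%E /\
  power_liminf p a = (2^-1%:E * power_liminf p s)%E.
Proof.
move=> a0 b0 s0 eps0 ad bd sd_ cs sd ab ba ecvg.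
pose c n := Num.min (a n) (b n); pose d n := Num.max (a n) (b n).
have c0 n : 0 <= c n by rewrite le_min a0 b0.
have d0 n : 0 <= d n by rewrite le_max a0.
have ac n m : a (n + m) <= c n + eps m.
  rewrite /c minEle; case: ifP => _; last exact: ab.
  by apply: le_trans (ad n _ (leq_addr _ _)) _; rewrite lerDl.
have da n m : d (n + m) <= a n + eps m.
  rewrite ge_max ba andbT.
  by apply: le_trans (ad n _ (leq_addr _ _)) _; rewrite lerDl.
have half2 (x : \bar R) : (2^-1%:E * (2%:E * x) = x)%E.
  by rewrite muleA -EFinM mulVf// mul1e.
split; apply/eqP; rewrite eq_le; apply/andP; split.
- apply: le_trans (power_limsup_shift a0 c0 eps0 ac ecvg) _.
  exact: power_limsup_double_ge.
- rewrite -[leRHS]half2 lee_pmul2l ?lte_fin//.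
  apply: le_trans (power_limsup_double_le s0 sd_ sd) _.
  by rewrite lee_pmul2l ?lte_fin//; exact: (power_limsup_shift d0 a0 eps0 da ecvg).
- apply: le_trans (power_liminf_shift a0 c0 eps0 ac ecvg) _.
  exact: power_liminf_double_ge.
- rewrite -[leRHS]half2 lee_pmul2l ?lte_fin//.
  apply: le_trans (power_liminf_double_le s0 sd) _.
  by rewrite lee_pmul2l ?lte_fin//; exact: (power_liminf_shift d0 a0 eps0 da ecvg).
Qed.

End power_asymptotics.

(** * The space L2 of the circle *)

Section riesz_fischer.
Variables (R : realType) (d : measure_display) (T : measurableType d).
Variable m : probability T R.
Implicit Types f g : T -> R.

Lemma Lfun2P f : f \in Lfun m 2%:E <->
  measurable_fun setT f /\ (\int[m]_z (f z ^+ 2)%:E < +oo)%E.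
Proof.
split=> [fL|[mf ff]].
  split; first by move: fL; rewrite inE => /andP[/[!inE]].
  have /integrableP[_] := Lfun2_integrable_sqr fL.
  by under eq_integral do rewrite /= ger0_norm ?sqr_ge0//.
rewrite inE; apply/andP; split; rewrite inE//= /finite_norm unlock.
apply: poweR_lty; apply: le_lt_trans ff; rewrite le_eqVlt; apply/orP; left; apply/eqP.
apply: eq_integral => z _ /=.
by rewrite -[in RHS]real_normK ?num_real// powR_mulrn.
Qed.

(** Young's inequality in place of Cauchy-Schwarz: for a mean square [4 ^- k] and [c = 2 ^ k] it
    gives the summable bound [2 ^- k]. *)
Lemma integral_norm_le_sq f (c : R) : measurable_fun setT f -> 0 < c ->
  (\int[m]_z `|f z|%:E <= (c / 2)%:E * (\int[m]_z (f z ^+ 2)%:E) + (c^-1 / 2)%:E)%E.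
Proof.
move=> mf c0; have c20 : (0 <= (c / 2)%:E)%E by rewrite lee_fin divr_ge0// ltW.
have mf2 : measurable_fun setT (EFin \o ((fun z => f z ^+ 2) : T -> R)).
  by apply/measurable_EFinP; exact: measurable_funX.
rewrite -ge0_integralZl//; last by move=> z _; rewrite lee_fin sqr_ge0.
have <- : (\int[m]_z (c^-1 / 2)%:E = (c^-1 / 2)%:E)%E.
  by rewrite integral_cst// -[X in (_ * X)%E]/(m setT) probability_setT mule1.
rewrite -ge0_integralD//.
- apply: ge0_le_integral => //.
  + by apply/measurable_EFinP; exact: measurableT_comp.
  + apply: emeasurable_funD => //; exact: measurable_funeM.
  + move=> z _; rewrite -EFinM -EFinD lee_fin -[f z ^+ 2]real_normK ?num_real//.
    have := sqr_ge0 (c * `|f z| - 1); have := normr_ge0 (f z).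
    set x := `|f z| => x0 h.
    rewrite -(ler_pM2l (mulr_gt0 (ltr0Sn R 1) c0)).
    rewrite mulrDr (_ : 2 * c * (c^-1 / 2) = 1); last by field; rewrite gt_eqF.
    by rewrite (_ : 2 * c * (c / 2 * x ^+ 2) = c ^+ 2 * x ^+ 2); [nra|field].
- by move=> z _; rewrite -EFinM lee_fin mulr_ge0 ?sqr_ge0// divr_ge0// ltW.
- exact: measurable_funeM.
- by move=> z _; rewrite lee_fin divr_ge0// invr_ge0 ltW.
Qed.

(* A subsequence whose increments are below [4 ^- k] in mean square has an almost
   everywhere absolutely convergent telescoping series; Fatou's lemma then bounds the
   distance to the limit. *)
Theorem L2_complete (f : nat -> T -> R) : (forall n, f n \in Lfun m 2%:E) ->
  (forall eps : R, 0 < eps -> exists n0, forall j k, (n0 <= j)%N -> (n0 <= k)%N ->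
     (\int[m]_z ((f j z - f k z) ^+ 2)%:E <= eps%:E)%E) ->
  exists2 g, g \in Lfun m 2%:E &
    forall eps : R, 0 < eps -> exists n0, forall n, (n0 <= n)%N ->
     (\int[m]_z ((f n z - g z) ^+ 2)%:E <= eps%:E)%E.
Proof.
move=> fL fC.
have mf n : measurable_fun setT (f n) by have /Lfun2P[] := fL n.
have /choice[N NP] : forall i : nat, exists n0, forall j k, (n0 <= j)%N -> (n0 <= k)%N ->
    (\int[m]_z ((f j z - f k z) ^+ 2)%:E <= ((4^-1 : R) ^+ i)%:E)%E.
  by move=> i; apply: fC; rewrite exprn_gt0.
(* Summing makes [phi] nondecreasing and keeps it above both [N k] and [k]. *)
pose phi k := (\sum_(i < k.+1) (N i).+1)%N.
have Nphi k : (N k <= phi k)%N.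
  by rewrite /phi big_ord_recr/=; apply: leq_trans (leqnSn _) (leq_addl _ _).
have kphi k : (k <= phi k)%N.
  have : (\sum_(i < k.+1) 1 <= phi k)%N by apply: leq_sum.
  by rewrite sum_nat_const card_ord muln1 => /ltnW.
have phiS k : (phi k <= phi k.+1)%N by rewrite /phi [leqRHS]big_ord_recr leq_addr.
pose h k z := f (phi k) z.
pose D k z := h k.+1 z - h k z.
have mh k : measurable_fun setT (h k) by exact: mf.
have mD k : measurable_fun setT (D k) by exact: measurable_funB.
have DN k : (\int[m]_z `|D k z|%:E <= ((2^-1 : R) ^+ k)%:E)%E.
  have c0 : 0 < (2 : R) ^+ k by rewrite exprn_gt0.
  apply: le_trans (integral_norm_le_sq (mD k) c0) _.
  apply: (@le_trans _ _ ((2 ^+ k / 2)%:E * ((4^-1 : R) ^+ k)%:E + ((2 ^+ k)^-1 / 2)%:E)%E).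
    rewrite leeD2r// lee_wpmul2l ?lee_fin ?divr_ge0 ?(ltW c0)//.
    by apply: NP; [apply: leq_trans (phiS k)|]; exact: Nphi.
  rewrite -EFinM -EFinD lee_fin (_ : 4^-1 = 2^-1 * 2^-1); last by field.
  by rewrite !exprVn exprMn exprVn le_eqVlt; apply/orP; left; apply/eqP; field; rewrite gt_eqF.
have Dsum : (\int[m]_z \sum_(0 <= k <oo) `|D k z|%:E < +oo)%E.
  rewrite integral_nneseries//; last first.
    by move=> k; apply/measurable_EFinP; exact: measurableT_comp.
  apply: (@le_lt_trans _ _ 2%:E); last by rewrite ltry.
  apply: lime_le; first by apply: is_cvg_nneseries => k _ _; apply: integral_ge0 => z _; rewrite lee_fin.
  apply: nearW => n; apply: (@le_trans _ _ (\sum_(0 <= k < n) ((2^-1 : R) ^+ k)%:E)%E).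
    by apply: lee_sum => k _; exact: DN.
  rewrite sumEFin lee_fin (_ : \sum_(0 <= k < n) _ = 2 - 2 * 2^-1 ^+ n).
    by rewrite gerBl mulr_ge0// exprn_ge0.
  elim: n => [|n ih]; first by rewrite big_nil expr0 mulr1 subrr.
  by rewrite big_nat_recr//= ih exprS; field.
have mDsum : measurable_fun setT (fun z => \sum_(0 <= k <oo) (`|D k z|%:E : \bar R))%E.
  apply: ge0_emeasurable_sum => [k z _ _|k _]; first by rewrite lee_fin.
  by apply/measurable_EFinP; exact: measurableT_comp.
have hcv : {ae m, forall z, cvgn (h ^~ z)}.
  have /integrable_ae : m.-integrable setT (fun z => \sum_(0 <= k <oo) `|D k z|%:E)%E.
    apply/integrableP; split=> //.
    apply: le_lt_trans Dsum; rewrite le_eqVlt; apply/orP; left; apply/eqP.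
    by apply: eq_integral => z _; rewrite gee0_abs// nneseries_ge0// => k _ _; rewrite lee_fin.
  move=> /(_ measurableT); apply: filterS => z /(_ I) zfin.
  have : cvgn [normed series (D ^~ z)].
    apply: nondecreasing_is_cvgn.
      by apply: nondecreasing_series => k _ _; exact: normr_ge0.
    exists (fine (\sum_(0 <= k <oo) `|D k z|%:E)%E) => _ [n _ <-].
    rewrite -lee_fin fineK// -[X in X%:E]/(\sum_(0 <= k < n) `|D k z|) -sumEFin.
    by apply: nneseries_lim_ge => k _; rewrite lee_fin.
  move=> /normed_cvg sc.
  have -> : h ^~ z = fun n => h 0 z + series (D ^~ z) n.
    apply/funext => n; rewrite /series/= /D telescope_sumr//; ring.
  by apply: is_cvgD => //; exact: is_cvg_cst.
(* An upper limit is defined everywhere and measurable; it equals the pointwise limit almost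
   everywhere. *)
pose g z := fine (limn_esup (fun k => (h k z)%:E)).
have mg : measurable_fun setT g.
  apply: measurableT_comp => //; apply: measurable_fun_limn_esup => k.
  exact/measurable_EFinP.
have gE z : cvgn (h ^~ z) -> h ^~ z @ \oo --> g z.
  move=> hz; suff -> : g z = limn (h ^~ z) by [].
  have e : (fun k => (h k z)%:E) @ \oo --> (limn (h ^~ z))%:E.
    by apply: cvg_EFin; [exact: nearW|exact: hz].
  by rewrite /g (cvg_limn_einf_sup e).2.
have gB eps n0 :
   (forall j k, (n0 <= j)%N -> (n0 <= k)%N ->
     (\int[m]_z ((f j z - f k z) ^+ 2)%:E <= eps%:E)%E) ->
   forall n, (n0 <= n)%N -> (\int[m]_z ((f n z - g z) ^+ 2)%:E <= eps%:E)%E.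
  move=> fe n n0n; pose q k := EFin \o ((fun z => (f n z - h k z) ^+ 2) : T -> R).
  have mq k : measurable_fun setT (q k).
    by apply/measurable_EFinP; apply: measurable_funX; exact: measurable_funB.
  rewrite (@ge0_ae_eq_integral _ _ _ _ _ _ (fun z => limn_einf (q ^~ z)))//.
  - apply: le_trans (fatou _ measurableT mq _) _.
      by move=> k z _; rewrite lee_fin sqr_ge0.
    apply: limn_einf_le_freq => K; exists (maxn K n0); first exact: leq_maxl.
    by apply: fe => //; apply: leq_trans (kphi _); exact: leq_maxr.
  - by apply/measurable_EFinP; apply: measurable_funX; exact: measurable_funB.
  - rewrite (_ : (fun z => _) = -%E \o (fun z => limn_esup (fun k => - q k z)%E)).
      apply: measurableT_comp => //; apply: measurable_fun_limn_esup => k.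
      exact: measurableT_comp.
    by apply/funext => z; rewrite /= -[LHS]oppeK -limn_esupN.
  - by move=> z _; rewrite lee_fin sqr_ge0.
  - move=> z _; rewrite limn_einfE; apply: (@le_trans _ _ (einfs (q ^~ z) 0%N)).
      by apply: le_ereal_inf_tmp => _ [k _ <-]; rewrite lee_fin sqr_ge0.
    by apply: ereal_sup_ubound; exists 0%N.
  - apply: filterS hcv => z /gE hz _; apply/esym.
    suff e : q ^~ z @ \oo --> ((f n z - g z) ^+ 2)%:E by rewrite (cvg_limn_einf_sup e).1.
    apply: cvg_EFin; first exact: nearW.
    rewrite (_ : fine \o _ = fun k => (f n z - h k z) * (f n z - h k z))// expr2.
    by apply: cvgM; apply: cvgB => //; exact: cvg_cst.
exists g; last first.
  by move=> eps /fC[n0 fe]; exists n0; exact: gB.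
have [n0 /gB/(_ n0 (leqnn _)) fgn] := fC 1 ltr01.
have p1 : (1 <= 2%:E :> \bar R)%E by rewrite lee_fin ler1n.
have [_ LZD] := Lfun_submod_closed m p1.
have -> : g = (-1) *: (fun z => f n0 z - g z) + f n0.
  by apply/funext => z; rewrite !fctE /= [_ *: _]mulN1r opprB subrK.
apply: LZD => //; apply/Lfun2P; split; first exact: measurable_funB.
by apply: le_lt_trans fgn _; rewrite ltry.
Qed.

End riesz_fischer.

(** * Invariance of arc length under conjugation *)

Section circle_measure.
Variable R : realType.
Notation T := (circle R).
Notation m := (@arc_measure R).
Notation mu := (@lebesgue_measure R).

Lemma circle_measurable_fun d (U : sigmaRingType d) (f : T -> U) :
  measurable_fun setT (f \o @mexpi R) -> measurable_fun setT f.
Proof.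
move=> mf _ B mB; rewrite setTI.
have := mf measurableT B mB; rewrite setTI => h.
by rewrite /measurable /= /circle_measurable /image_set_system /= setTI.
Qed.

Lemma arc_integral_ge0 (f : T -> \bar R) : measurable_fun setT f ->
  (forall z, 0 <= f z)%E ->
  (\int[m]_z f z = ((pi *+ 2)^-1)%:E * \int[mu]_(t in `[0%R, (pi *+ 2)%R]) f (expi t))%E.
Proof.
move=> mf f0; rewrite (ge0_integral_pushforward (@measurable_mexpi R))//.
rewrite preimage_setT integral_uniform ?subr0//; last by move=> t; exact: f0.
exact: measurableT_comp.
Qed.

Let refl (c : R) (t : measurableTypeR R) : measurableTypeR R := c - t.

Let measurable_refl c : measurable_fun setT (refl c).
Proof. by apply: measurable_funB => //; exact: measurable_cst. Qed.

Let refl_mixin c := isMeasurableFun.Build _ _ _ _ (refl c) (measurable_refl c).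
Let mrefl c : {mfun _ >-> _} := HB.pack (refl c) (refl_mixin c).

(** Lebesgue measure is determined by half-open intervals, and the reflection exchanges []a, b]]
    with [[c - b, c - a[], of the same length. *)
Lemma lebesgue_measure_refl c (A : set R) : measurable A ->
  mu A = mu ((fun t => c - t) @^-1` A).
Proof.
move=> mA; apply: (@lebesgue_measure_unique R (pushforward mu (mrefl c))) => //.
move=> _ [[a b] _ <-] /=; rewrite /pushforward /=.
rewrite (_ : _ @^-1` _ = `[c - b, c - a[%classic); last first.
  apply/seteqP; split=> t /=; rewrite !in_itv/= /refl.
    by move=> /andP[at_ tb]; apply/andP; split; lra.
  by move=> /andP[at_ tb]; apply/andP; split; lra.
rewrite !lebesgue_measure_itv /= !lte_fin ltrD2l ltrN2.
by case: ifPn => // _; rewrite -!EFinD; congr EFin; ring.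
Qed.

Lemma ge0_integral_refl c (f : R -> \bar R) : measurable_fun setT f ->
  (forall t, 0 <= f t)%E ->
  (\int[mu]_(t in `[0%R, c]) f (c - t)%R = \int[mu]_(t in `[0%R, c]) f t)%E.
Proof.
move=> mf f0; rewrite [RHS](eq_measure_integral (pushforward mu (mrefl c))); last first.
  by move=> A mA _; exact: lebesgue_measure_refl.
rewrite (ge0_integral_pushforward (@measurable_refl c))//; last exact: measurable_funTS.
congr (integral _ _ _); apply/seteqP; split=> t /=; rewrite !in_itv/= /refl.
  by move=> /andP[at_ tb]; apply/andP; split; lra.
by move=> /andP[at_ tb]; apply/andP; split; lra.
Qed.

Lemma expi_conj (t : R) : expi (pi *+ 2 - t) = circle_conj (expi t).
Proof.
by apply/val_inj; rewrite /= addrC cosD2pi sinD2pi cosN sinN.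
Qed.

Lemma measurable_circle_conj : measurable_fun setT (@circle_conj R).
Proof.
apply: circle_measurable_fun.
rewrite (_ : _ \o _ = @mexpi R \o refl (pi *+ 2)); last first.
  by apply/funext => t /=; rewrite /refl /mexpi -expi_conj.
by apply: measurableT_comp; [exact: measurable_mexpi|exact: measurable_refl].
Qed.

Lemma ge0_integral_circle_conj (f : T -> \bar R) : measurable_fun setT f ->
  (forall z, 0 <= f z)%E -> (\int[m]_z f (circle_conj z) = \int[m]_z f z)%E.
Proof.
move=> mf f0; have mfc : measurable_fun setT (f \o @circle_conj R).
  by apply: measurableT_comp => //; exact: measurable_circle_conj.
rewrite !arc_integral_ge0//; congr (_ * _)%E.
under eq_integral do rewrite -expi_conj.
have mfe : measurable_fun setT (f \o @mexpi R).
  by apply: measurableT_comp => //; exact: measurable_mexpi.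
apply: (@ge0_integral_refl _ (f \o @mexpi R)) => // t.
exact: f0.
Qed.

(** Null sets are recognized by the integral of their indicator, to which the invariance of the
    integral applies. *)
Lemma ae_circle_conj (P : T -> Prop) :
  {ae m, forall z, P z} -> {ae m, forall z, P (circle_conj z)}.
Proof.
move=> [A [mA mA0 PA]]; exists (@circle_conj R @^-1` A).
have mcA : measurable (@circle_conj R @^-1` A).
  by rewrite -[X in measurable X]setTI; exact: measurable_circle_conj.
have indicE (B : set T) : measurable B -> (\int[m]_z (\1_B z)%:E = m B)%E.
  by move=> mB; rewrite integral_indic// setIT.
split => //; last by move=> z /= nP; exact: PA.
rewrite -(indicE _ mcA) -[RHS]mA0 -(indicE _ mA).
rewrite -[RHS]ge0_integral_circle_conj//.
by apply/measurable_EFinP; exact: measurable_indic.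
Qed.

Lemma Rintegral_circle_conj (f : T -> R) : measurable_fun setT f ->
  \int[m]_z f (circle_conj z) = \int[m]_z f z.
Proof.
move=> mf; rewrite /Rintegral; congr fine; rewrite integralE [RHS]integralE.
have mf' : measurable_fun setT (EFin \o f) by exact/measurable_EFinP.
have mX := measurable_funepos mf'; have mY := measurable_funeneg mf'.
rewrite -(ge0_integral_circle_conj mX (funepos_ge0 _)).
rewrite -(ge0_integral_circle_conj mY (funeneg_ge0 _)). 
by congr (_ - _)%E; apply: eq_integral => z _; rewrite !(funeposE, funenegE).
Qed.

Lemma Rintegral_arc (f : T -> R) : m.-integrable setT (EFin \o f) ->
  \int[m]_z f z = (pi *+ 2)^-1 * \int[mu]_(t in `[0, pi *+ 2]) f (expi t).
Proof.
move=> fint; rewrite /Rintegral.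
have mf' : measurable_fun setT (EFin \o f) by exact: measurable_int fint.
have c0 : 0 < (pi *+ 2)^-1 :> R by rewrite invr_gt0 lt0_2pi.
have Xfin := integrable_pos_fin_num measurableT fint.
have Yfin := integrable_neg_fin_num measurableT fint.
have fin (g : T -> \bar R) : measurable_fun setT g -> (forall z, 0 <= g z)%E ->
    (\int[m]_z g z)%E \is a fin_num ->
    (\int[mu]_(t in `[0%R, (pi *+ 2)%R]) g (expi t))%E \is a fin_num.
  move=> mg g0; rewrite arc_integral_ge0//.
  have : (0 <= \int[mu]_(t in `[0%R, (pi *+ 2)%R]) g (expi t))%E by exact: integral_ge0.
  by case: (integral _ _ _) => [r| |]//; rewrite gt0_muley// lte_fin.
have mX := measurable_funepos mf'; have mY := measurable_funeneg mf'.
have Xfin' := fin _ mX (funepos_ge0 _) Xfin.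
have Yfin' := fin _ mY (funeneg_ge0 _) Yfin.
rewrite integralE [in RHS]integralE !arc_integral_ge0//.
rewrite -muleBr ?fin_num_adde_defr//. rewrite fineM//; last by rewrite fin_numB Xfin' Yfin'.
by congr (_ * fine (_ - _)%E); apply: eq_integral => z _; rewrite !(funeposE, funenegE).
Qed.

End circle_measure.

(** * Multiplication and flip operators on L2, and its completeness *)

Section circle_L2.
Variable R : realType.
Notation T := (circle R).
Notation C := R[i].
Notation m := (@arc_measure R).
Notation L2 := (L2 R).
Notation dot := (@L2_dot R).
Notation N := (hnorm (@L2_dot R)).
Notation ReC := (@complex.Re R).
Notation ImC := (@complex.Im R).
Implicit Types (F G w : T -> C) (x y : L2).
Local Open Scope quotient_scope.

Definition cmeasurable F :=
  measurable_fun setT (ReC \o F) /\ measurable_fun setT (ImC \o F).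

Lemma cmeasurable_cabs2 F : cmeasurable F ->
  measurable_fun setT ((fun z => cabs (F z) ^+ 2) : T -> R).
Proof.
move=> [mr mi]; rewrite (_ : (fun z => _) = fun z => ReC (F z) ^+ 2 + ImC (F z) ^+ 2).
  by apply: measurable_funD; apply: measurable_funX.
by apply/funext => z; rewrite cabs_sqr.
Qed.

Lemma cmeasurableM F G : cmeasurable F -> cmeasurable G ->
  cmeasurable (fun z => F z * G z).
Proof.
move=> [mrF miF] [mrG miG]; split.
  rewrite (_ : _ \o _ = fun z => ReC (F z) * ReC (G z) - ImC (F z) * ImC (G z)).
    by apply: measurable_funB; apply: measurable_funM.
  by apply/funext => z /=; case: (F z) (G z) => ? ? [].
rewrite (_ : _ \o _ = fun z => ReC (F z) * ImC (G z) + ImC (F z) * ReC (G z)).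
  by apply: measurable_funD; apply: measurable_funM.
by apply/funext => z /=; case: (F z) (G z) => ? ? [].
Qed.

Lemma cmeasurable_conj F : cmeasurable F -> cmeasurable (fun z => F (circle_conj z)).
Proof.
by move=> [mr mi]; split; apply: (measurableT_comp (f := _ \o F)) => //;
  exact: measurable_circle_conj.
Qed.

Lemma Lp2P F : F \in Lp 2%:E <->
  cmeasurable F /\ (\int[m]_z (cabs (F z) ^+ 2)%:E < +oo)%E.
Proof.
have split_int : cmeasurable F -> (\int[m]_z (cabs (F z) ^+ 2)%:E =
    \int[m]_z (ReC (F z) ^+ 2)%:E + \int[m]_z (ImC (F z) ^+ 2)%:E)%E.
  move=> [mr mi]; rewrite -ge0_integralD//.
  - by apply: eq_integral => z _; rewrite cabs_sqr EFinD.
  - by move=> z _; rewrite lee_fin sqr_ge0.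
  - by apply/measurable_EFinP; apply: measurable_funX.
  - by move=> z _; rewrite lee_fin sqr_ge0.
  - by apply/measurable_EFinP; apply: measurable_funX.
split=> [/andP[/Lfun2P[mr fr] /Lfun2P[mi fi]]|[mF]].
  by split=> //; rewrite split_int//; exact: lte_add_pinfty.
rewrite split_int// => fin; apply/andP; split; apply/Lfun2P; (split; first by case: mF).
  by apply: le_lt_trans fin; rewrite leeDl// integral_ge0// => z _; rewrite lee_fin sqr_ge0.
by apply: le_lt_trans fin; rewrite leeDr// integral_ge0// => z _; rewrite lee_fin sqr_ge0.
Qed.

Lemma toL2E F (FL : F \in Lp 2%:E) : toL2 F = \pi_L2 (L2Fun FL) :> L2.
Proof.
by rewrite /toL2; congr (\pi_L2 _); apply: val_inj; rewrite insubdK.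
Qed.

Lemma toL2_repr x : toL2 (repr x) = x.
Proof.
rewrite (toL2E (L2_valP (repr x))) -[RHS]reprK; congr (\pi_L2 _); exact: val_inj.
Qed.

Lemma toL2_ae F : F \in Lp 2%:E -> {ae m, forall z, repr (toL2 F) z = F z}.
Proof. by move=> FL; rewrite (toL2E FL); exact: L2_repr_pi. Qed.

Lemma toL2_eq F G : F \in Lp 2%:E -> G \in Lp 2%:E ->
  {ae m, forall z, F z = G z} -> toL2 F = toL2 G.
Proof. by move=> FL GL FG; rewrite (toL2E FL) (toL2E GL); apply/eqP/L2_eqP. Qed.

Lemma exists_toL2 x : exists2 F, F \in Lp 2%:E & x = toL2 F.
Proof. by exists (repr x); [exact: L2_valP|rewrite toL2_repr]. Qed.

Lemma Lp2_lin a F G : F \in Lp 2%:E -> G \in Lp 2%:E ->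
  (fun z => a * F z + G z) \in Lp 2%:E.
Proof. by move=> FL GL; have [_ LZD] := @Lp2_submod_closed R; exact: (LZD a F G). Qed.

Lemma toL2_lin a F G : F \in Lp 2%:E -> G \in Lp 2%:E ->
  toL2 (fun z => a * F z + G z) = a *: toL2 F + toL2 G.
Proof.
move=> FL GL; rewrite (toL2E FL) (toL2E GL) (toL2E (Lp2_lin a FL GL)).
rewrite [_ *: _]L2_scaleE -[RHS](_ : \pi_L2 (a *: L2Fun FL + L2Fun GL) = _ ); last by rewrite !piE.
by congr (\pi_L2 _); apply: val_inj.
Qed.

Lemma Lp2_0 : (fun _ : T => 0 : C) \in Lp 2%:E.
Proof. by have [] := @Lp2_submod_closed R. Qed.

Lemma toL2_0 : toL2 (fun _ : T => 0 : C) = 0.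
Proof.
have /eqP := toL2_lin 1 Lp2_0 Lp2_0.
rewrite scale1r (_ : (fun z => _) = fun=> 0); last by apply/funext => z; rewrite mulr0 addr0.
by rewrite -subr_eq0 opprD addNKr oppr_eq0 => /eqP.
Qed.

Lemma Lp2B F G : F \in Lp 2%:E -> G \in Lp 2%:E -> (fun z => F z - G z) \in Lp 2%:E.
Proof.
move=> FL GL; have := Lp2_lin (-1) GL FL.
rewrite (_ : (fun z => _) = (fun z => F z - G z))//.
by apply/funext => z; rewrite mulN1r addrC.
Qed.

Lemma toL2B F G : F \in Lp 2%:E -> G \in Lp 2%:E ->
  toL2 (fun z => F z - G z) = toL2 F - toL2 G.
Proof.
move=> FL GL; have := toL2_lin (-1) GL FL; rewrite scaleN1r addrC => <-.
by congr toL2; apply/funext => z; rewrite mulN1r addrC.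
Qed.

Lemma dot_toL2 F G : F \in Lp 2%:E -> G \in Lp 2%:E ->
  dot (toL2 F) (toL2 G) = arc_integral (fun z => F z * conjc (G z)).
Proof. by move=> FL GL; rewrite (toL2E FL) (toL2E GL) L2_dotE. Qed.

Lemma hnorm_toL2 F : F \in Lp 2%:E ->
  ((N (toL2 F)) ^+ 2)%:E = (\int[m]_z (cabs (F z) ^+ 2)%:E)%E.
Proof.
move=> FL; rewrite -rdotxx -[rdot _ _ _]/(ReC (dot (toL2 F) (toL2 F))) dot_toL2//=.
have [mF fin] := (Lp2P F).1 FL.
rewrite -[RHS]fineK; last first.
  by rewrite ge0_fin_numE ?integral_ge0// => z _; rewrite lee_fin sqr_ge0.
congr EFin; apply: eq_Rintegral => z _.
by rewrite mulcJ_cabs.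
Qed.

Lemma hnorm_toL2_le F G (M : R) : F \in Lp 2%:E -> G \in Lp 2%:E -> 0 <= M ->
  {ae m, forall z, cabs (F z) <= M * cabs (G z)} -> N (toL2 F) <= M * N (toL2 G).
Proof.
move=> FL GL M0 FG.
have [mF _] := (Lp2P F).1 FL; have [mG _] := (Lp2P G).1 GL.
rewrite -(@ler_pXn2r _ 2)// ?nnegrE ?mulr_ge0 ?hnorm_ge0// -lee_fin exprMn [X in (_ <= X)%E]EFinM.
rewrite !hnorm_toL2// -ge0_integralZl//; last 3 first.
- by apply/measurable_EFinP; exact: cmeasurable_cabs2.
- by move=> z _; rewrite lee_fin sqr_ge0.
- by rewrite lee_fin sqr_ge0.
apply: ae_ge0_le_integral => //.
- by move=> z _; rewrite lee_fin sqr_ge0.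
- by apply/measurable_EFinP; exact: cmeasurable_cabs2.
- by move=> z _; rewrite -EFinM lee_fin mulr_ge0 ?sqr_ge0.
- by apply: measurable_funeM; apply/measurable_EFinP; exact: cmeasurable_cabs2.
apply: filterS FG => z h _; rewrite -EFinM lee_fin -exprMn.
by rewrite ler_pXn2r ?nnegrE ?mulr_ge0 ?cabs_ge0.
Qed.

(** [M] is any almost everywhere bound for [|w|]. It is kept explicit because it bounds the norm of
    [mul_op w], from which the error constants are computed. *)
Definition multiplier w (M : R) :=
  [/\ cmeasurable w, 0 <= M & {ae m, forall z, cabs (w z) <= M}].

Lemma multiplier_Lp2 w M F : multiplier w M -> F \in Lp 2%:E ->
  (fun z => w z * F z) \in Lp 2%:E.
Proof.
move=> [mw M0 wM] FL; have [mF Ffin] := (Lp2P F).1 FL.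
have mwF := cmeasurableM mw mF; apply/Lp2P; split=> //.
apply: (@le_lt_trans _ _ ((M ^+ 2)%:E * \int[m]_z (cabs (F z) ^+ 2)%:E)%E); last first.
  apply: lte_mul_pinfty => //; by rewrite lee_fin sqr_ge0.
rewrite -ge0_integralZl//; last 3 first.
- by apply/measurable_EFinP; exact: cmeasurable_cabs2.
- by move=> z _; rewrite lee_fin sqr_ge0.
- by rewrite lee_fin sqr_ge0.
apply: ae_ge0_le_integral => //.
- by move=> z _; rewrite lee_fin sqr_ge0.
- by apply/measurable_EFinP; exact: cmeasurable_cabs2.
- by move=> z _; rewrite -EFinM lee_fin mulr_ge0 ?sqr_ge0.
- by apply: measurable_funeM; apply/measurable_EFinP; exact: cmeasurable_cabs2.
apply: filterS wM => z h _; rewrite -EFinM lee_fin -exprMn cabsM.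
by rewrite ler_pXn2r ?nnegrE ?mulr_ge0 ?cabs_ge0// ler_wpM2r ?cabs_ge0.
Qed.

Lemma mul_op_toL2 w M F : multiplier w M -> F \in Lp 2%:E ->
  mul_op w (toL2 F) = toL2 (fun z => w z * F z).
Proof.
move=> wM FL; rewrite /mul_op; apply: toL2_eq.
- by apply: multiplier_Lp2 wM _; exact: L2_valP.
- exact: multiplier_Lp2 wM _.
- by apply: filterS (toL2_ae FL) => z ->.
Qed.

Lemma mul_op_linear w M : multiplier w M -> linear (mul_op w).
Proof.
move=> wM a x y; have [F FL ->] := exists_toL2 x; have [G GL ->] := exists_toL2 y.
rewrite -toL2_lin// !(mul_op_toL2 wM)//; last exact: Lp2_lin.
rewrite -toL2_lin; [|exact: multiplier_Lp2 wM _..].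
by congr toL2; apply/funext => z; ring.
Qed.

Lemma hnorm_mul_op w M x : multiplier w M -> N (mul_op w x) <= M * N x.
Proof.
move=> wM; have [F FL ->] := exists_toL2 x; rewrite (mul_op_toL2 wM)//.
have [_ M0 h] := wM; apply: hnorm_toL2_le => //; first exact: multiplier_Lp2 wM _.
by apply: filterS h => z h; rewrite cabsM ler_wpM2r ?cabs_ge0.
Qed.

Lemma multiplierM w1 w2 M1 M2 : multiplier w1 M1 -> multiplier w2 M2 ->
  multiplier (fun z => w1 z * w2 z) (M1 * M2).
Proof.
move=> [m1 M10 h1] [m2 M20 h2]; split; [exact: cmeasurableM|exact: mulr_ge0|].
apply: filterS2 h1 h2 => z h1 h2; rewrite cabsM; apply: ler_pM => //; exact: cabs_ge0.
Qed.

Lemma mul_opM w1 w2 M1 M2 x : multiplier w1 M1 -> multiplier w2 M2 ->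
  mul_op w1 (mul_op w2 x) = mul_op (fun z => w1 z * w2 z) x.
Proof.
move=> h1 h2; have [F FL ->] := exists_toL2 x.
rewrite (mul_op_toL2 h2)// (mul_op_toL2 h1); last exact: multiplier_Lp2 h2 _.
rewrite (mul_op_toL2 (multiplierM h1 h2))//.
by congr toL2; apply/funext => z; ring.
Qed.

Lemma eq_mul_op w1 w2 M1 M2 x : multiplier w1 M1 -> multiplier w2 M2 ->
  {ae m, forall z, w1 z = w2 z} -> mul_op w1 x = mul_op w2 x.
Proof.
move=> h1 h2 e; have [F FL ->] := exists_toL2 x.
rewrite (mul_op_toL2 h1)// (mul_op_toL2 h2)//; apply: toL2_eq.
- exact: multiplier_Lp2 h1 _.
- exact: multiplier_Lp2 h2 _.
- by apply: filterS e => z ->.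
Qed.

Lemma multiplier_lin a w1 w2 M1 M2 : multiplier w1 M1 -> multiplier w2 M2 ->
  multiplier (fun z => a * w1 z + w2 z) (cabs a * M1 + M2).
Proof.
move=> [[r1 i1] M10 h1] [[r2 i2] M20 h2]; split.
- split.
    rewrite (_ : _ \o _ = fun z => (complex.Re a * ReC (w1 z) - complex.Im a * ImC (w1 z)) + ReC (w2 z)).
      by apply: measurable_funD => //; apply: measurable_funB; apply: measurable_funM.
    by apply/funext => z /=; case: a (w1 z) (w2 z) => ? ? [? ?] [].
  rewrite (_ : _ \o _ = fun z => (complex.Re a * ImC (w1 z) + complex.Im a * ReC (w1 z)) + ImC (w2 z)).
    by apply: measurable_funD => //; apply: measurable_funD; apply: measurable_funM.
  by apply/funext => z /=; case: a (w1 z) (w2 z) => ? ? [? ?] [].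
- by rewrite addr_ge0 ?mulr_ge0 ?cabs_ge0.
- apply: filterS2 h1 h2 => z h1 h2; apply: le_trans (cabsD _ _) _.
  by rewrite cabsM lerD// ler_wpM2l ?cabs_ge0.
Qed.

Lemma mul_op_lin a w1 w2 M1 M2 x : multiplier w1 M1 -> multiplier w2 M2 ->
  mul_op (fun z => a * w1 z + w2 z) x = a *: mul_op w1 x + mul_op w2 x.
Proof.
move=> h1 h2; have [F FL ->] := exists_toL2 x.
rewrite (mul_op_toL2 (multiplier_lin a h1 h2))// (mul_op_toL2 h1)// (mul_op_toL2 h2)//.
rewrite -toL2_lin; [|exact: multiplier_Lp2 h1 _|exact: multiplier_Lp2 h2 _].
by congr toL2; apply/funext => z; ring.
Qed.

Lemma multiplier_conjc w M : multiplier w M -> multiplier (fun z => conjc (w z)) M.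
Proof.
move=> [[r i] M0 h]; split=> //; last by apply: filterS h => z; rewrite cabsJ.
split.
  by rewrite (_ : _ \o _ = ReC \o w)//; apply/funext => z /=; case: (w z).
rewrite (_ : _ \o _ = \- (ImC \o w)); first exact: measurableT_comp.
by apply/funext => z /=; case: (w z).
Qed.

Lemma multiplier_flip w M : multiplier w M -> multiplier (fun z => w (circle_conj z)) M.
Proof.
by move=> [mw M0 h]; split=> //; [exact: cmeasurable_conj|exact: (ae_circle_conj h)].
Qed.

Lemma dot_mul_op w M x y : multiplier w M ->
  dot (mul_op w x) y = dot x (mul_op (fun z => conjc (w z)) y).
Proof.
move=> wM; have wM' := multiplier_conjc wM.
have [F FL ->] := exists_toL2 x; have [G GL ->] := exists_toL2 y.
rewrite (mul_op_toL2 wM)// (mul_op_toL2 wM')//.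
rewrite !dot_toL2//; [|exact: multiplier_Lp2 wM' _|exact: multiplier_Lp2 wM _].
congr arc_integral; apply/funext => z.
by rewrite rmorphM/= conjcK; ring.
Qed.

Lemma Lp2_flip F : F \in Lp 2%:E -> (fun z => F (circle_conj z)) \in Lp 2%:E.
Proof.
move=> /Lp2P[mF fin]; apply/Lp2P; split; first exact: cmeasurable_conj.
rewrite (@ge0_integral_circle_conj _ (fun z => (cabs (F z) ^+ 2)%:E))//.
  by apply/measurable_EFinP; exact: cmeasurable_cabs2.
by move=> z; rewrite lee_fin sqr_ge0.
Qed.

Lemma flip_op_toL2 F : F \in Lp 2%:E ->
  flip_op (toL2 F) = toL2 (fun z => F (circle_conj z)).
Proof.
move=> FL; apply: toL2_eq; [|exact: Lp2_flip|].
  by apply: (@Lp2_flip (repr (toL2 F))); exact: L2_valP.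
exact: (ae_circle_conj (toL2_ae FL)).
Qed.

Lemma flip_op_linear : linear (@flip_op R).
Proof.
move=> a x y; have [F FL ->] := exists_toL2 x; have [G GL ->] := exists_toL2 y.
rewrite -toL2_lin// !flip_op_toL2//; last exact: Lp2_lin.
by rewrite -toL2_lin//; exact: Lp2_flip.
Qed.

Lemma circle_conjK (z : T) : circle_conj (circle_conj z) = z.
Proof. by apply: val_inj => /=; rewrite conjcK. Qed.

Lemma dot_flip x y : dot (flip_op x) y = dot x (flip_op y).
Proof.
have [F FL ->] := exists_toL2 x; have [G GL ->] := exists_toL2 y.
rewrite !flip_op_toL2// !dot_toL2//; try exact: Lp2_flip.
have /andP[/Lfun1_integrable Ir /Lfun1_integrable Ii] := Lp1_mul_conj FL (Lp2_flip GL).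
rewrite /arc_integral; congr (_ +i* _).
  rewrite -(@Rintegral_circle_conj _ (fun z => ReC (F z * conjc (G (circle_conj z))))).
    by apply: eq_Rintegral => z _; rewrite circle_conjK.
  by apply/measurable_EFinP; exact: measurable_int Ir.
rewrite -(@Rintegral_circle_conj _ (fun z => ImC (F z * conjc (G (circle_conj z))))).
  by apply: eq_Rintegral => z _; rewrite circle_conjK.
by apply/measurable_EFinP; exact: measurable_int Ii.
Qed.

Lemma flip_opK x : flip_op (flip_op x) = x.
Proof.
have [F FL ->] := exists_toL2 x; rewrite !flip_op_toL2//; last exact: Lp2_flip.
by congr toL2; apply/funext => z; rewrite circle_conjK.
Qed.

Lemma hnorm_flip x : N (flip_op x) = N x.
Proof.
rewrite /hnorm; congr (Num.sqrt (ReC _)).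
by rewrite -[LHS]/(dot (flip_op x) (flip_op x)) dot_flip flip_opK.
Qed.

Lemma flip_mul_op w M x : multiplier w M ->
  flip_op (mul_op w x) = mul_op (fun z => w (circle_conj z)) (flip_op x).
Proof.
move=> wM; have [F FL ->] := exists_toL2 x.
rewrite (mul_op_toL2 wM)// !flip_op_toL2//; last exact: multiplier_Lp2 wM _.
by rewrite (mul_op_toL2 (multiplier_flip wM))//; exact: Lp2_flip.
Qed.

Lemma L2_hcomplete : hcomplete dot.
Proof.
move=> u uC; pose f n : T -> C := repr (u n).
have fL n : f n \in Lp 2%:E by exact: L2_valP.
have uE n : u n = toL2 (f n) by rewrite toL2_repr.
have distE j k : (\int[m]_z (cabs (f j z - f k z) ^+ 2)%:E = (N (u j - u k) ^+ 2)%:E)%E.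
  rewrite !uE -toL2B// hnorm_toL2//.
  exact: Lp2B.
have part (p : C -> R) : (forall a b : C, p (a - b) = p a - p b) ->
    (forall a : C, `|p a| <= cabs a) -> (forall n, p \o f n \in Lfun m 2%:E) ->
    exists2 g, g \in Lfun m 2%:E & forall eps : R, 0 < eps -> exists n0, forall n,
      (n0 <= n)%N -> (\int[m]_z ((p (f n z) - g z) ^+ 2)%:E <= eps%:E)%E.
  move=> pB pc pL; apply: (L2_complete pL) => eps eps0.
  have se : 0 < Num.sqrt eps by rewrite sqrtr_gt0.
  have [n0 h] := uC _ se.
  exists n0 => j k n0j n0k; apply: (@le_trans _ _ (N (u j - u k) ^+ 2)%:E); last first.
    rewrite lee_fin -[leRHS]sqr_sqrtr ?(ltW eps0)//.
    by rewrite ler_pXn2r ?nnegrE ?hnorm_ge0 ?sqrtr_ge0// ltW// h.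
  have [mj _] := (Lfun2P _ _).1 (pL j); have [mk _] := (Lfun2P _ _).1 (pL k).
  rewrite -distE; apply: ge0_le_integral => //.
  - by move=> z _; rewrite lee_fin sqr_ge0.
  - by apply/measurable_EFinP; apply: measurable_funX; exact: measurable_funB.
  - apply/measurable_EFinP; apply: (@cmeasurable_cabs2 (fun z => f j z - f k z)).
    by have /Lp2P[] := Lp2B (fL j) (fL k).
  - move=> z _; rewrite lee_fin /= -pB -real_normK ?num_real//.
    by rewrite ler_pXn2r ?nnegrE ?cabs_ge0.
have [gr grL hr] : exists2 g, g \in Lfun m 2%:E & forall eps : R, 0 < eps ->
    exists n0, forall n, (n0 <= n)%N -> (\int[m]_z ((ReC (f n z) - g z) ^+ 2)%:E <= eps%:E)%E.
  apply: part; first by move=> a b; rewrite ReD ReN.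
    exact: le_Re_cabs.
  by move=> n; have /andP[] := fL n.
have [gi giL hi] : exists2 g, g \in Lfun m 2%:E & forall eps : R, 0 < eps ->
    exists n0, forall n, (n0 <= n)%N -> (\int[m]_z ((ImC (f n z) - g z) ^+ 2)%:E <= eps%:E)%E.
  apply: part; first by move=> [? ?] [].
    exact: le_Im_cabs.
  by move=> n; have /andP[] := fL n.
pose g z := gr z +i* gi z.
have gL : g \in Lp 2%:E by apply/andP; split.
exists (toL2 g); apply/hcvgP => eps eps0.
have e0 : 0 < eps ^+ 2 / 3 by rewrite divr_gt0 ?exprn_gt0.
have [nr {}hr] := hr _ e0; have [ni {}hi] := hi _ e0.
exists (maxn nr ni) => n; rewrite geq_max => /andP[nrn nin].
have fgL : (fun z => f n z - g z) \in Lp 2%:E.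
  exact: Lp2B.
rewrite uE -toL2B// -(@ltr_pXn2r _ 2)// ?nnegrE ?hnorm_ge0 ?(ltW eps0)//.
rewrite -lte_fin hnorm_toL2//.
have [[mfr mfi] _] := (Lp2P _).1 (fL n).
have [mgr _] := (Lfun2P _ _).1 grL; have [mgi _] := (Lfun2P _ _).1 giL.
have mr : measurable_fun setT ((fun z => (ReC (f n z) - gr z) ^+ 2) : T -> R).
  by apply: measurable_funX; exact: measurable_funB.
have mi : measurable_fun setT ((fun z => (ImC (f n z) - gi z) ^+ 2) : T -> R).
  by apply: measurable_funX; exact: measurable_funB.
rewrite (_ : integral _ _ _ = \int[m]_z ((ReC (f n z) - gr z) ^+ 2)%:E +
    \int[m]_z ((ImC (f n z) - gi z) ^+ 2)%:E)%E.
  apply: le_lt_trans (leeD (hr n nrn) (hi n nin)) _.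
  by rewrite -EFinD lte_fin; have : 0 < eps ^+ 2; [rewrite exprn_gt0|lra].
rewrite -ge0_integralD//.
- by apply: eq_integral => z _; rewrite cabs_sqr -EFinD /g; case: (f n z).
- by move=> z _; rewrite lee_fin sqr_ge0.
- exact/measurable_EFinP.
- by move=> z _; rewrite lee_fin sqr_ge0.
- exact/measurable_EFinP.
Qed.

End circle_L2.

(** * Fourier series of smooth functions *)

Section smooth_functions.
Variable R : realType.
Implicit Types (f g : R -> R) (U V : set R) (n : nat).

(** Derivatives are supplied as witnesses on [U], so that products, quotients and functions glued
    over open sets are treated by induction on the order without iterating [derive1n]. *)
Fixpoint differentiable_n n U f : Prop := if n is n'.+1 then
  exists f', (forall t, U t -> is_derive t 1 f (f' t)) /\ differentiable_n n' U f'
  else True.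

Lemma differentiable_n_eq n U f g : open U -> (forall t, U t -> f t = g t) ->
  differentiable_n n U f -> differentiable_n n U g.
Proof.
move=> oU fg; case: n => // n [f' [df Df]]; exists f'; split=> // t Ut.
have e : \near t, f t = g t.
  by have := open_nbhs_nbhs (conj oU Ut); apply: filterS => s; exact: fg.
have [ex v] := df t Ut; split; first exact: near_eq_derivable ex.
by rewrite -v; apply/esym/near_eq_derive.
Qed.

Lemma differentiable_nS n U f : differentiable_n n.+1 U f -> differentiable_n n U f.
Proof.
elim: n f => // n ih f [f' [df Df]]; exists f'; split=> //; exact: ih.
Qed.

Lemma differentiable_n_le m n U f : (m <= n)%N -> differentiable_n n U f -> differentiable_n m U f.
Proof.
elim: n m f => [|n ih] [|m] f //= mn [f' [df Df]].
by exists f'; split=> //; exact: ih.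
Qed.

Lemma differentiable_n_sub n U V f : V `<=` U ->
  differentiable_n n U f -> differentiable_n n V f.
Proof.
move=> VU; elim: n f => // n ih f [f' [df Df]]; exists f'; split; last exact: ih.
by move=> t /VU; exact: df.
Qed.

(** On the overlap both candidates are the derivative of the same function, hence agree, so the
    patched derivative restricts correctly to each piece. *)
Lemma differentiable_nU n U V f : open U -> open V ->
  differentiable_n n U f -> differentiable_n n V f -> differentiable_n n (U `|` V) f.
Proof.
move=> oU oV; elim: n f => // n ih f [f1 [df1 Df1]] [f2 [df2 Df2]].
pose f' t := if `[< U t >] then f1 t else f2 t.
have f'1 t : U t -> f1 t = f' t by move=> Ut; rewrite /f' asboolT.
have f'2 t : V t -> f2 t = f' t.
  move=> Vt; rewrite /f'; case: asboolP => // Ut.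
  by have [_ <-] := df1 t Ut; have [_ <-] := df2 t Vt.
exists f'; split.
  move=> t [Ut|Vt]; first by rewrite -f'1//; exact: df1.
  by rewrite -f'2//; exact: df2.
by apply: ih; [exact: differentiable_n_eq Df1|exact: differentiable_n_eq Df2].
Qed.

Lemma differentiable_n_cst n U c : differentiable_n n U (fun=> c).
Proof.
by elim: n c => // n ih c; exists (fun=> 0); split=> // t _; exact: is_derive_cst.
Qed.

Lemma differentiable_nD n U f g : differentiable_n n U f -> differentiable_n n U g ->
  differentiable_n n U (fun t => f t + g t).
Proof.
elim: n f g => // n ih f g [f' [df Df]] [g' [dg Dg]].
exists (fun t => f' t + g' t); split; last exact: ih.
by move=> t Ut; apply: is_deriveD; [exact: df|exact: dg].
Qed.

Lemma differentiable_nM n U f g : differentiable_n n U f -> differentiable_n n U g ->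
  differentiable_n n U (fun t => f t * g t).
Proof.
elim: n f g => // n ih f g fn gn; have [f' [df Df]] := fn; have [g' [dg Dg]] := gn.
exists (fun t => f t * g' t + g t * f' t); split.
  by move=> t Ut; apply: is_deriveM; [exact: df|exact: dg].
by apply: differentiable_nD; apply: ih => //; exact: differentiable_nS.
Qed.

Lemma differentiable_nN n U f : differentiable_n n U f ->
  differentiable_n n U (fun t => - f t).
Proof.
move=> fn; rewrite (_ : (fun t => - f t) = fun t => -1 * f t).
  by apply: differentiable_nM => //; exact: differentiable_n_cst.
by apply/funext => t; rewrite mulN1r.
Qed.

Lemma differentiable_nV n U f : (forall t, U t -> f t != 0) ->
  differentiable_n n U f -> differentiable_n n U (fun t => (f t)^-1).
Proof.
elim: n f => // n ih f f0 fn; have [f' [df Df]] := fn.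
exists (fun t => - f' t * ((f t)^-1 * (f t)^-1)); split.
  move=> t Ut; have := is_deriveV (f0 t Ut) (df t Ut).
  rewrite (_ : _ *: _ = - f' t * ((f t)^-1 * (f t)^-1))//.
  by rewrite -[LHS]/(- f t ^- 2 * f' t) expr2 invfM; ring.
have fVn : differentiable_n n U (fun t => (f t)^-1) by apply: ih => //; exact: differentiable_nS.
by apply: differentiable_nM; [exact: differentiable_nN|exact: differentiable_nM].
Qed.

Lemma differentiable_n_sincos n U :
  differentiable_n n U (@sin R) /\ differentiable_n n U (@cos R).
Proof.
elim: n => // n [ihs ihc]; split.
  by exists cos; split=> // t _; exact: is_derive_sin.
exists (fun t => - sin t); split; first by move=> t _; exact: is_derive_cos.
exact: differentiable_nN.
Qed.

Lemma smooth_differentiable_n n U f :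
  (forall k t, U t -> derivable (derive1n k f) t 1) -> differentiable_n n U f.
Proof.
elim: n f => // n ih f fU; exists (derive1 f); split.
  by move=> t Ut; split; [exact: (fU 0%N)|rewrite derive1E].
by apply: ih => k t Ut; rewrite -derive1Sn; exact: fU.
Qed.

Lemma differentiable_n_derivable n U f t : differentiable_n n.+1 U f -> U t -> derivable f t 1.
Proof. by move=> [f' [df _]] Ut; have [] := df t Ut. Qed.

Lemma differentiable_n_continuous n f : differentiable_n n.+1 setT f -> continuous f.
Proof.
by move=> fn t; apply/differentiable_continuous/derivable1_diffP; exact: differentiable_n_derivable fn _.
Qed.

(** The source of cutoffs of finite smoothness. At 0 the difference quotient is at most [|h|] in
    absolute value as soon as [|h| < 1]. *)
Lemma is_derive_posX k (y : R) :
  is_derive y 1 (fun y => Num.max 0 y ^+ k.+2) (k.+2%:R * Num.max 0 y ^+ k.+1).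
Proof.
have [y0|y0|<-] := ltgtP 0 y.
- have e : \near y, y ^+ k.+2 = Num.max 0 y ^+ k.+2.
    by near=> z; rewrite max_r// ltW//; near: z; exact: lt_nbhsr.
  have [ex v] : is_derive y 1 (fun y : R => y ^+ k.+2) (k.+2%:R * y ^+ k.+1).
    have h := is_deriveX k.+2 (is_derive_id y (1 : R)).
    rewrite (_ : id ^+ k.+2 = fun y : R => y ^+ k.+2) in h; last exact: exprfctE.
    by apply: (is_derive_eq h); rewrite /= [_ *: _]mulr1.
  split; first exact: near_eq_derivable ex.
  by rewrite -v; apply/esym/near_eq_derive.
- have e : \near y, 0 = Num.max 0 y ^+ k.+2 :> R.
    by near=> z; rewrite max_l ?expr0n// ltW//; near: z; exact: lt_nbhsl.
  have [ex v] : is_derive y 1 (fun y : R => 0 : R) 0 by exact: is_derive_cst.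
  split; first exact: near_eq_derivable ex.
  by rewrite expr0n mulr0 -[RHS]v; apply/esym/near_eq_derive.
- pose p (y : R) := Num.max 0 y ^+ k.+2.
  have c : (fun h : R => h^-1 *: ((p \o shift 0) (h *: 1) - p 0)) @ 0^' --> (0 : R).
    apply/cvgr0Pnorm_lt => eps eps0; near=> h.
    have h1 : `|h| < 1 by near: h; exact: dnbhs0_lt.
    have he : `|h| < eps by near: h; exact: dnbhs0_lt.
    have h0 : h != 0 by near: h; exact: nbhs_dnbhs_neq.
    rewrite /p /= addr0 [h *: 1]mulr1 maxxx expr0n subr0.
    rewrite [_ *: _](_ : _ = h^-1 * Num.max 0 h ^+ k.+2)// normrM normfV.
    rewrite ltr_pdivrMl ?normr_gt0//; apply: (@le_lt_trans _ _ (`|h| * `|h|)).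
      rewrite normrX -expr2; apply: (@le_trans _ _ (`|h| ^+ k.+2)).
        by rewrite ler_pXn2r ?nnegrE// ger0_norm ?le_max ?lexx// ge_max normr_ge0 ler_norm.
      by rewrite -addn2 exprD ler_piMl ?sqr_ge0// exprn_ile1// ltW.
    by rewrite ltr_pM2l// normr_gt0.
  split; first by apply/cvg_ex; exists 0.
  by rewrite expr0n mulr0; exact: cvg_lim c.
Unshelve. all: by end_near. Qed.

End smooth_functions.

(** * Integrals against sines and cosines, and the chord-arc inequality *)

Section trigonometric_integrals.
Variable R : realType.
Notation mu := (@lebesgue_measure R).
Implicit Types (f g F : R -> R).

Let I g := \int[mu]_(t in `[0, pi *+ 2]) g t.

Lemma continuous_integrable a b g : continuous g ->
  mu.-integrable `[a, b] (EFin \o g).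
Proof.
move=> cg; apply: continuous_compact_integrable; first exact: segment_compact.
exact: continuous_subspaceT.
Qed.

Lemma integral_derivative0 F g : (forall t : R, is_derive t 1 F (g t)) -> continuous g ->
  F 0 = F (pi *+ 2) -> I g = 0.
Proof.
move=> dF cg F0; rewrite /I /Rintegral (@continuous_FTC2 _ g F).
- by rewrite -EFinB F0 subrr.
- exact: lt0_2pi.
- exact: continuous_subspaceT.
- have cF t : {for t, continuous F}.
    by apply/differentiable_continuous/derivable1_diffP; have [] := dF t.
  split; first by move=> t _; have [] := dF t.
    exact/cvg_at_right_filter/cF.
  exact/cvg_at_left_filter/cF.
- by move=> t _; rewrite derive1E; have [_] := dF t.
Qed.

Lemma is_derive_periodic f f' (T : R) : (forall t : R, is_derive t 1 f (f' t)) ->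
  periodic f T -> periodic f' T.
Proof.
move=> df fT t; have sh : is_derive t 1 (fun s : R => s + T) 1.
  have h := is_deriveD (is_derive_id t (1 : R)) (is_derive_cst T t 1).
  by apply: (is_derive_eq h); rewrite addr0.
have [_] := @is_derive1_comp R f (fun s : R => s + T) t _ _ (df (t + T)) sh.
have -> : f \o (fun s : R => s + T) = f by apply/funext => s; exact: fT.
by rewrite mulr1; have [_ ->] := df t => <-.
Qed.

Let is_derive_scale (k t : R) (p p' : R -> R) : (forall s : R, is_derive s 1 p (p' s)) ->
  is_derive t 1 (fun s => p (k * s)) (k * p' (k * t)).
Proof.
move=> dp; have sc : is_derive t 1 (fun s : R => k * s) k.
  have h := is_deriveZ k (is_derive_id t (1 : R)).
  by apply: (is_derive_eq h); rewrite [_ *: _]mulr1.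
by have h := @is_derive1_comp R p (fun s : R => k * s) t _ _ (dp (k * t)) sc; apply: (is_derive_eq h); rewrite mulrC.
Qed.

Let continuous_scale (k : R) (p : R -> R) : continuous p -> continuous (fun t : R => p (k * t)).
Proof.
move=> cp t; apply: (@continuous_comp _ _ _ (fun t : R => k * t) p); last exact: cp.
by apply: cvgM; [exact: cvg_cst|exact: cvg_id].
Qed.

Let continuous_mul (p q : R -> R) : continuous p -> continuous q -> continuous (fun t : R => p t * q t : R).
Proof. by move=> cp cq t; apply: cvgM; [exact: cp|exact: cq]. Qed.

(** The conditions on [sin] and [cos] express that [k] is an integer, so that the boundary terms at
    0 and [pi *+ 2] cancel. *)
Lemma integral_by_parts_periodic f f' k : (forall t : R, is_derive t 1 f (f' t)) ->
  continuous f' -> periodic f (pi *+ 2) -> sin (k * (pi *+ 2)) = 0 -> cos (k * (pi *+ 2)) = 1 ->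
  k * I (fun t => f t * cos (k * t)) = - I (fun t => f' t * sin (k * t)) /\
  k * I (fun t => f t * sin (k * t)) = I (fun t => f' t * cos (k * t)).
Proof.
move=> df cf' fT sk ck.
have cf : continuous f.
  by move=> t; apply/differentiable_continuous/derivable1_diffP; have [] := df t.
have csin := continuous_scale (k := k) (@continuous_sin R).
have ccos := continuous_scale (k := k) (@continuous_cos R).
have dsin t := is_derive_scale k t (@is_derive_sin R).
have dcos t := is_derive_scale k t (@is_derive_cos R).
have f2 : f (pi *+ 2) = f 0 by rewrite -[pi *+ 2]add0r fT.
have i1 := continuous_integrable 0 (pi *+ 2) (continuous_mul cf csin).
have i2 := continuous_integrable 0 (pi *+ 2) (continuous_mul cf ccos).
have i3 := continuous_integrable 0 (pi *+ 2) (continuous_mul cf' csin).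
have i4 := continuous_integrable 0 (pi *+ 2) (continuous_mul cf' ccos).
have mI : measurable (`[0, pi *+ 2] : set (measurableTypeR R)) by exact: measurable_itv.
have int_lin (g1 g2 : R -> R) : mu.-integrable `[0, pi *+ 2] (EFin \o g1) ->
    mu.-integrable `[0, pi *+ 2] (EFin \o g2) ->
    forall c : R, I (fun t => g1 t + c * g2 t) = I g1 + c * I g2.
  move=> h1 h2 c; rewrite /I RintegralD//; first by rewrite RintegralZl.
  exact: (integrableZl mI c h2).
split.
  have : I (fun t => f' t * sin (k * t) + k * (f t * cos (k * t))) = 0.
    apply: (@integral_derivative0 (fun t => f t * sin (k * t))).
    - move=> t; have h := is_deriveM (df t) (dsin t).
      by apply: (is_derive_eq h); rewrite -[_ + _]/(f t * (k * cos (k * t)) + sin (k * t) * f' t); ring.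
    - move=> t; apply: cvgD; first exact: continuous_mul.
      by apply: cvgM; [exact: cvg_cst|exact: continuous_mul].
    - by rewrite mulr0 sin0 mulr0 sk mulr0.
  by rewrite int_lin// => /eqP; rewrite addrC addr_eq0 => /eqP.
have : I (fun t => f' t * cos (k * t) + (- k) * (f t * sin (k * t))) = 0.
  apply: (@integral_derivative0 (fun t => f t * cos (k * t))).
  - move=> t; have h := is_deriveM (df t) (dcos t).
    by apply: (is_derive_eq h); rewrite -[_ + _]/(f t * (k * - sin (k * t)) + cos (k * t) * f' t); ring.
  - move=> t; apply: cvgD; first exact: continuous_mul.
    by apply: cvgM; [exact: cvg_cst|exact: continuous_mul].
  - by rewrite mulr0 cos0 mulr1 ck mulr1 f2.
by rewrite int_lin// => /eqP; rewrite mulNr subr_eq0 => /eqP.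
Qed.

(** Each integration by parts gains one factor [k]. The last derivative must still be continuous to
    be integrated, which costs one more order. *)
Lemma fourier_decay n f : differentiable_n n.+1 setT f -> periodic f (pi *+ 2) ->
  exists C, forall k, sin (k * (pi *+ 2)) = 0 -> cos (k * (pi *+ 2)) = 1 ->
    `|k| ^+ n * `|I (fun t => f t * cos (k * t))| <= C /\
    `|k| ^+ n * `|I (fun t => f t * sin (k * t))| <= C.
Proof.
elim: n f => [|n ih] f fn fT.
  have cf := differentiable_n_continuous fn.
  have mI : measurable (`[0, pi *+ 2] : set (measurableTypeR R)) by exact: measurable_itv.
  have bnd (p : R -> R) : continuous p -> (forall t, `|p t| <= 1) ->
      `|I (fun t => f t * p t)| <= I (fun t => `|f t|).
    move=> cp p1; have ip := continuous_integrable 0 (pi *+ 2) (continuous_mul cf cp).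
    apply: le_trans (le_normr_Rintegral mI ip) _; apply: le_Rintegral => //.
    - exact: integrable_norm.
    - exact/integrable_norm/continuous_integrable.
    - by move=> t _; rewrite normrM ler_piMr.
  exists (I (fun t => `|f t|)) => k sk ck; rewrite expr0 !mul1r; split.
    by apply: bnd => [|t]; [exact: (continuous_scale (k := k) (@continuous_cos R))|exact: cos_max].
  by apply: bnd => [|t]; [exact: (continuous_scale (k := k) (@continuous_sin R))|exact: sin_max].
have [f' [df f'n]] := fn; have df' (t : R) : is_derive t 1 f (f' t) := df t Logic.I.
have [C CP] := ih _ f'n (is_derive_periodic df' fT).
exists C => k sk ck; have [h1 h2] := CP k sk ck.
have [e1 e2] := integral_by_parts_periodic df' (differentiable_n_continuous f'n) fT sk ck.
split; rewrite exprSr -mulrA -normrM ?e1 ?e2 ?normrN//.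
Qed.

(** For [y = x / 2], [sin y >= y * cos y] because [sin t - t * cos t] has derivative [t * sin t].
    Hence [sin x = 2 * sin y * cos y >= y * (2 * cos y ^ 2)], and
    [2 * cos y ^ 2 = 1 + cos x >= 1]. *)
Lemma sin_ge_half (x : R) : 0 <= x <= pi / 2 -> x / 2 <= sin x.
Proof.
have [pi0 pi4] : (0 : R) < pi /\ pi / 2 < (2 : R) by split; [exact: pi_gt0|exact: pihalf_lt2].
move=> /andP[x0 xpi]; pose y := x / 2.
have y0 : 0 <= y by rewrite divr_ge0.
have ycos : y * cos y <= sin y.
  have d (t : R) : is_derive t 1 (fun t => sin t - t * cos t) (t * sin t).
    have h := is_deriveB (is_derive_sin t) (is_deriveM (is_derive_id t (1 : R)) (is_derive_cos t)).
    by apply: (is_derive_eq h); rewrite -[_ - _]/(cos t - (t * - sin t + cos t * 1)); ring.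
  have := @ger0_derive1_ndecr R (fun t => sin t - t * cos t) 0 y.
  move=> /(_ _ _ _ 0 y (lexx _) y0 (lexx _)); rewrite sin0 mul0r subr0 subr_ge0; apply.
  - by move=> t _; have [] := d t.
  - move=> t; rewrite in_itv/= => /andP[t0 ty]; rewrite derive1E; have [_ ->] := d t.
    rewrite mulr_ge0 ?(ltW t0)// sin_ge0_pi// (ltW t0)/= ltW// (lt_le_trans ty)//.
    by rewrite /y; lra.
  - apply: derivable_within_continuous => t _; by have [] := d t.
have cosx0 : 0 <= cos x.
  by apply: cos_ge0_pihalf; rewrite xpi andbT (le_trans _ x0)// oppr_le0; lra.
have -> : x = y *+ 2 by rewrite /y -mulr_natr divfK.
have c2 : 1 <= cos y ^+ 2 *+ 2.
  by move: cosx0; rewrite {1}(_ : x = y *+ 2) ?cos_mulr2n ?subr_ge0// /y -mulr_natr divfK.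
rewrite -[y *+ 2]mulr_natr mulfK// mulr_natr sin_mulr2n.
have cy0 : 0 <= cos y.
  by apply: cos_ge0_pihalf; rewrite /y; apply/andP; split; lra.
rewrite -mulr_natr; rewrite -mulr_natr in c2.
have h := ler_wpM2l cy0 ycos; have := ler_wpM2l y0 c2.
set c := cos y in h *; set s := sin y in h *.
by move: h; rewrite expr2; lra.
Qed.

(** The right-hand side is the squared chord [|exp (i u) - 1| ^ 2 = 4 * sin (u / 2) ^ 2], and
    [sin_ge_half] applies to the half angle. *)
Lemma cos_dist_ge (u : R) : `|u| <= pi -> (u / 2) ^+ 2 <= 2 - 2 * cos u.
Proof.
move=> upi; rewrite -[cos u]cos_norm -[(u / 2) ^+ 2]real_normK ?num_real// normrM.
rewrite (ger0_norm (_ : 0 <= 2^-1))//; set v := `|u| in upi *.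
have v0 : 0 <= v by exact: normr_ge0.
have := @sin_ge_half (v / 2).
rewrite divr_ge0//= ler_pM2r// => /(_ upi) h.
have -> : cos v = 1 - 2 * sin (v / 2) ^+ 2.
  have -> : v = (v / 2) *+ 2 by rewrite -mulr_natr divfK.
  by rewrite cos_mulr2n cos2sin2 -[(v / 2) *+ 2]mulr_natr mulfK//; ring.
have h0 : 0 <= v / 2 / 2 by rewrite !divr_ge0.
by nra.
Qed.

Lemma lipschitz_on_segment f a b : differentiable_n 2 setT f ->
  exists2 K, 0 <= K & forall s t, s \in `[a, b] -> t \in `[a, b] ->
    `|f s - f t| <= K * `|s - t|.
Proof.
move=> [f' [df Df]]; have cf' := @differentiable_n_continuous R 0 f' Df.
have [ba|ab] := ltP b a.
  exists 0 => // s t; rewrite in_itv/= => /andP[as_ sb].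
  by have := le_trans as_ sb; rewrite leNgt ba.
have [c _ cmax] : exists2 c, c \in `[a, b] & forall t, t \in `[a, b] -> `|f' t| <= `|f' c|.
  apply: (@EVT_max R (fun t => `|f' t|)) => //; apply: continuous_subspaceT => t.
  by apply: (@continuous_comp _ _ _ f' (@Num.norm _ R^o)); [exact: cf'|exact: norm_continuous].
exists `|f' c| => // s t.
wlog st : s t / s <= t.
  move=> h sab tab; have [/h|/ltW/h] := leP s t; first exact.
  by rewrite distrC (distrC t); exact.
move=> sab tab; move: st; rewrite le_eqVlt => /orP[/eqP->|st].
  by rewrite !subrr normr0 mulr0.
have [d dst e] : exists2 d, d \in `]s, t[ & f t - f s = f' d * (t - s) .
  apply: MVT => //; first by move=> x _; exact: df.
  by apply: derivable_within_continuous => x _; have [] := df x Logic.I.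
rewrite distrC e normrM (distrC s) ler_wpM2r//; apply: cmax.
move: dst sab tab; rewrite !in_itv/= => /andP[sd dt] /andP[as_ _] /andP[_ tb].
by rewrite (le_trans as_ (ltW sd)) (le_trans (ltW dt) tb).
Qed.

End trigonometric_integrals.

Section fourier.
Variable R : realType.
Notation T := (circle R).
Notation C := R[i].
Notation m := (@arc_measure R).
Notation mu := (@lebesgue_measure R).
Notation L2 := (L2 R).
Notation dot := (@L2_dot R).
Notation N := (hnorm (@L2_dot R)).
Notation ReC := (@complex.Re R).
Notation ImC := (@complex.Im R).
Implicit Types (F : T -> C) (k : int) (z : T).

Definition chi k z : C := (z : C) ^ k.

Lemma circle_neq0 z : (z : C) != 0.
Proof. by rewrite -normr_eq0 (eqP (circle_norm z)) oner_eq0. Qed.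

Lemma conj_chi k z : conjc (chi k z) = chi (- k) z.
Proof.
have zz : conjc (z : C) = (z : C)^-1.
  apply: (mulfI (circle_neq0 z)); rewrite divff ?circle_neq0//.
  by rewrite -sqr_normc (eqP (circle_norm z)) expr1n.
by rewrite /chi fmorphXz/= zz exprz_inv.
Qed.

Lemma chiD j k z : chi (j + k) z = chi j z * chi k z.
Proof. by rewrite /chi expfzDr ?circle_neq0. Qed.

Lemma chi0 z : chi 0 z = 1. Proof. by []. Qed.

Lemma chi1 z : chi 1 z = z. Proof. by []. Qed.

Lemma chi_conj k z : chi k (circle_conj z) = chi (- k) z.
Proof.
by rewrite -conj_chi /chi fmorphXz.
Qed.

Lemma cabs_chi k z : cabs (chi k z) = 1.
Proof.
apply/eqP; rewrite -(@eqrXn2 _ 2)// ?cabs_ge0// expr1n; apply/eqP/complexI.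
by rewrite -mulcJ_cabs conj_chi -chiD subrr.
Qed.

Lemma chi_expi k (t : R) : chi k (expi t) = cos (k%:~R * t) +i* sin (k%:~R * t).
Proof.
have nat_case (n : nat) : chi n (expi t) = cos (n%:R * t) +i* sin (n%:R * t).
  elim: n => [|n ih]; first by rewrite mul0r cos0 sin0.
  rewrite -addn1 PoszD chiD ih chi1 natrD mulrDl mul1r cosD sinD /=.
  by apply/eqP; rewrite eq_complex /=; apply/andP; split; apply/eqP; ring.
case: k => n; first exact: nat_case.
by rewrite NegzE -conj_chi nat_case /= rmorphN/= mulNr cosN sinN.
Qed.

Lemma expi_surj z : exists2 t : R, `|t| <= pi & z = expi t.
Proof.
have := circle_norm z; case: z => -[x y] /= nz; rewrite normc_def /= => /eqP/complexI h.
have xy : x ^+ 2 + y ^+ 2 = 1.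
  by rewrite -[LHS]sqr_sqrtr ?addr_ge0 ?sqr_ge0// h expr1n.
have x1 : -1 <= x <= 1.
  by rewrite -ler_norml -(@ler_pXn2r _ 2)// ?nnegrE// real_normK ?num_real// expr1n -xy lerDl sqr_ge0.
have [y0|y0] := leP 0 y.
  exists (acos x); first by rewrite ger0_norm ?acos_ge0// acos_lepi.
  apply: val_inj => /=; rewrite acosK ?in_itv//= sin_acos//.
  by congr (_ +i* _); rewrite -xy addrC addKr sqrtr_sqr ger0_norm.
exists (- acos x); first by rewrite normrN ger0_norm ?acos_ge0// acos_lepi.
apply: val_inj => /=; rewrite cosN sinN acosK ?in_itv//= sin_acos//.
by congr (_ +i* _); rewrite -xy addrC addKr sqrtr_sqr ltr0_norm// opprK.
Qed.

Lemma expiD (s t : R) : (expi (s + t) : C) = (expi s : C) * (expi t : C).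
Proof.
rewrite /= cosD sinD; apply/eqP; rewrite eq_complex /=.
by apply/andP; split; apply/eqP; ring.
Qed.

Lemma continuous_cmeasurable F : continuous (fun t => ReC (F (expi t))) ->
  continuous (fun t => ImC (F (expi t))) -> cmeasurable F.
Proof. by move=> cr ci; split; apply: circle_measurable_fun; exact: continuous_measurable_fun. Qed.

Definition smooth_circle n F :=
  differentiable_n n setT (fun t => ReC (F (expi t))) /\
  differentiable_n n setT (fun t => ImC (F (expi t))).

Lemma smooth_multiplier F : smooth_circle 2 F -> exists M, multiplier F M.
Proof.
move=> [fr fi].
have cr := @differentiable_n_continuous R 1 _ fr; have ci := @differentiable_n_continuous R 1 _ fi.
have [Kr Kr0 hr] := lipschitz_on_segment (- pi) pi fr.
have [Ki Ki0 hi] := lipschitz_on_segment (- pi) pi fi.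
have p0 : 0 <= pi :> R by exact: pi_ge0.
have zin : (0 : R) \in `[- pi, pi] by rewrite in_itv/= oppr_le0 p0.
exists ((`|ReC (F (expi 0))| + Kr * pi) + (`|ImC (F (expi 0))| + Ki * pi)); split.
- exact: continuous_cmeasurable.
- by rewrite !addr_ge0// mulr_ge0.
- apply: nearW => z; have [t tpi ->] := expi_surj z.
  have tin : t \in `[- pi, pi] by rewrite in_itv/= -ler_norml.
  have bnd (f : R -> R) K : `|f t - f 0| <= K * `|t - 0| -> 0 <= K -> `|f t| <= `|f 0| + K * pi.
    move=> h K0; rewrite -[f t](subrK (f 0)) addrC; apply: le_trans (ler_normD _ _) _.
    by rewrite lerD2l (le_trans h)// subr0 ler_wpM2l.
  apply: le_trans (cabs_le_ReIm _) _; apply: lerD.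
    by apply: (bnd (fun t => ReC (F (expi t)))); [exact: hr|].
  by apply: (bnd (fun t => ImC (F (expi t)))); [exact: hi|].
Qed.

Lemma multiplier_chi k : multiplier (chi k) 1.
Proof.
split=> //; last by apply: nearW => z; rewrite cabs_chi.
have ck (p : R -> R) : continuous p -> continuous (fun t : R => p (k%:~R * t)).
  move=> cp t; apply: (@continuous_comp _ _ _ (fun t : R => k%:~R * t) p); last exact: cp.
  by apply: cvgM; [exact: cvg_cst|exact: cvg_id].
apply: continuous_cmeasurable.
  rewrite (_ : (fun t => _) = fun t => cos (k%:~R * t)); first exact/ck/continuous_cos.
  by apply/funext => t; rewrite chi_expi.
rewrite (_ : (fun t => _) = fun t => sin (k%:~R * t)); first exact/ck/continuous_sin.
by apply/funext => t; rewrite chi_expi.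
Qed.

Lemma multiplier_cst (c : C) : multiplier (fun=> c) (cabs c).
Proof.
split; [|exact: cabs_ge0|exact: nearW].
by split; exact: measurable_cst.
Qed.

Lemma Lp2_1 : (fun _ : T => 1 : C) \in Lp 2%:E.
Proof.
apply/Lp2P; split; first by have [] := multiplier_cst 1.
by under eq_integral do rewrite cabs_real normr1 expr1n; rewrite integral_cst//
  -[X in (_ * X)%E]/(m setT) probability_setT mule1 ltry.
Qed.

Lemma multiplier_in_Lp2 (w : T -> C) M : multiplier w M -> w \in Lp 2%:E.
Proof.
move=> wM; have := multiplier_Lp2 wM Lp2_1.
by rewrite (_ : (fun z => _) = w)//; apply/funext => z; rewrite mulr1.
Qed.

Lemma Lp2_chi k : chi k \in Lp 2%:E.
Proof. exact: multiplier_in_Lp2 (multiplier_chi k). Qed.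

Definition coef F k := dot (toL2 F) (toL2 (chi k)).

Lemma coefE F k : F \in Lp 2%:E -> coef F k = arc_integral (fun z => F z * chi (- k) z).
Proof.
move=> FL; rewrite /coef dot_toL2 ?Lp2_chi//.
by congr arc_integral; apply/funext => z; rewrite conj_chi.
Qed.

Let period_int (k : int) : sin (k%:~R * (pi *+ 2)) = 0 :> R /\ cos (k%:~R * (pi *+ 2)) = 1 :> R.
Proof.
have nat_case (n : nat) : sin (n%:R * (pi *+ 2)) = 0 :> R /\ cos (n%:R * (pi *+ 2)) = 1 :> R.
  rewrite -[n%:R * _]add0r mulr_natl; split.
    by rewrite (periodicn (@sinD2pi R)) sin0.
  by rewrite (periodicn (@cosD2pi R)) cos0.
case: k => n; first exact: nat_case.
by rewrite NegzE rmorphN/= mulNr sinN cosN; have [-> ->] := nat_case n.+1; rewrite oppr0.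
Qed.

Let I (g : R -> R) := \int[mu]_(t in `[0, pi *+ 2]) g t.

Lemma coef_Re_Im F k : F \in Lp 2%:E ->
  continuous (fun t => ReC (F (expi t))) -> continuous (fun t => ImC (F (expi t))) ->
  ReC (coef F k) = (pi *+ 2)^-1 * (I (fun t => ReC (F (expi t)) * cos (k%:~R * t)) +
                                   I (fun t => ImC (F (expi t)) * sin (k%:~R * t))) /\
  ImC (coef F k) = (pi *+ 2)^-1 * (I (fun t => ImC (F (expi t)) * cos (k%:~R * t)) -
                                   I (fun t => ReC (F (expi t)) * sin (k%:~R * t))).
Proof.
move=> FL cr ci; rewrite coefE//.
have /andP[/Lfun1_integrable Ir /Lfun1_integrable Ii] := Lp1_mul_conj FL (Lp2_chi k).
have E : (fun z => F z * conjc (chi k z)) = (fun z => F z * chi (- k) z).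
  by apply/funext => z; rewrite conj_chi.
rewrite E in Ir Ii; rewrite /arc_integral /=.
have ck (p : R -> R) : continuous p -> continuous (fun t : R => p (k%:~R * t)).
  move=> cp t; apply: (@continuous_comp _ _ _ (fun t : R => k%:~R * t) p); last exact: cp.
  by apply: cvgM; [exact: cvg_cst|exact: cvg_id].
have cm (p q : R -> R) : continuous p -> continuous q ->
    mu.-integrable `[0, pi *+ 2] (EFin \o (fun t => p t * q t : R)).
  by move=> cp cq; apply: continuous_integrable => t; apply: cvgM; [exact: cp|exact: cq].
have cos_c := ck _ (@continuous_cos R); have sin_c := ck _ (@continuous_sin R).
rewrite (Rintegral_arc Ir) (Rintegral_arc Ii); split; congr (_ * _).
  rewrite /I -RintegralD//; [|exact: cm..].
  apply: eq_Rintegral => t _ /=; rewrite -conj_chi chi_expi /=.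
  by case: (F _) => a b /=; ring.
rewrite /I -RintegralB//; [|exact: cm..].
apply: eq_Rintegral => t _ /=; rewrite -conj_chi chi_expi /=.
by case: (F _) => a b /=; ring.
Qed.

(** For [k != 0] the constant is integrated by parts: its derivative is 0, hence so are its
    integrals against [cos (k t)] and [sin (k t)]. The orthogonality of all characters follows by
    translating [k]. *)
Lemma coef_1 k : coef (fun=> 1) k = (k == 0)%:R.
Proof.
have [->|k0] := eqVneq k 0.
  rewrite coefE ?Lp2_1// (_ : (fun z => _) = fun=> 1); last by apply/funext => z; rewrite mulr1.
  have I1 (c : R) : \int[m]_z c = c.
    by rewrite Rintegral_cst// -[X in _ * fine X]/(m setT) probability_setT mulr1.
  by rewrite /arc_integral /= !I1.
have cc (c : R) : continuous (fun _ : R => c) by move=> t; exact: cvg_cst.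
have [s0 c1] := period_int k.
have dc (c : R) (t : R) : is_derive t 1 (fun _ : R => c) 0 by exact: is_derive_cst.
have pc (c : R) : periodic (fun _ : R => c) (pi *+ 2) by [].
have kR : k%:~R != 0 :> R by rewrite intr_eq0.
have I0 (p : R -> R) : I (fun t => 0 * p t) = 0.
  by rewrite /I; under eq_Rintegral do rewrite mul0r; rewrite Rintegral_cst// mul0r.
have zero c : I (fun t => c * cos (k%:~R * t)) = 0 /\ I (fun t => c * sin (k%:~R * t)) = 0.
  have [e1 e2] := integral_by_parts_periodic (dc c) (cc 0) (pc c) s0 c1.
  split; apply: (mulfI kR); rewrite mulr0.
    by apply: etrans e1 _; rewrite [X in - X](I0 (fun t => sin (k%:~R * t))) oppr0.
  by apply: etrans e2 _; exact: (I0 (fun t => cos (k%:~R * t))).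
have [r i] := coef_Re_Im k Lp2_1 (cc 1) (cc 0).
have [z1 z2] := zero 1; have [z3 z4] := zero 0.
apply/eqP; rewrite eq_complex r i /=.
by rewrite z1 z2 z3 z4 addr0 subr0 mulr0 eqxx.
Qed.

Lemma dot_chi j k : dot (toL2 (chi j)) (toL2 (chi k)) = (j == k)%:R.
Proof.
rewrite -[LHS]/(coef _ _) coefE ?Lp2_chi//.
have -> : (j == k) = (k - j == 0) by rewrite subr_eq0 eq_sym.
rewrite -coef_1 coefE ?Lp2_1//.
congr arc_integral; apply/funext => z.
by rewrite mul1r -chiD opprB.
Qed.

Lemma orthosys_chi (s : nat -> int) : injective s ->
  orthosys dot (fun n => toL2 (chi (s n))).
Proof.
move=> sI i j; have n0 : toL2 (chi (s i)) != 0.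
  apply/eqP => h; have := dot_chi (s i) (s i); rewrite h eqxx.
  have -> : dot 0 0 = 0 by exact: (linear0l dot).
  by move=> /esym/eqP; rewrite oner_eq0.
by rewrite n0 andbT -[LHS]/(dot _ _) dot_chi (inj_eq sI).
Qed.

Lemma coef_decay n F : smooth_circle n.+2 F -> exists2 c, 0 <= c &
  forall k, (`|k|%N%:R) ^+ n.+1 * cabs (coef F k) <= c.
Proof.
move=> [fr fi].
have [M FM] : exists M, multiplier F M.
  apply: smooth_multiplier; split; elim: (n) fr fi => // q ih fr fi.
  - by apply: ih; exact: differentiable_nS.
  - by apply: ih; exact: differentiable_nS.
have FL := multiplier_in_Lp2 FM.
have pr (p : C -> R) : periodic (fun t => p (F (expi t))) (pi *+ 2).
  move=> t; congr (p (F _)); apply: val_inj.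
  by rewrite /= cosD2pi sinD2pi.
have [Cr hr] := fourier_decay fr (pr _); have [Ci hi] := fourier_decay fi (pr _).
have cr := differentiable_n_continuous fr; have ci := differentiable_n_continuous fi.
have p2 : 0 < (pi *+ 2)^-1 :> R by rewrite invr_gt0 lt0_2pi.
have [Cr0 Ci0] : 0 <= Cr /\ 0 <= Ci.
  have [s0 c1] := period_int 0.
  have [h _] := hr _ s0 c1; have [h' _] := hi _ s0 c1.
  by split; [apply: le_trans h|apply: le_trans h']; rewrite mulr_ge0// exprn_ge0.
exists ((pi *+ 2)^-1 * (Cr + Ci) + (pi *+ 2)^-1 * (Cr + Ci)).
  by rewrite addr_ge0// mulr_ge0 ?addr_ge0// ltW.
move=> k; have [s0 c1] := period_int k.
have [r i] := coef_Re_Im k FL cr ci.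
have [r1 r2] := hr _ s0 c1; have [i1 i2] := hi _ s0 c1.
have kE : `|k|%N%:R = `|k%:~R| :> R by rewrite -intr_norm -abszE.
have k0 : 0 <= `|k|%N%:R ^+ n.+1 :> R by rewrite exprn_ge0.
apply: le_trans (ler_wpM2l k0 (cabs_le_ReIm _)) _; rewrite r i mulrDr; apply: lerD.
  rewrite normrM (ger0_norm (ltW p2)) mulrCA ler_pM2l//.
  apply: le_trans (ler_wpM2l k0 (ler_normD _ _)) _; rewrite mulrDr kE.
  exact: lerD.
rewrite normrM (ger0_norm (ltW p2)) mulrCA ler_pM2l// [leRHS]addrC.
apply: le_trans (ler_wpM2l k0 (ler_normB _ _)) _; rewrite mulrDr kE.
exact: lerD.
Qed.

End fourier.

(** * Pointwise Fourier inversion and uniform trigonometric approximation *)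

Section fourier_inversion.
Variable R : realType.
Notation T := (circle R).
Notation C := R[i].
Notation L2 := (L2 R).
Notation dot := (@L2_dot R).
Notation N := (hnorm (@L2_dot R)).
Notation ReC := (@complex.Re R).
Notation ImC := (@complex.Im R).
Implicit Types (F G : T -> C) (k : int) (z : T).

(** A Riemann-Lebesgue lemma: consecutive partial projections differ by a single term, and they form
    a Cauchy sequence. *)
Lemma orthosys_coef_small (V : lmodType C) (d : {dot V for Num.conj}) (e : nat -> V) x eps :
  orthosys d e -> 0 < eps -> exists n0, forall n, (n0 <= n)%N -> cabs (d x (e n)) < eps.
Proof.
move=> eO eps0; have [n0 h] := oproj_cauchy eO x eps0; exists n0 => n n0n.
have := h n.+1 n (leqW n0n) n0n.
rewrite /oproj big_ord_recr /= [X in hnorm _ X]addrC addKr hnormZ.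
have [->|/(orthosys_norm eO) ->] := eqVneq (e n) 0; last by rewrite mulr1.
by rewrite linear0r cabs0.
Qed.

Lemma cmeasurableV F : cmeasurable F -> cmeasurable (fun z => (F z)^-1).
Proof.
move=> mF; pose r (z : T) : R := (cabs (F z) ^+ 2) `^ (-1).
have mr : measurable_fun setT r.
  by apply: (measurableT_comp (@measurable_powR R (-1))); exact: cmeasurable_cabs2.
have FV z : (F z)^-1 = conjc (F z) * (r z)%:C.
  rewrite /r powR_inv1 ?sqr_ge0//; have [->|F0] := eqVneq (F z) 0.
    by rewrite invr0 conjc0 mul0r.
  apply: (mulfI F0); rewrite divff// mulrA mulcJ_cabs -rmorphM/= divff//.
  by rewrite expf_eq0/=; apply: contraNneq F0 => /cabs0_eq0 ->.
have [mr' mi'] := mF; split.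
  rewrite (_ : _ \o _ = fun z => ReC (F z) * r z); first exact: measurable_funM.
  by apply/funext => z; rewrite /= FV; case: (F z) => a b /=; ring.
rewrite (_ : _ \o _ = fun z => - (ImC (F z) * r z)).
  by apply: measurableT_comp => //; exact: measurable_funM.
by apply/funext => z; rewrite /= FV; case: (F z) => a b /=; ring.
Qed.

Lemma cabs_expi_sub1 (u : R) : `|u| <= pi -> `|u| <= 2 * cabs ((expi u : C) - 1).
Proof.
move=> /cos_dist_ge h.
rewrite -(@ler_pXn2r _ 2)// ?nnegrE ?mulr_ge0 ?cabs_ge0// real_normK ?num_real//.
rewrite exprMn cabs_sqr /=.
have -> : (cos u - 1) ^+ 2 + (sin u - 0) ^+ 2 = 2 - 2 * cos u.
  by rewrite subr0 sin2cos2; ring.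
by move: h; rewrite exprMn exprVn; lra.
Qed.

(** The angle of [z] is measured from that of [z0], so that the increment [u] lies in [[- pi, pi]],
    where the chord controls the arc. In exchange [t + u] ranges over [[- 2 pi, 2 pi]]. *)
Lemma circle_near z0 z : exists t u : R,
  [/\ `|t| <= pi, `|u| <= pi, z0 = expi t & z = expi (t + u)].
Proof.
have [t tpi tE] := expi_surj z0; have [s _ sE] := expi_surj z.
have [u upi uE] := expi_surj (expi (s - t)).
exists t, u; split=> //; apply: val_inj.
by rewrite [RHS]expiD -uE -expiD addrC subrK sE.
Qed.

Lemma circle_lipschitz F : smooth_circle 2 F ->
  exists2 K, 0 <= K & forall z0 z, cabs (F z - F z0) <= K * cabs ((z : C) - (z0 : C)).
Proof.
move=> [fr fi].
have [Kr Kr0 hr] := lipschitz_on_segment (- (pi *+ 2)) (pi *+ 2) fr.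
have [Ki Ki0 hi] := lipschitz_on_segment (- (pi *+ 2)) (pi *+ 2) fi.
exists ((Kr + Ki) * 2); first by rewrite mulr_ge0 ?addr_ge0.
move=> z0 z; have [t [u [tpi upi -> ->]]] := circle_near z0 z.
have p0 : 0 <= pi :> R by exact: pi_ge0.
have tin : t \in `[- (pi *+ 2), pi *+ 2].
  by rewrite in_itv/= -ler_norml (le_trans tpi)// mulr2n lerDl.
have tuin : t + u \in `[- (pi *+ 2), pi *+ 2].
  by rewrite in_itv/= -ler_norml (le_trans (ler_normD _ _))// mulr2n lerD.
have ufac : cabs ((expi (t + u) : C) - (expi t : C)) = cabs ((expi u : C) - 1).
  have -> : (expi (t + u) : C) - (expi t : C) = (expi t : C) * ((expi u : C) - 1).
    by rewrite expiD mulrBr mulr1.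
  by rewrite cabsM -[expi t : C]/(chi 1 (expi t)) cabs_chi mul1r.
apply: (@le_trans _ _ ((Kr + Ki) * `|u|)); last first.
  by rewrite -mulrA ler_wpM2l ?addr_ge0// ufac cabs_expi_sub1.
apply: le_trans (cabs_le_ReIm _) _; rewrite mulrDl; apply: lerD.
  by have := hr _ _ tuin tin; rewrite [t + u]addrC addrK ReD ReN [u + t]addrC.
have := hi _ _ tuin tin; rewrite [t + u]addrC addrK [u + t]addrC.
by case: (F _) => ? ?; case: (F _).
Qed.

Section quotient.
Variables (F : T -> C) (z0 : T).
Hypothesis F2 : smooth_circle 2 F.

(** This difference quotient is bounded since [F] is Lipschitz. By [F z = F z0 + (z - z0) * h z],
    the Fourier sum of [F] at [z0] telescopes to [F z0] plus two coefficients of [h], up to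
    unimodular factors, and these tend to 0. No convolution kernel is involved. *)
Let h z := (F z - F z0) * ((z : C) - (z0 : C))^-1.

Let FE z : F z = F z0 + ((z : C) - (z0 : C)) * h z.
Proof.
have [zz0|zz0] := eqVneq ((z : C) - (z0 : C)) 0.
  by rewrite zz0 mul0r addr0; congr F; apply: val_inj; apply/eqP; rewrite -subr_eq0; apply/eqP.
by rewrite /h mulrC divfK// addrC subrK.
Qed.

Let h_multiplier : exists M, multiplier h M.
Proof.
have [K K0 KP] := circle_lipschitz F2; have [M FM] := smooth_multiplier F2.
exists K; split=> //.
  apply: (@cmeasurableM _ (fun z => F z - F z0)).
    have [+ _ _] := multiplier_lin 1 FM (multiplier_cst (- F z0)).
    by rewrite (_ : (fun z => _) = (fun z => F z - F z0))//; apply/funext => z; rewrite mul1r.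
  apply: (@cmeasurableV (fun z => (z : C) - (z0 : C))).
  have [+ _ _] := multiplier_lin 1 (multiplier_chi R 1) (multiplier_cst (- (z0 : C))).
  by rewrite (_ : (fun z => _) = (fun z => (z : C) - (z0 : C)))//; apply/funext => z; rewrite mul1r.
apply: nearW => z; rewrite cabsM; have [z0E|zz0] := eqVneq ((z : C) - (z0 : C)) 0.
  by rewrite z0E invr0 cabs0 mulr0.
have c0 : 0 < cabs ((z : C) - (z0 : C)).
  by rewrite lt_def cabs_ge0 andbT; apply: contraNneq zz0 => /cabs0_eq0 ->.
rewrite -(ler_pM2r c0) -mulrA -cabsM mulVf// cabs_real normr1 mulr1.
exact: KP.
Qed.

Let coef_lin a G1 G2 k : G1 \in Lp 2%:E -> G2 \in Lp 2%:E ->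
  coef (fun z => a * G1 z + G2 z) k = a * coef G1 k + coef G2 k.
Proof. by move=> h1 h2; rewrite /coef toL2_lin// [LHS]L2_dot_linearl. Qed.

Let coef_F k : coef F k = F z0 * (k == 0)%:R + (coef h (k - 1) - (z0 : C) * coef h k).
Proof.
have [M hM] := h_multiplier; have hL := multiplier_in_Lp2 hM.
have zh := multiplier_Lp2 (multiplier_chi R 1) hL.
rewrite (_ : coef F k = coef (fun z => F z0 * 1 + ((- (z0 : C)) * h z + chi 1 z * h z)) k); last first.
  by congr coef; apply/funext => z; rewrite FE chi1; ring.
rewrite coef_lin ?Lp2_1//; last exact: Lp2_lin.
rewrite coef_lin// coef_1 addrC mulNr [in RHS]addrC; congr (_ + _).
rewrite addrC; congr (_ - _).
rewrite coefE// [RHS]coefE//; congr arc_integral; apply/funext => z.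
by rewrite opprB [1 - k]addrC chiD; ring.
Qed.

Let G k := coef h (k - 1) * chi k z0.

Let coef_term k : coef F k * chi k z0 = F z0 * (k == 0)%:R + (G k - G (k + 1)).
Proof.
rewrite coef_F /G addrK [chi (k + 1) z0]chiD chi1.
have [->|k0] := eqVneq k 0; first by rewrite chi0; ring.
by rewrite mulr0 !add0r; ring.
Qed.

Lemma fourier_sum n : \sum_(0 <= k < n.+1) coef F k%:Z * chi k%:Z z0 +
    \sum_(0 <= k < n) coef F (- k.+1%:Z) * chi (- k.+1%:Z) z0 =
  F z0 + (G (- n%:Z) - G n.+1%:Z).
Proof.
have -> : \sum_(0 <= k < n.+1) coef F k%:Z * chi k%:Z z0 = F z0 + (G 0 - G n.+1%:Z).
  elim: n => [|n ih].
    by rewrite big_nat1 coef_term eqxx mulr1 add0r.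
  rewrite big_nat_recr//= ih coef_term mulr0 add0r.
  rewrite (_ : n.+1%:Z + 1 = n.+2%:Z); last by rewrite -[in RHS]addn1 PoszD.
  by ring.
have -> : \sum_(0 <= k < n) coef F (- k.+1%:Z) * chi (- k.+1%:Z) z0 = G (- n%:Z) - G 0.
  elim: n => [|n ih]; first by rewrite big_nil oppr0 subrr.
  rewrite big_nat_recr//= ih coef_term.
  rewrite (_ : - n.+1%:Z + 1 = - n%:Z); last by rewrite -addn1 PoszD opprD subrK.
  by rewrite mulr0 add0r; ring.
by ring.
Qed.

Lemma fourier_cvg eps : 0 < eps -> exists n0, forall n, (n0 <= n)%N ->
  cabs (F z0 - (\sum_(0 <= k < n.+1) coef F k%:Z * chi k%:Z z0 +
    \sum_(0 <= k < n) coef F (- k.+1%:Z) * chi (- k.+1%:Z) z0)) <= eps.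
Proof.
move=> eps0; have e2 : 0 < eps / 2 by rewrite divr_gt0.
have op : orthosys dot (fun n => toL2 (chi n%:Z)).
  by apply: (@orthosys_chi R Posz) => i j [].
(* The boundary terms [G (- n)] and [G n.+1] contain the coefficients of [h] at [- n - 1] and at
   [n], whence the shift in this system. *)
have on : orthosys dot (fun n => toL2 (chi (- n%:Z - 1))).
  by apply: (@orthosys_chi R (fun n => - n%:Z - 1)) => i j /addIr/oppr_inj[].
have [n1 h1] := orthosys_coef_small (toL2 h) op e2.
have [n2 h2] := orthosys_coef_small (toL2 h) on e2.
exists (maxn n1 n2) => n; rewrite geq_max => /andP[n1n n2n].
rewrite fourier_sum opprD addrA subrr add0r cabsN.
apply: le_trans (cabsD _ _) _; rewrite cabsN (splitr eps) /G !cabsM !cabs_chi !mulr1.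
apply: lerD; first by apply: ltW; exact: h2.
rewrite -addn1 PoszD addrK; apply: ltW; exact: h1.
Qed.

End quotient.

Definition trig_poly (s : seq (C * int)) z := \sum_(c <- s) c.1 * chi c.2 z.

(* The partial Fourier sums of order [m]: a coefficient decay of order [n + 2] leaves a
   uniform remainder of order [m ^- n]. *)
Theorem trig_approximation n F : smooth_circle n.+3 F -> exists2 c, 0 <= c &
  forall m, (0 < m)%N -> exists s : seq (C * int),
    (forall a, a \in s -> (`|a.2|%N <= m)%N) /\
    forall z, cabs (F z - trig_poly s z) <= c / m%:R ^+ n.
Proof.
move=> Fn.
have F2 : smooth_circle 2 F.
  have [fr fi] := Fn; split.
    by elim: (n) fr => [|q ih] /differentiable_nS.
  by elim: (n) fi => [|q ih] /differentiable_nS.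
have [c c0 cP] := coef_decay Fn.
pose S q z := \sum_(0 <= k < q.+1) coef F k%:Z * chi k%:Z z +
    \sum_(0 <= k < q) coef F (- k.+1%:Z) * chi (- k.+1%:Z) z.
exists (2 * c); first by rewrite mulr_ge0.
move=> m m0; have mR : 0 < m%:R :> R by rewrite ltr0n.
pose s := [seq (coef F i%:Z, i%:Z) | i <- index_iota 0 m.+1] ++
  [seq (coef F (- i.+1%:Z), - i.+1%:Z) | i <- index_iota 0 m].
exists s; split.
  move=> a; rewrite mem_cat => /orP[] /mapP[k]; rewrite mem_index_iota => /andP[_ km] -> /=.
    by rewrite -ltnS.
  by [].
have sE z : trig_poly s z = S m z.
  by rewrite /trig_poly /s big_cat !big_map.
(* Of the decay [(q + 1) ^- (n + 2)], [n] powers are bounded by [m ^- n] and the other two by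
   [1 / (q * (q + 1)) = 1 / q - 1 / (q + 1)], which telescopes. *)
have incr q z : (m <= q)%N ->
    cabs (S q.+1 z - S q z) <= 2 * c / m%:R ^+ n * (q%:R^-1 - q.+1%:R^-1).
  move=> mq; have q0 : 0 < q%:R :> R by rewrite ltr0n (leq_trans m0).
  have -> : S q.+1 z - S q z = coef F q.+1%:Z * chi q.+1%:Z z +
      coef F (- q.+1%:Z) * chi (- q.+1%:Z) z.
    by rewrite /S big_nat_recr//= [X in _ + X - _]big_nat_recr//=; ring.
  have bnd k : `|k|%N = q.+1 -> cabs (coef F k) <= c / m%:R ^+ n * (q%:R^-1 - q.+1%:R^-1).
    move=> kq; have := cP k; rewrite kq => h.
    have S0 : 0 < q.+1%:R :> R by [].
    rewrite (@le_trans _ _ (c / q.+1%:R ^+ n.+2))//.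
      by rewrite ler_pdivlMr ?exprn_gt0// mulrC.
    rewrite -mulrA ler_wpM2l//.
    have -> : q%:R^-1 - q.+1%:R^-1 = (q%:R * q.+1%:R)^-1 :> R.
      by rewrite -natr1; field; rewrite natr1 !gt_eqF.
    rewrite -invfM lef_pV2 ?posrE ?exprn_gt0 ?mulr_gt0 ?exprn_gt0//.
    rewrite -addn2 exprD; apply: ler_pM.
    - exact: exprn_ge0.
    - by rewrite mulr_ge0.
    - by apply: lerXn2r; rewrite ?nnegrE// ler_nat leqW.
    - by rewrite expr2 ler_wpM2r// ler_nat.
  apply: le_trans (cabsD _ _) _; rewrite !cabsM !cabs_chi !mulr1 -!mulrA mulr2n mulrDl mul1r.
  by apply: lerD; rewrite mulrA; apply: bnd; rewrite ?abszN.
have tel d z : cabs (S (m + d)%N z - S m z) <= 2 * c / m%:R ^+ n * (m%:R^-1 - (m + d)%:R^-1).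
  elim: d => [|d ih]; first by rewrite addn0 !subrr cabs0 mulr0.
  rewrite addnS -[S (m + d).+1 z](subrK (S (m + d)%N z)) -addrA.
  apply: le_trans (cabsD _ _) _.
  apply: le_trans (lerD (incr _ z (leq_addr _ _)) ih) _.
  by rewrite -mulrDr le_eqVlt; apply/orP; left; apply/eqP; congr (_ * _); ring.
(* A partial sum far beyond [m] is within [eps] of [F z], and the accumulated increments are bounded
   independently of how far it is. *)
move=> z; apply/ler_addgt0Pr => eps eps0; have [n0 h] := fourier_cvg z F2 eps0.
have := h (m + n0)%N (leq_addl _ _); rewrite -/(S (m + n0)%N z) => h1.
rewrite sE -[F z](subrK (S (m + n0)%N z)) -addrA.
rewrite (le_trans (cabsD _ _))// [leRHS]addrC lerD//.
apply: le_trans (tel n0 z) _; rewrite -[leRHS]mulr1 ler_wpM2l//.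
  by rewrite divr_ge0 ?mulr_ge0// exprn_ge0.
by rewrite lerBlDr (@le_trans _ _ 1)// ?lerDl// invf_le1// ler1n.
Qed.

End fourier_inversion.

(** * Hankel operators *)

Section hardy.
Variable R : realType.
Notation T := (circle R).
Notation C := R[i].
Notation m := (@arc_measure R).
Notation L2 := (L2 R).
Notation H2 := (H2 R).
Notation dot := (@L2_dot R).
Notation N := (hnorm (@L2_dot R)).
Notation e := (@monomials R).
Implicit Types (x y : H2) (f g : L2) (w : T -> C).

Lemma monomialsE n : e n = toL2 (chi n%:Z).
Proof. by []. Qed.

Lemma orthosys_monomials : orthosys dot e.
Proof. by apply: (@orthosys_chi R Posz) => i j []. Qed.

Lemma monomial_H2 n : e n \in closed_span dot e.
Proof.
apply/asboolP => eps eps0; exists [:: (1, n)].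
by rewrite big_seq1 scale1r subrr hnorm0.
Qed.

Lemma hnorm_H2 x : hnorm (@H2_dot R) x = N (H2_val x).
Proof. by []. Qed.

Lemma H2_hcomplete : hcomplete (@H2_dot R).
Proof.
move=> u uC; have [f uf] : exists f, hcvg dot (@H2_val R \o u) f.
  by apply: L2_hcomplete => eps /uC.
have fH : f \in closed_span dot e.
  by apply: (closed_span_closed _ uf) => n; exact: H2_valP.
by exists (MkH2 fH).
Qed.

Let P := closed_proj dot e.

Let P_closed_span f : P f \in closed_span dot e.
Proof.
apply: (closed_span_closed _ (closed_proj_cvg (@L2_hcomplete R) orthosys_monomials f)) => n.
exact: oproj_closed_span.
Qed.

Let P_id f : f \in closed_span dot e -> P f = f.
Proof.
move=> fH; apply: hcvg_unique (closed_proj_cvg (@L2_hcomplete R) orthosys_monomials f) _.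
exact: (closed_span_oproj orthosys_monomials).
Qed.

Lemma dot_closed_span_orth f g : f \in closed_span dot e ->
  (forall i, dot g (e i) = 0) -> dot f g = 0.
Proof.
move=> fH ge; rewrite -(P_id fH).
exact: (closed_proj_orth (@L2_hcomplete R) orthosys_monomials).
Qed.

(** The limit of the partial projections on the monomials lies in H2 and has the defining property,
    so [xget] does not return its default. *)
Lemma PplusP f x : dot (f - H2_val (Pplus f)) (H2_val x) = 0.
Proof.
apply: (@xgetPex _ 0 [set g : H2 | forall h : H2, dot (f - H2_val g) (H2_val h) = 0]).
exists (MkH2 (P_closed_span f)) => y /=.
rewrite L2_dot_herm expr0 mul1r dot_closed_span_orth ?rmorph0//; first exact: H2_valP.
move=> i; apply: etrans (dotBl dot _ _ _) _.
by rewrite (dot_closed_proj (@L2_hcomplete R) orthosys_monomials) subrr.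
Qed.

Lemma dot_Pplus f x : dot (H2_val (Pplus f)) (H2_val x) = dot f (H2_val x).
Proof.
have := PplusP f x; rewrite [LHS](dotBl dot _ _ _) => /eqP.
by rewrite subr_eq0 => /eqP.
Qed.

Lemma Pplus_linear : linear (@Pplus R).
Proof.
move=> a f g; apply/subr0_eq/(dot_eq0 (dot := @H2_dot R)) => x.
rewrite dotBl dotDl dotZl [X in X - _](dot_Pplus _ x) [X in _ - (_ * X + _)](dot_Pplus _ x).
by rewrite [X in _ - (_ + X)](dot_Pplus _ x) L2_dot_linearl subrr.
Qed.

Lemma Pplus_best f g : g \in closed_span dot e -> N (f - H2_val (Pplus f)) <= N (f - g).
Proof.
move=> gH; have := PplusP f (Pplus f - MkH2 gH); set r := f - _ => rH.
have -> : f - g = r + (H2_val (Pplus f) - g) by rewrite /r addrA subrK.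
rewrite -(@ler_pXn2r _ 2)// ?nnegrE ?hnorm_ge0// (hnorm_sqrD _ r (_ - g)).
have -> : rdot dot r (H2_val (Pplus f) - g) = 0 by rewrite /rdot [X in complex.Re X]rH.
by rewrite mulr0 addr0 lerDl sqr_ge0.
Qed.

Lemma hnorm_Pplus f : N (H2_val (Pplus f)) <= N f.
Proof.
have h := dot_Pplus f (Pplus f).
have [->|p0] := eqVneq (N (H2_val (Pplus f))) 0; first exact: hnorm_ge0.
have pp : 0 < N (H2_val (Pplus f)) by rewrite lt_def p0 hnorm_ge0.
rewrite -(ler_pM2r pp); apply: le_trans (rdot_le dot _ _).
by rewrite -expr2 -rdotxx /rdot [X in complex.Re X <= _]h.
Qed.

Section hankel_operator.
Variables (w : T -> C) (M : R).
Hypothesis wM : multiplier w M.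
Hypothesis w_sym : {ae m, forall z, conjc (w z) = w (circle_conj z)}.

(** The form of the Hankel operator without the projection. Unlike [hankel w] it can be evaluated at
    [sigma x], which need not be in H2; against vectors of H2 the projection disappears. *)
Definition hankel_form f g := rdot dot (mul_op w (flip_op f)) g.

Lemma dot_hankel x y : H2_dot (hankel w x) y = dot (mul_op w (flip_op (H2_val x))) (H2_val y).
Proof. exact: dot_Pplus. Qed.

Lemma rdot_hankel x y :
  rdot (@H2_dot R) (hankel w x) y = hankel_form (H2_val x) (H2_val y).
Proof. exact: (congr1 (@complex.Re R) (dot_hankel x y)). Qed.

Lemma hankel_linear : linear (hankel w).
Proof.
move=> a x y; rewrite /hankel.
rewrite -[H2_val (a *: x + y)]/(a *: H2_val x + H2_val y).
by rewrite flip_op_linear (mul_op_linear wM) Pplus_linear.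
Qed.

Lemma hankel_bounded x : hnorm (@H2_dot R) (hankel w x) <= M * hnorm (@H2_dot R) x.
Proof.
rewrite !hnorm_H2; apply: le_trans (hnorm_Pplus _) _.
by apply: le_trans (hnorm_mul_op _ wM) _; rewrite hnorm_flip.
Qed.

(** The adjoint of [w W] is [W] after multiplication by the conjugate of [w]. Moving [W] to the
    right evaluates that conjugate at [conj z], which gives back [w] by the symmetry condition. *)
Lemma hankel_symmetric x y : H2_dot (hankel w x) y = H2_dot x (hankel w y).
Proof.
rewrite dot_hankel (dot_mul_op _ _ wM) dot_flip (flip_mul_op _ (multiplier_conjc wM)).
have -> : H2_dot x (hankel w y) = dot (H2_val x) (mul_op w (flip_op (H2_val y))).
  rewrite [LHS]L2_dot_herm [RHS]L2_dot_herm !expr0 !mul1r.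
  by congr (Num.conj _); exact: dot_hankel.
congr (dot _ _); apply: (eq_mul_op _ (multiplier_flip (multiplier_conjc wM)) wM).
by apply: filterS (ae_circle_conj w_sym) => z ->; rewrite circle_conjK.
Qed.

Lemma hankel_form_le f g : `|hankel_form f g| <= M * (N f * N g).
Proof.
apply: le_trans (normr_rdot_le _ _ _) _; rewrite mulrA ler_wpM2r ?hnorm_ge0//.
by apply: le_trans (hnorm_mul_op _ wM) _; rewrite hnorm_flip.
Qed.

Lemma hankel_formBl f g h : hankel_form (f - g) h = hankel_form f h - hankel_form g h.
Proof.
by rewrite /hankel_form (linB (@flip_op_linear R)) (linB (mul_op_linear wM)) rdotBl.
Qed.

Lemma hankel_formBr f g h : hankel_form f (g - h) = hankel_form f g - hankel_form f h.
Proof. by rewrite /hankel_form rdotBr. Qed.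

End hankel_operator.

Lemma multiplier_trig_poly (s : seq (C * int)) : exists K, multiplier (trig_poly s) K.
Proof.
elim: s => [|a s [K sK]].
  exists (cabs 0); rewrite (_ : trig_poly _ = fun=> 0); first exact: multiplier_cst.
  by apply/funext => z; rewrite /trig_poly big_nil.
exists (cabs a.1 * 1 + K).
rewrite (_ : trig_poly _ = fun z => a.1 * chi a.2 z + trig_poly s z).
  by apply: multiplier_lin => //; exact: multiplier_chi.
by apply/funext => z; rewrite /trig_poly big_cons.
Qed.

Lemma mul_op_trig_poly (s : seq (C * int)) k :
  mul_op (trig_poly s) (toL2 (chi k)) = \sum_(a <- s) a.1 *: toL2 (chi (a.2 + k)).
Proof.
elim: s => [|a s ih].
  rewrite big_nil (_ : trig_poly _ = fun=> 0); last first.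
    by apply/funext => z; rewrite /trig_poly big_nil.
  rewrite (mul_op_toL2 (multiplier_cst 0) (Lp2_chi R k)) -(toL2_0 R).
  by congr toL2; apply/funext => z; rewrite mul0r.
have [K sK] := multiplier_trig_poly s.
rewrite big_cons -ih (_ : trig_poly _ = fun z => a.1 * chi a.2 z + trig_poly s z); last first.
  by apply/funext => z; rewrite /trig_poly big_cons.
rewrite (mul_op_lin _ _ (multiplier_chi R a.2) sK); congr (_ *: _ + _).
rewrite (mul_op_toL2 (multiplier_chi R a.2) (Lp2_chi R k)); congr toL2.
by apply/funext => z; rewrite chiD.
Qed.

Lemma flip_chi k : flip_op (toL2 (@chi R k)) = toL2 (chi (- k)).
Proof.
rewrite flip_op_toL2 ?Lp2_chi//; congr toL2.
by apply/funext => z; rewrite chi_conj.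
Qed.

Section tail.
Variables (x : H2) (n : nat) (s : seq (C * int)).
Hypothesis x_orth : forall j, (j < n)%N -> dot (H2_val x) (e j) = 0.
Hypothesis s_deg : forall a, a \in s -> (`|a.2|%N <= n)%N.

Let xcvg : hcvg dot (oproj dot e ^~ (H2_val x)) (H2_val x).
Proof. exact: (closed_span_oproj orthosys_monomials (H2_valP x)). Qed.

(** [x] has frequencies at least [n] only, and terms of degree at least [- n] shift them to
    nonnegative ones; partial projections reduce this to monomials. *)
Lemma mul_trig_poly_H2 : mul_op (trig_poly s) (H2_val x) \in closed_span dot e.
Proof.
have [K sK] := multiplier_trig_poly s.
have slin := mul_op_linear sK.
apply: (@closed_span_closed _ _ _ _ _ (mul_op (trig_poly s) \o oproj dot e ^~ (H2_val x))).
  move=> q /=; rewrite /oproj (lin_sum slin); apply: rpred_sum => i _.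
  rewrite (linZ slin); have [in_|ni] := ltnP i n.
    by rewrite [X in X *: _](x_orth in_) scale0r rpred0.
  apply: rpredZ; rewrite monomialsE mul_op_trig_poly big_seq; apply: rpred_sum => a /s_deg an.
  have [b ->] : exists b : nat, a.2 + i%:Z = b%:Z.
    exists (absz (a.2 + i%:Z)); rewrite gez0_abs// -lerBlDr sub0r lerNl.
    apply: le_trans (ler_norm _) _.
    by rewrite normrN -abszE lez_nat (leq_trans an).
  by apply: rpredZ; rewrite -monomialsE monomial_H2.
apply: (hcvg_lip (M := K)) xcvg => f g.
by rewrite -(linB slin); exact: hnorm_mul_op.
Qed.

(** The flipped [x] has frequencies at most [- n], so the product has frequencies at most 0. It can
    meet [x] only at frequency 0, where the coefficient of [x] is 0 because [0 < n]. *)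
Lemma dot_mul_trig_poly_flip : (0 < n)%N ->
  dot (mul_op (trig_poly s) (flip_op (H2_val x))) (H2_val x) = 0.
Proof.
move=> n0; have [K sK] := multiplier_trig_poly s.
have slin := mul_op_linear sK; have flin := @flip_op_linear R.
apply: (@hcvg_dot0 _ _ dot
  ((fun f => mul_op (trig_poly s) (flip_op f)) \o oproj dot e ^~ (H2_val x))).
  apply: (hcvg_lip (f := fun f => mul_op (trig_poly s) (flip_op f)) (M := K)) xcvg => f g.
  rewrite -(linB slin) -(linB flin).
  by rewrite (le_trans (hnorm_mul_op _ sK))// hnorm_flip.
move=> q /=; rewrite /oproj (lin_sum flin) (lin_sum slin) dot_suml big1// => i _.
rewrite (linZ flin) (linZ slin) dotZl; have [in_|ni] := ltnP i n.
  by rewrite [X in X * _](x_orth in_) mul0r.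
rewrite monomialsE flip_chi mul_op_trig_poly dot_suml big_seq big1 ?mulr0// => a /s_deg an.
rewrite dotZl dotC.
suff h : L2_dot (H2_val x) (toL2 (chi (a.2 - i%:Z))) = 0.
  by rewrite [X in conjc X]h conjc0 mulr0.
have : a.2 - i%:Z <= 0.
  rewrite subr_le0; apply: le_trans (ler_norm _) _.
  by rewrite -abszE lez_nat (leq_trans an).
rewrite le_eqVlt => /orP[/eqP ->|jneg]; first exact: x_orth.
apply: dot_closed_span_orth; first exact: H2_valP.
by move=> j; rewrite monomialsE dot_chi lt_eqF// (lt_le_trans jneg).
Qed.

End tail.

Lemma hnorm_mul_opB (w1 w2 : T -> C) L1 L2 d : multiplier w1 L1 -> multiplier w2 L2 ->
  0 <= d -> (forall z, cabs (w1 z - w2 z) <= d) ->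
  forall f, N (mul_op w1 f - mul_op w2 f) <= d * N f.
Proof.
move=> h1 h2 d0 h f.
have -> : mul_op w1 f - mul_op w2 f = mul_op (fun z => -1 * w2 z + w1 z) f.
  by rewrite (mul_op_lin _ _ h2 h1) scaleN1r addrC.
apply: hnorm_mul_op; have [mw _ _] := multiplier_lin (-1) h2 h1; split => //.
by apply: nearW => z; rewrite mulN1r addrC.
Qed.

(* With [T x] the projection of [sigma x], oddness of [sigma] gives
   [<H T x, T x> = - <sigma ^ 2 w W x, x>] up to the defect of [sigma x] from
   being in [H2], and [(1 - sigma ^ 2) w] is smooth. *)
Section sign_flip.
Variables (w sigma : T -> C) (M : R) (G : T -> C).
Hypothesis wM : multiplier w M.
Hypothesis sigma1 : multiplier sigma 1.
Hypothesis sigma_real : forall z, conjc (sigma z) = sigma z.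
Hypothesis sigma_odd : forall z, sigma (circle_conj z) = - sigma z.
Hypothesis GE : {ae m, forall z, w z - sigma z ^+ 2 * w z = G z}.

Definition toeplitz x : H2 := Pplus (mul_op sigma (H2_val x)).

Lemma toeplitz_linear : linear toeplitz.
Proof.
move=> a x y; rewrite /toeplitz -[H2_val (a *: x + y)]/(a *: H2_val x + H2_val y).
by rewrite (mul_op_linear sigma1) Pplus_linear.
Qed.

Lemma toeplitz_contraction x : hnorm (@H2_dot R) (toeplitz x) <= hnorm (@H2_dot R) x.
Proof.
rewrite !hnorm_H2; apply: le_trans (hnorm_Pplus _) _.
by apply: le_trans (hnorm_mul_op _ sigma1) _; rewrite mul1r.
Qed.

Lemma hankel_form_sign_flip (X Y : L2) K d1 d2 : multiplier G K ->
  N Y <= N X -> N (mul_op sigma X - Y) <= d1 * N X ->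
  `|rdot dot (mul_op G (flip_op X)) X| <= d2 * N X ^+ 2 ->
  `|hankel_form w X X + hankel_form w Y Y| <= (2 * M * d1 + d2) * N X ^+ 2.
Proof.
move=> GK YN rN GX; have M0 : 0 <= M by case: wM.
have yN := hnorm_mul_op X sigma1; rewrite mul1r in yN.
have -> : hankel_form w X X + hankel_form w Y Y = rdot dot (mul_op G (flip_op X)) X -
    (hankel_form w (mul_op sigma X - Y) (mul_op sigma X) +
     hankel_form w Y (mul_op sigma X - Y)).
  have -> : rdot dot (mul_op G (flip_op X)) X =
      hankel_form w X X + hankel_form w (mul_op sigma X) (mul_op sigma X).
    rewrite /hankel_form; have sf := multiplier_flip sigma1.
    have -> : rdot dot (mul_op w (flip_op (mul_op sigma X))) (mul_op sigma X) =
        rdot dot (mul_op (fun z => sigma z * (w z * sigma (circle_conj z))) (flip_op X)) X.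
      rewrite -(mul_opM _ sigma1 (multiplierM wM sf)) -(mul_opM _ wM sf).
      rewrite (flip_mul_op _ sigma1).
      move: (mul_op w (mul_op _ _)) => f; have := dot_mul_op f X sigma1.
      rewrite (_ : (fun z => conjc (sigma z)) = sigma); last exact/funext.
      by move=> h; exact: (congr1 (@complex.Re R) (esym h)).
    rewrite -rdotDl; congr (rdot _ _ _).
    have mm := multiplierM sigma1 (multiplierM wM sf).
    have := mul_op_lin 1 (flip_op X) wM mm; rewrite scale1r => <-.
    apply: (eq_mul_op _ GK (multiplier_lin 1 wM mm)).
    by apply: filterS GE => z <-; rewrite sigma_odd; ring.
  move: (mul_op sigma X) => y; rewrite (hankel_formBl wM) hankel_formBr.
  move: (hankel_form w X X) (hankel_form w y y) (hankel_form w Y Y) (hankel_form w Y y).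
  by move=> a b c d; ring.
have h1 : `|hankel_form w (mul_op sigma X - Y) (mul_op sigma X)| <= M * d1 * N X ^+ 2.
  apply: le_trans (hankel_form_le wM _ _) _; rewrite -mulrA ler_wpM2l// expr2 mulrA.
  by apply: ler_pM => //; exact: hnorm_ge0.
have h2 : `|hankel_form w Y (mul_op sigma X - Y)| <= M * d1 * N X ^+ 2.
  apply: le_trans (hankel_form_le wM _ _) _; rewrite -mulrA ler_wpM2l// expr2 mulrA mulrC.
  by apply: ler_pM => //; exact: hnorm_ge0.
apply: le_trans (ler_normB _ _) _; apply: le_trans (lerD GX (ler_normD _ _)) _.
by have := lerD h1 h2; lra.
Qed.

(** Multiplication by [trig_poly s1] keeps [x] in H2, so the projection of [sigma x] is within
    [d1 * N x] of [sigma x]. The polynomial of [s2] contributes nothing to the form of [G], which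
    leaves [d2]. *)
Lemma hankel_sign_flip x n (s1 s2 : seq (C * int)) d1 d2 K : multiplier G K ->
  (0 < n)%N -> (forall j, (j < n)%N -> dot (H2_val x) (e j) = 0) ->
  (forall a, a \in s1 -> (`|a.2|%N <= n)%N) -> (forall a, a \in s2 -> (`|a.2|%N <= n)%N) ->
  0 <= d1 -> 0 <= d2 ->
  (forall z, cabs (sigma z - trig_poly s1 z) <= d1) ->
  (forall z, cabs (G z - trig_poly s2 z) <= d2) ->
  `|rdot (@H2_dot R) (hankel w x) x +
    rdot (@H2_dot R) (hankel w (toeplitz x)) (toeplitz x)| <=
  (2 * M * d1 + d2) * hnorm (@H2_dot R) x ^+ 2.
Proof.
move=> GK n0 xo s1n s2n d10 d20 sd1 sd2.
have [Tx TxE] : exists Tx, Tx = toeplitz x by exists (toeplitz x).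
have TxN := toeplitz_contraction x; rewrite -!TxE !hnorm_H2 in TxN *.
move: (rdot_hankel w x x) (rdot_hankel w Tx Tx).
(* Generalizing avoids a conversion test between [x] and [Tx] that unfolds [Pplus]. *)
generalize (hankel w x) (hankel w Tx) => hx hTx -> ->.
have [K1 s1K] := multiplier_trig_poly s1; have [K2 s2K] := multiplier_trig_poly s2.
apply: (hankel_form_sign_flip GK TxN).
  rewrite TxE; apply: le_trans (Pplus_best _ (mul_trig_poly_H2 xo s1n)) _.
  exact: (hnorm_mul_opB sigma1 s1K d10 sd1).
have -> : rdot dot (mul_op G (flip_op (H2_val x))) (H2_val x) =
    rdot dot (mul_op G (flip_op (H2_val x)) - mul_op (trig_poly s2) (flip_op (H2_val x))) (H2_val x).
  rewrite rdotBl; have h := dot_mul_trig_poly_flip xo s2n n0.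
  by rewrite [X in _ - X](_ : _ = 0) ?subr0// /rdot [X in complex.Re X]h.
apply: le_trans (normr_rdot_le _ _ _) _; rewrite expr2 mulrA ler_wpM2r ?hnorm_ge0//.
by have := hnorm_mul_opB GK s2K d20 sd2 (flip_op (H2_val x)); rewrite hnorm_flip.
Qed.

End sign_flip.

End hardy.

(** * The odd cutoff near the singular support *)

Section cutoff.
Variable R : realType.
Notation T := (circle R).
Notation C := R[i].
Notation m := (@arc_measure R).
Notation ReC := (@complex.Re R).
Notation ImC := (@complex.Im R).
Implicit Types (z : T) (w : T -> C).

Lemma Linfty_multiplier w : w \in Lp +oo%E -> exists M, multiplier w M.
Proof.
have bnd (f : T -> R) : f \in Lfun m +oo%E -> measurable_fun setT f /\
    exists2 M, 0 <= M & {ae m, forall z, `|f z| <= M}.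
  rewrite inE => /andP[/[!inE] /= mf]; rewrite /finite_norm unlock => fM; split=> //.
  move: fM; rewrite -[X in if X then _ else _]/((0 < m setT)%E) probability_setT lte01.
  set M := ess_sup _ _ => fM.
  have aeM : {ae m, forall z, (`|f z|%:E <= M)%E} by exact: ess_sup_ge.
  exists (`|fine M|) => //; apply: filterS aeM => z; move: fM; case: (M) => [r| |]//.
  by rewrite lee_fin /= => _ h; apply: le_trans h _; exact: ler_norm.
move=> /andP[/bnd[mr [Mr Mr0 hr]] /bnd[mi [Mi Mi0 hi]]].
exists (Mr + Mi); split; [by []|exact: addr_ge0|].
apply: filterS2 hr hi => z hr hi; apply: le_trans (cabs_le_ReIm _) _.
exact: lerD.
Qed.

Lemma differentiable_n_posX (eps c : R) n : differentiable_n n setT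
  (fun t => Num.max 0 (eps + c * sin t) ^+ n.+1).
Proof.
elim: n => // n ih.
exists (fun t => (n.+2%:R * Num.max 0 (eps + c * sin t) ^+ n.+1) * (c * cos t)); split.
  move=> t _; have d : is_derive t 1 (fun t => eps + c * sin t) (c * cos t).
    have h := is_deriveD (is_derive_cst eps t 1) (is_deriveZ c (is_derive_sin t)).
    by apply: (is_derive_eq h); rewrite add0r.
  exact: (@is_derive1_comp R (fun y => Num.max 0 y ^+ n.+2) (fun t => eps + c * sin t) t
    _ _ (is_derive_posX n _) d).
apply: differentiable_nM.
  by apply: differentiable_nM => //; exact: differentiable_n_cst.
apply: differentiable_nM; first exact: differentiable_n_cst.
by have [] := differentiable_n_sincos n (setT : set R).
Qed.

Section sign.
Variables (eps : R) (n : nat).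
Hypothesis eps0 : 0 < eps.

Let b (y : R) := Num.max 0 (eps + y) ^+ n.+1.

Let b_ge0 y : 0 <= b y.
Proof. by rewrite exprn_ge0// le_max lexx. Qed.

Let b_gt0 y : 0 < b y + b (- y).
Proof.
have pos x : 0 <= x -> 0 < b x.
  by move=> x0; rewrite exprn_gt0// lt_max; apply/orP; right; rewrite ltr_wpDr.
have [y0|y0] := leP 0 y; first by rewrite ltr_wpDr ?pos.
by rewrite ltr_wpDl// pos// oppr_ge0 ltW.
Qed.

(** [b (- y)] vanishes for [y >= eps] and [b y] for [y <= - eps], so the quotient is exactly 1 or -1
    there; everywhere else at least one of the two is positive. *)
Definition smooth_sign (y : R) := (b y - b (- y)) / (b y + b (- y)).

Lemma smooth_signN y : smooth_sign (- y) = - smooth_sign y.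
Proof. by rewrite /smooth_sign opprK -mulNr opprB; congr (_ / _); rewrite addrC. Qed.

Lemma smooth_sign_le1 y : `|smooth_sign y| <= 1.
Proof.
rewrite /smooth_sign normrM normfV (gtr0_norm (b_gt0 y)) ler_pdivrMr// mul1r.
by apply: le_trans (ler_normB _ _) _; rewrite !ger0_norm.
Qed.

Lemma smooth_sign_sqr y : eps <= `|y| -> smooth_sign y ^+ 2 = 1.
Proof.
wlog y0 : y / 0 <= y => [h|].
  have [y0|/ltW y0] := leP 0 y; first exact: h.
  by move=> ey; rewrite -sqrrN -smooth_signN h ?oppr_ge0 ?normrN.
rewrite ger0_norm// => ey; rewrite /smooth_sign.
have -> : b (- y) = 0 by rewrite /b max_l ?expr0n// subr_le0.
have := b_gt0 y; rewrite {1}/b [X in _ + X](_ : _ = 0) ?addr0; last first.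
  by rewrite /b max_l ?expr0n// subr_le0.
by rewrite subr0 -/(b y) => by0; rewrite divff ?expr1n// gt_eqF.
Qed.

Lemma differentiable_n_smooth_sign :
  differentiable_n n setT (fun t => smooth_sign (sin t)).
Proof.
have bp : differentiable_n n setT (fun t => b (sin t)).
  rewrite (_ : (fun t => _) = fun t => Num.max 0 (eps + 1 * sin t) ^+ n.+1).
    exact: differentiable_n_posX.
  by apply/funext => t; rewrite mul1r.
have bn : differentiable_n n setT (fun t => b (- sin t)).
  rewrite (_ : (fun t => _) = fun t => Num.max 0 (eps + -1 * sin t) ^+ n.+1).
    exact: differentiable_n_posX.
  by apply/funext => t; rewrite mulN1r.
apply: differentiable_nM.
  by apply: differentiable_nD => //; exact: differentiable_nN.
apply: differentiable_nV; last exact: differentiable_nD.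
by move=> t _; rewrite gt_eqF.
Qed.

End sign.

Lemma open_gt0 (f : R -> R) : continuous f -> open [set t | 0 < f t].
Proof.
move=> cf; rewrite (_ : [set t | _] = f @^-1` [set y | 0 < y])//.
exact: ((continuousP f).1 cf _ (@open_gt R 0)).
Qed.

(* A point of the circle with small imaginary part is close to 1 or to -1. *)
Lemma near_point (X : set T) (x0 : R) : x0 ^+ 2 = 1 -> closed X ->
  (forall z, (z : C) = x0%:C -> ~ X z) ->
  exists2 eps, 0 < eps & forall z, `|ImC (z : C)| < eps -> 0 < x0 * ReC (z : C) -> ~ X z.
Proof.
move=> x01 cX nX.
have x0c : `|(x0%:C : C)| == 1.
  by rewrite -(@eqrXn2 _ 2)// ?normr_ge0// expr1n; apply/eqP; rewrite cabsE -rmorphXn/= cabs_real real_normK ?num_real// x01.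
have := closed_openC cX => -[B oB BX].
have Bx0 : B (x0%:C : C).
  have : (~` X) (Circle x0c) by apply: nX.
  by rewrite -BX.
have [r /= r0 rB] : nbhs (x0%:C : C^o) B by apply: open_nbhs_nbhs; split.
have rE : r = (ReC r)%:C by move: r0; rewrite lt0r => /andP[_ /ger0_real /RRe_real ->].
have rr0 : 0 < ReC r by move: r0; rewrite rE ltcR.
exists (ReC r / 2); first by rewrite divr_gt0.
move=> z zim zre; suff : (~` X) z by [].
rewrite -BX; apply: rB; rewrite /ball_ /= rE cabsE ltcR.
have := circle_norm z; move: zim zre; case: (circle_val z) => x y /= yr xx0.
rewrite normc_def /= => /eqP/complexI xy1.
have xy : x ^+ 2 + y ^+ 2 = 1.
  by rewrite -[LHS]sqr_sqrtr ?addr_ge0 ?sqr_ge0// xy1 expr1n.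
rewrite -(@ltr_pXn2r _ 2)// ?nnegrE ?cabs_ge0 ?(ltW rr0)// cabs_sqr /=.
have xx1 : x0 * x <= 1.
  have : (x0 * x) ^+ 2 <= 1 by rewrite exprMn x01 mul1r -xy lerDl sqr_ge0.
  by rewrite -{1}(expr1n _ 2) ler_pXn2r ?nnegrE// ltW.
have e1 : (x0 - x) ^+ 2 + (0 - y) ^+ 2 = 2 - 2 * (x0 * x).
  by rewrite sub0r sqrrN sqrrB x01; move: xy; lra.
have y2 : y ^+ 2 = 1 - (x0 * x) ^+ 2 by rewrite exprMn x01 mul1r; move: xy; lra.
have yr2 : y ^+ 2 < (ReC r / 2) ^+ 2.
  rewrite -[y ^+ 2]real_normK ?num_real// ltr_pXn2r ?nnegrE ?divr_ge0//.
  exact: ltW.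
rewrite e1; move: yr2; rewrite y2; move: (x0 * x) xx0 xx1 => q q0 q1.
move: (ReC r) rr0 => r' r0' h; have qq : 0 <= q * (1 - q) by rewrite mulr_ge0 ?subr_ge0// ltW.
by have := sqr_ge0 r'; lra.
Qed.

Lemma smooth_on_differentiable n (U : set T) (g : T -> C) (V : set R) : smooth_on U g ->
  (forall t, V t -> U (expi t)) ->
  differentiable_n n V (fun t => ReC (g (expi t))) /\
  differentiable_n n V (fun t => ImC (g (expi t))).
Proof.
by move=> gU VU; split; apply: smooth_differentiable_n => k t /VU /(gU k)[].
Qed.

(** The singular support is an intersection, so one admissible closed set already misses [z0]. The
    set and the smooth representative depend on the point, which is why two of them are glued
    later. *)
Lemma not_sing_supp w z0 : ~ sing_supp w z0 -> exists (X : set T) (g : T -> C),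
  [/\ closed X, ~ X z0, smooth_on (~` X) g & {ae m, forall z, ~ X z -> w z = g z}].
Proof.
by rewrite -existsNE => -[X] /not_implyP[[cX [g [gX wg]]] nX]; exists X, g.
Qed.

(** [sigma] is a smoothed sign of the imaginary part, hence odd under conjugation, with square 1
    where [|Im z| >= eps]. The sign of the real part separates the two remaining arcs, on which [w]
    is replaced by its smooth representatives [g1] and [g2]. *)
Lemma exists_cutoff w n : ~ sing_supp w circle1 -> ~ sing_supp w circleN1 ->
  exists sigma G : T -> C,
    [/\ multiplier sigma 1, forall z, conjc (sigma z) = sigma z &
        forall z, sigma (circle_conj z) = - sigma z] /\
    [/\ smooth_circle n.+1 sigma, smooth_circle n.+1 G &
        {ae m, forall z, w z - sigma z ^+ 2 * w z = G z}].
Proof.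
move=> /not_sing_supp[X1 [g1 [cX1 nX1 g1X wg1]]] /not_sing_supp[X2 [g2 [cX2 nX2 g2X wg2]]].
have [e1 e10 near1] : exists2 eps, 0 < eps &
    forall z, `|ImC (z : C)| < eps -> 0 < 1 * ReC (z : C) -> ~ X1 z.
  apply: near_point => //; first exact: expr1n.
  by move=> z z1; rewrite (_ : z = circle1)//; exact: val_inj.
have [e2 e20 near2] : exists2 eps, 0 < eps &
    forall z, `|ImC (z : C)| < eps -> 0 < -1 * ReC (z : C) -> ~ X2 z.
  apply: near_point => //; first by rewrite sqrrN expr1n.
  move=> z z1; rewrite (_ : z = circleN1)//; apply: val_inj.
  by rewrite /= z1 rmorphN1.
(* The bound by 1 keeps ['i] and [- 'i], where the real part vanishes, out of the arcs
   [|Im z| < e]. *)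
pose e := Num.min 1 (Num.min e1 e2).
have e0 : 0 < e by rewrite !lt_min ltr01 e10.
have [e_1 ee1 ee2] : [/\ e <= 1, e <= e1 & e <= e2] by rewrite /e !ge_min !lexx !orbT.
(* As [eps < e], the regions [|sin t| < e] and [|sin t| > eps] overlap, so that the open sets [V1],
   [V2] and [V3] below cover the line. *)
pose eps := e / 2; have eps0 : 0 < eps by rewrite divr_gt0.
have epse : eps < e by rewrite /eps ltr_pdivrMr// ltr_pMr// ltr1n.
pose s := smooth_sign eps n.+1.
pose sigma z : C := (s (ImC (z : C)))%:C.
pose g z : C := if 0 < ReC (z : C) then g1 z else g2 z.
pose G z : C := (1 - s (ImC (z : C)) ^+ 2)%:C * g z.
have s_sin : differentiable_n n.+1 setT (fun t => s (sin t)).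
  exact: differentiable_n_smooth_sign.
have sigma_smooth : smooth_circle n.+1 sigma.
  by split=> //; exact: differentiable_n_cst.
exists sigma, G; split; split=> //.
- split=> //; last by apply: nearW => z; rewrite cabs_real smooth_sign_le1.
  by apply: continuous_cmeasurable;
    [exact: (differentiable_n_continuous sigma_smooth.1)|
     exact: (differentiable_n_continuous sigma_smooth.2)].
- by move=> z; rewrite /sigma conjc_real.
- move=> z; rewrite /sigma (_ : ImC _ = - ImC (z : C)) ?[s _]smooth_signN ?rmorphN//.
  by rewrite /=; case: (circle_val z).
- pose V1 := [set t | 0 < e ^+ 2 - sin t ^+ 2 :> R] `&` [set t | 0 < cos t :> R].
  pose V2 := [set t | 0 < e ^+ 2 - sin t ^+ 2 :> R] `&` [set t | 0 < - cos t :> R].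
  pose V3 := [set t | 0 < sin t ^+ 2 - eps ^+ 2 :> R].
  have cs (c : R) : continuous (fun t : R => sin t ^+ 2 - c).
    have [h _] := differentiable_n_sincos 1 (setT : set R).
    apply: (@differentiable_n_continuous R 0); apply: differentiable_nD.
      by under eq_fun do rewrite expr2; exact: differentiable_nM.
    exact: differentiable_n_cst.
  have cN (f : R -> R) : continuous f -> continuous (fun t => - f t).
    by move=> cf t; apply: (@cvgN _ R^o); exact: cf.
  have oc : open [set t : R | 0 < e ^+ 2 - sin t ^+ 2].
    rewrite (_ : [set t | _] = [set t | 0 < - (sin t ^+ 2 - e ^+ 2) :> R]).
      exact: open_gt0 (cN _ (cs _)).
    by apply/seteqP; split=> t /=; rewrite opprB.
  have o1 : open V1 by apply: openI => //; apply: open_gt0; exact: continuous_cos.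
  have o2 : open V2.
    by apply: openI => //; exact: open_gt0 (cN _ (@continuous_cos R)).
  have o3 : open V3 by apply: open_gt0; exact: cs.
  have small t : 0 < e ^+ 2 - sin t ^+ 2 -> `|sin t| < e.
    rewrite subr_gt0 => h; rewrite -(@ltr_pXn2r _ 2)// ?nnegrE ?(ltW e0)//.
    by rewrite real_normK ?num_real.
  have VT : V1 `|` V2 `|` V3 = setT.
    apply/seteqP; split=> // t _; rewrite /V1 /V2 /V3 /=.
    have [h|h] := ltP (eps ^+ 2) (sin t ^+ 2); first by right; rewrite subr_gt0.
    left; have h' : 0 < e ^+ 2 - sin t ^+ 2.
      by rewrite subr_gt0 (le_lt_trans h)// ltr_pXn2r// nnegrE ltW.
    have [c0|c0|c0] := ltgtP 0 (cos t); [by left|by right; rewrite oppr_gt0|exfalso].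
    have := cos2Dsin2 t; rewrite -c0 expr0n add0r => s1.
    by move: h'; rewrite s1 subr_gt0 expr_gt1 ?(ltW e0)// ltNge e_1.
  have f1 : differentiable_n n.+1 setT (fun t => 1 - s (sin t) ^+ 2).
    apply: differentiable_nD; first exact: differentiable_n_cst.
    by apply: differentiable_nN; under eq_fun do rewrite expr2; exact: differentiable_nM.
  have [r1 i1] : differentiable_n n.+1 V1 (fun t => ReC (g1 (expi t))) /\
      differentiable_n n.+1 V1 (fun t => ImC (g1 (expi t))).
    apply: smooth_on_differentiable g1X _ => t [/small st ct].
    by apply: near1; rewrite ?mul1r//= (lt_le_trans st).
  have [r2 i2] : differentiable_n n.+1 V2 (fun t => ReC (g2 (expi t))) /\
      differentiable_n n.+1 V2 (fun t => ImC (g2 (expi t))).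
    apply: smooth_on_differentiable g2X _ => t [/small st ct].
    by apply: near2; rewrite ?mulN1r//= (lt_le_trans st).
  have glue (p : C -> R) : (forall (c : R) u, p (c%:C * u) = c * p u) ->
      differentiable_n n.+1 V1 (fun t => p (g1 (expi t))) ->
      differentiable_n n.+1 V2 (fun t => p (g2 (expi t))) ->
      differentiable_n n.+1 setT (fun t => p (G (expi t))).
    move=> pM d1 d2; rewrite -VT; apply: differentiable_nU => //; first exact: openU.
      apply: differentiable_nU => //.
        apply: (@differentiable_n_eq _ _ _ (fun t => (1 - s (sin t) ^+ 2) * p (g1 (expi t)))) => //.
          by move=> t [_ /= ct]; rewrite pM /g /= ct.
        by apply: differentiable_nM => //; exact: differentiable_n_sub f1.
      apply: (@differentiable_n_eq _ _ _ (fun t => (1 - s (sin t) ^+ 2) * p (g2 (expi t)))) => //.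
        by move=> t [_ /= ct]; rewrite pM /g /= ltNge -oppr_ge0 (ltW ct).
      by apply: differentiable_nM => //; exact: differentiable_n_sub f1.
    (* On [V3] the factor [1 - s ^ 2] is 0, which hides the possible jump of [g] where the real part
       changes sign. *)
    apply: (@differentiable_n_eq _ _ _ (fun=> 0)) => //; last exact: differentiable_n_cst.
    move=> t; rewrite /V3 /= subr_gt0 => h; rewrite pM /= [X in _ - X]smooth_sign_sqr ?subrr ?mul0r//.
    by rewrite -(@ler_pXn2r _ 2)// ?nnegrE ?(ltW eps0)// real_normK ?num_real// ltW.
  by split; apply: glue => // c [x y] /=; rewrite mul0r ?subr0 ?addr0.
- apply: filterS2 wg1 wg2 => z w1 w2.
  rewrite /sigma -rmorphXn -{1}[w z]mul1r -mulrBl -(rmorph1 (real_complex R)) -rmorphB.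
  rewrite /G; have [h|h] := leP eps `|ImC (z : C)|.
    by rewrite smooth_sign_sqr// subrr !mul0r.
  congr (_ * _); rewrite /g; have he := lt_trans h epse.
  have xy : ReC (z : C) ^+ 2 + ImC (z : C) ^+ 2 = 1.
    have := circle_norm z; case: (circle_val z) => x y; rewrite normc_def /= => /eqP/complexI q.
    by rewrite -[LHS]sqr_sqrtr ?addr_ge0 ?sqr_ge0// q expr1n.
  have [c0|c0|c0] := ltgtP 0 (ReC (z : C)).
  + by apply: w1; apply: near1; rewrite ?mul1r// (lt_le_trans he).
  + by apply: w2; apply: near2; rewrite ?mulN1r ?oppr_gt0// (lt_le_trans he).
  + exfalso; move: xy; rewrite -c0 expr0n add0r -[X in X = _]real_normK ?num_real// => /eqP.
    by rewrite lt_eqF// expr_lt1// (lt_le_trans he).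
Qed.

End cutoff.

(** Since [N p >= 2], the sequence is at most a constant over [n + 1]: the 4 bounds the square of
    [(n + 2) / (n + 1)], and the power of [a] accounts for the separate value at 0. *)
Lemma cvg_powR_inv_exp (R : realType) (p a c : R) N : 0 < p -> 0 <= c -> 2 <= N%:R * p ->
  (fun n => n.+1%:R * (if n is 0 then a else c / n%:R ^+ N) `^ p) @ \oo --> (0 : R).
Proof.
move=> p0 c0 Np; pose K := a `^ p + 4 * c `^ p.
apply: (@squeeze_cvgr _ _ _ _ (fun=> 0) (fun n => K * harmonic n)).
- apply: nearW => n; rewrite mulr_ge0 ?powR_ge0//=.
  rewrite -[n.+1%:R * _]mulr1 -{3}(@mulfV _ n.+1%:R) ?pnatr_eq0// mulrA ler_wpM2r ?invr_ge0//.
  case: n => [|n]; first by rewrite !mul1r mulr1 lerDl mulr_ge0// powR_ge0.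
  have n0 : 0 < n.+1%:R^-1 :> R by rewrite invr_gt0.
  have n1 : n.+1%:R^-1 <= 1 :> R by rewrite invf_le1// ler1n.
  have -> : (c / n.+1%:R ^+ N) `^ p = c `^ p * n.+1%:R^-1 `^ (N%:R * p).
    by rewrite powRM ?invr_ge0 ?exprn_ge0// -exprVn powRrM powR_mulrn// ltW.
  have h : n.+1%:R^-1 `^ (N%:R * p) <= n.+1%:R^-1 ^+ 2.
    by rewrite -powR_mulrn ?(ltW n0)//; apply: ger_powR; rewrite ?n0.
  have cp : 0 <= c `^ p by exact: powR_ge0.
  have n2 : n.+2%:R * n.+1%:R^-1 <= 2 :> R.
    by rewrite ler_pdivrMr// -natrM ler_nat mul2n -addnn addSn addnS !ltnS leq_addr.
  have -> : n.+2%:R * (c `^ p * n.+1%:R^-1 `^ (N%:R * p)) * n.+2%:R =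
      c `^ p * (n.+2%:R ^+ 2 * n.+1%:R^-1 `^ (N%:R * p)) by ring.
  apply: (@le_trans _ _ (c `^ p * 4)); last by rewrite /K mulrC lerDr powR_ge0.
  rewrite ler_wpM2l//; apply: le_trans (ler_wpM2l (sqr_ge0 _) h) _.
  rewrite -exprMn (_ : 4 = 2 ^+ 2); last by rewrite -natrX.
  by rewrite ler_pXn2r ?nnegrE ?mulr_ge0// ltW.
- exact: cvg_cst.
- rewrite -[X in _ --> X](mulr0 K).
  by apply: cvgM; [exact: cvg_cst|exact: cvg_harmonic].
Qed.

Theorem theorem4p1 (R : realType) (w : circle R -> R[i]) (p : R)
    (w_Linfty : w \in Lp +oo%E)
    (w_sym : {ae @arc_measure R, forall z, (w z)^* = w (circle_conj z)})
    (ss1 : ~ sing_supp w circle1)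
    (ssN1 : ~ sing_supp w circleN1)
    (H_compact : compact_op (@H2_dot R) (hankel w))
    (p_gt0 : 0 < p) :
  [/\ Delta_plus p (hankel w) = Delta_minus p (hankel w),
      Delta_minus p (hankel w) =
        ((2^-1 : R)%:E * Delta (@H2_dot R) p (hankel w))%E,
      delta_plus p (hankel w) = delta_minus p (hankel w) &
      delta_minus p (hankel w) =
        ((2^-1 : R)%:E * delta (@H2_dot R) p (hankel w))%E].
Proof.
have [M wM] := Linfty_multiplier w_Linfty; have M0 : 0 <= M by case: wM.
pose N := (Num.truncn (2 / p)).+1.
have Np : 2 <= N%:R * p by rewrite -ler_pdivrMr// ltW// lt_truncnS// divr_ge0// ltW.
(* The argument [N.+2] gives smoothness of order [N.+3], which [trig_approximation] consumes for a
   remainder of size [m ^- N]. *)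
have [sigma [G [[sigma1 sigma_real sigma_odd] [ssm Gsm GE]]]] :=
  exists_cutoff N.+2 ss1 ssN1.
have [c1 c10 happrox1] := trig_approximation ssm.
have [c2 c20 happrox2] := trig_approximation Gsm.
have [K GK] : exists K, multiplier G K.
  apply: smooth_multiplier; have [] := Gsm.
  by move=> gr gi; split; [apply: differentiable_n_le gr|apply: differentiable_n_le gi].
have Hlin := hankel_linear wM; have Hb := hankel_bounded wM.
have Hsym := hankel_symmetric wM w_sym; have H2c := @H2_hcomplete R.
pose c := 2 * M * c1 + c2; have c_ge0 : 0 <= c by rewrite addr_ge0// !mulr_ge0.
(* The approximation requires [m > 0]; for [m = 0] the trivial bound [M + M] of the two forms is
   used. Afterwards [c] combines the errors [2 * M * c1] from [sigma] and [c2] from [G]. *)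
pose eps n := if n is 0 then 2 * M else c / n%:R ^+ N.
have eps_ge0 n : 0 <= eps n.
  by case: n => [|n]; rewrite /eps ?mulr_ge0// divr_ge0// exprn_ge0.
have shift n m : lambda_plus (hankel w) (n + m) <= lambda_minus (hankel w) n + eps m /\
    lambda_minus (hankel w) (n + m) <= lambda_plus (hankel w) n + eps m.
  have Tlin := toeplitz_linear sigma1; have TN := toeplitz_contraction sigma1.
  apply: (lambda_shift Hlin Hsym Hb H_compact (u := fun j => MkH2 (monomial_H2 R j))
    Tlin TN n (eps_ge0 m)) => x xo.
  case: m xo => [|m] xo.
    apply: le_trans (ler_normD _ _) _.
    have h y : `|rdot (@H2_dot R) (hankel w y) y| <= M * hnorm (@H2_dot R) y ^+ 2.
      apply: le_trans (normr_rdot_le _ _ _) _; rewrite expr2 mulrA.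
      by rewrite ler_wpM2r ?hnorm_ge0.
    apply: le_trans (lerD (h _) (h _)) _.
    rewrite /eps -mulrA [2 * _]mulr_natl mulr2n lerD// ler_wpM2l//.
    by rewrite ler_pXn2r ?nnegrE ?hnorm_ge0.
  have [s1 [s1m hs1]] := happrox1 m.+1 isT; have [s2 [s2m hs2]] := happrox2 m.+1 isT.
  have -> : eps m.+1 = 2 * M * (c1 / m.+1%:R ^+ N) + c2 / m.+1%:R ^+ N.
    by rewrite /eps /c mulrDl mulrA.
  by apply: (hankel_sign_flip wM sigma1 sigma_real sigma_odd GE GK _ xo s1m s2m _ _ hs1 hs2);
    rewrite ?divr_ge0 ?exprn_ge0.
have eps_cvg := @cvg_powR_inv_exp R p (2 * M) c N p_gt0 c_ge0 Np.
have a0 := lambda_plus_ge0 Hlin Hsym Hb H_compact.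
have b0 := lambda_minus_ge0 Hlin Hsym Hb H_compact.
have ad := lambda_plus_nonincr Hlin Hsym Hb H_compact.
have bd := lambda_minus_nonincr Hlin Hsym Hb H_compact.
have s0 := singular_values_ge0 H2c Hlin Hsym Hb H_compact.
have sd := singular_values_nonincr H2c Hlin Hsym Hb H_compact.
have smax n : singular_values (@H2_dot R) (hankel w) n.*2 <=
    Num.max (lambda_plus (hankel w) n) (lambda_minus (hankel w) n).
  by rewrite -addnn; exact: (singular_values_le_max H2c Hlin Hsym Hb H_compact).
have smin n : Num.min (lambda_plus (hankel w) n) (lambda_minus (hankel w) n) <=
    singular_values (@H2_dot R) (hankel w) n.*2.+1.
  by rewrite -addnn; exact: (min_le_singular_values H2c Hlin Hsym Hb H_compact).
have [hp1 hp2] := half_asymptotics p_gt0 a0 b0 s0 eps_ge0 ad bd sd smin smax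
  (fun n m => (shift n m).1) (fun n m => (shift n m).2) eps_cvg.
have smin' n : Num.min (lambda_minus (hankel w) n) (lambda_plus (hankel w) n) <=
    singular_values (@H2_dot R) (hankel w) n.*2.+1 by rewrite minC; exact: smin.
have smax' n : singular_values (@H2_dot R) (hankel w) n.*2 <=
    Num.max (lambda_minus (hankel w) n) (lambda_plus (hankel w) n).
  by rewrite maxC; exact: smax.
have [hm1 hm2] := half_asymptotics p_gt0 b0 a0 s0 eps_ge0 bd ad sd smin' smax'
  (fun n m => (shift n m).2) (fun n m => (shift n m).1) eps_cvg.
by split; rewrite /Delta_plus /Delta_minus /delta_plus /delta_minus ?hp1 ?hp2 ?hm1 ?hm2.
Qed.
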